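(* Let $A$ be a normal operator in a complex Hilbert space $X$. Then $A$ generates an eventually differentiable $C_0$-semigroup $\{T(t)\}_{t\ge0}$ (of normal operators) on $X$ if and only if there exist $\omega\in\mathbb{R}$, $a>0$, and $b>0$ such that $$\sigma(A)\subseteq\{\lambda\in\mathbb{C} : \operatorname{Re}\lambda\le\min(\omega,\,a-b\ln|\operatorname{Im}\lambda|)\},$$ in which case (i.e., for any such $b$) the orbits $[0,\infty)\ni t\mapsto T(t)f\in X$ are strongly differentiable on $[b^{-1},\infty)$ for all $f\in X$.
   Context: Normal operators are allowed to be unbounded (densely defined, closed, $A^*A=AA^*$); $\sigma(A)$ is the spectrum. A $C_0$-semigroup $\{T(t)\}_{t\ge 0}$ on $X$ is eventually differentiable if there exists $t_0>0$ such that, for every $f\in X$, the orbit map $[0,\infty)\ni t\mapsto T(t)f\in X$ is differentiable (in the norm of $X$) on $[t_0,\infty)$. Convention: $\ln 0=-\infty$, so that for real $\lambda$ the minimum equals $\omega$. *)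

(* Defs.v *)
From HB Require Import structures.
From mathcomp Require Import all_boot all_order all_algebra sesquilinear.
From mathcomp.real_closed Require Import complex.
From mathcomp Require Import all_classical all_reals all_analysis.
Set Implicit Arguments.
Unset Strict Implicit.
Unset Printing Implicit Defensive.
Import Order.TTheory GRing.Theory Num.Theory numFieldNormedType.Exports.

Local Open Scope classical_set_scope.
Local Open Scope complex_scope.
Local Open Scope ring_scope.

(** Unbounded operators in [X] are represented by their graphs: [A (x, y)]
    means that [x] is in the domain of [A] and [A x = y].  Equality of
    operators, domains included, is then equality of sets. *)

Section Operators.
Context {R : realType} {X : completeNormedModType R[i]}.
Implicit Types A B : set (X * X).

Definition linear_operator A : Prop :=
  [/\ A (0, 0),
      forall (c : R[i]) p q, A p -> A q -> A (c *: p + q)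
    & forall x y z, A (x, y) -> A (x, z) -> y = z].

Definition domain A : set X := [set x | exists y, A (x, y)].

Definition graph_of (S : X -> X) : set (X * X) := [set p | p.2 = S p.1].

(** [op_comp B A] is [B A], with domain [{x in D(A) | A x in D(B)}]. *)
Definition op_comp B A : set (X * X) :=
  [set p | exists2 y, A (p.1, y) & B (y, p.2)].

(** The pairs [(y, z)] such that [<A x, y> = <x, z>] for all [x] in [D(A)];
    it is the graph of an operator as soon as [A] is densely defined. *)
Definition adjoint (dot : {dot X for @Num.conj R[i]}) A : set (X * X) :=
  [set p | forall x w, A (x, w) -> dot w p.1 = dot x p.2].

Definition normal_operator (dot : {dot X for @Num.conj R[i]}) A : Prop :=
  [/\ linear_operator A, dense (domain A), closed A
    & op_comp (adjoint dot A) A = op_comp A (adjoint dot A)].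

(** [l] is in the resolvent set when [l - A : D(A) -> X] has an everywhere
    defined bounded inverse [S]. *)
Definition resolvent_set A : set R[i] :=
  [set l | exists2 S : {linear X -> X}, continuous S &
     forall f x, (exists2 y, A (x, y) & l *: x - y = f) <-> x = S f].

Definition spectrum A : set R[i] := ~` resolvent_set A.

End Operators.

(** Semigroups are indexed by all of [R], but only their values at
    nonnegative times are constrained or used. *)

Section Semigroups.
Context {R : realType} {X : completeNormedModType R[i]}.
Implicit Types T : R -> {linear X -> X}.

Definition C0_semigroup T : Prop :=
  [/\ forall t, 0 <= t -> continuous (T t),
      T 0 =1 id,
      forall s t, 0 <= s -> 0 <= t -> T (s + t) =1 T s \o T t
    & forall f, T t f @[t --> 0^'+] --> f].

Definition generator T : set (X * X) :=
  [set p | (h^-1)%:C *: (T h p.1 - p.1) @[h --> 0^'+] --> p.2].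

Definition generates (A : set (X * X)) T : Prop :=
  C0_semigroup T /\ generator T = A.

(** Norm differentiability at [t] of a map defined on [[0, +oo[]. *)
Definition orbit_differentiable_at (u : R -> X) (t : R) : Prop :=
  exists g : X,
    ((s - t)^-1)%:C *: (u s - u t) @[s --> within `[0, +oo[ t^'] --> g.

Definition eventually_differentiable T : Prop :=
  exists2 t0 : R, 0 < t0 &
    forall (f : X) (t : R), t0 <= t -> orbit_differentiable_at (T ^~ f) t.

End Semigroups.

(** Since [lne 0 = -oo], the minimum is [w] when [l] is real. *)
Definition log_region {R : realType} (w a b : R) : set R[i] :=
  [set l | ((complex.Re l)%:E <=
            mine w%:E (a%:E - b%:E * lne `|complex.Im l|%:E))%E].

(* Main.v *)
Require Import Defs.
From HB Require Import structures.
From mathcomp Require Import all_boot all_order all_algebra sesquilinear.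
From mathcomp.real_closed Require Import complex.
From mathcomp Require Import all_classical all_reals all_analysis.
From mathcomp Require Import ring lra.
Set Implicit Arguments.
Unset Strict Implicit.
Unset Printing Implicit Defensive.
Import Order.TTheory GRing.Theory Num.Theory numFieldNormedType.Exports.

Local Open Scope classical_set_scope.
Local Open Scope complex_scope.
Local Open Scope ring_scope.

(** No spectral theorem is used. For a normal [A], the projection theorem gives
    [D(A) = D(A* )] and [|A x| = |A* x|], so that the spectrum consists of
    approximate eigenvalues. If [J] is a bounded normal operator and [F] commutes
    with [J], approximate null vectors of [F] can be refined to approximate
    eigenvectors of [J], by averaging [z^k J^k x] over [k]. Hence a bounded [N]
    in the bicommutant of [A] is bounded, up to a constant, by the numbers [mu]
    such that [(mu, l)] is a joint approximate eigenvalue of [(N, A)].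

    This bounds the resolvents by the inverse distance to a half-plane containing
    the spectrum; implicit Euler steps along dyadic subdivisions then converge to
    a semigroup, which is the only one generated by [A] and lies in the
    bicommutant. On a joint approximate eigenvector [T t] acts as [exp (t l)]:
    boundedness of [A T(t0)] then yields the logarithmic region, and conversely
    the region bounds the left difference quotients of [T] at [b^-1] uniformly,
    which extends differentiability of the orbits from [D(A)] to [X]. *)

(** * Real-valued norms and convergence *)

Section RealNorm.
Context {R : realType}.

(** The decisive estimates are scalar. On the region, [|Im l| <= exp ((a - Re l) / b)], so
    [|l| exp (t Re l)] is bounded for [t = b^-1]: this is where the critical time comes from. The
    obstacle is to pass between such bounds and operator norms. From operators to scalars, an
    approximate eigenvector of [A] is enough. From scalars to operators one needs vectors that are
    approximately eigen for [N] and for [A] at once, and [A] is unbounded. So the bounded pair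
    [(N S, S)] is treated instead, with [S] a resolvent, and the factor [S] is removed afterwards by
    letting an Euler step become small. This costs a constant factor, which a boundedness argument
    tolerates. At the endpoint [b^-1] the operator [A T(t)] is bounded, but for [t < b^-1] it need
    not be. Left difference quotients therefore cannot be estimated as averages of [A T(s)]; their
    bound compares [h] with [1 / |l|]. *)

(** Norms of [X] take values in [R[i]], which is only partially ordered. Reading them in [R] gives
    access to a total order, suprema and [lra]. *)
Definition nrm {V : normedZmodType R[i]} (x : V) : R := complex.Re `|x|.

Section Normed.
Context {V : normedZmodType R[i]}.
Implicit Types x y : V.

Lemma normE x : `|x| = (nrm x)%:C.
Proof. by rewrite /nrm RRe_real ?normr_real. Qed.

Lemma nrm_ge0 x : 0 <= nrm x.
Proof. by rewrite -lecR -normE normr_ge0. Qed.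

Lemma nrm0 : nrm (0 : V) = 0.
Proof. by rewrite /nrm normr0. Qed.

Lemma nrm_eq0 x : (nrm x == 0) = (x == 0).
Proof. by rewrite -(inj_eq (@complexI R)) -normE normr_eq0. Qed.

Lemma nrm_gt0 x : (0 < nrm x) = (x != 0).
Proof. by rewrite lt_def nrm_eq0 nrm_ge0 andbT. Qed.

Lemma nrmN x : nrm (- x) = nrm x.
Proof. by rewrite /nrm normrN. Qed.

Lemma nrmC x y : nrm (x - y) = nrm (y - x).
Proof. by rewrite -nrmN opprB. Qed.

Lemma nrmD x y : nrm (x + y) <= nrm x + nrm y.
Proof. by rewrite -lecR rmorphD /= -!normE ler_normD. Qed.

Lemma nrmB x y : nrm (x - y) <= nrm x + nrm y.
Proof. by rewrite -(nrmN y) nrmD. Qed.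

Lemma nrm_sub y x z : nrm (x - z) <= nrm (x - y) + nrm (y - z).
Proof. by rewrite (le_trans _ (nrmD _ _)) // addrA subrK. Qed.

Lemma nrm_lerB x y : nrm x - nrm y <= nrm (x - y).
Proof. by rewrite lerBlDr -{1}(subrK y x) nrmD. Qed.

Lemma nrm_sum I (r : seq I) (P : pred I) (u : I -> V) :
  nrm (\sum_(i <- r | P i) u i) <= \sum_(i <- r | P i) nrm (u i).
Proof.
elim/big_rec2 : _ => [|i a b _ h]; first by rewrite nrm0.
by rewrite (le_trans (nrmD _ _)) // lerD2l.
Qed.

End Normed.

Implicit Types (z w : R[i]) (r : R).

Lemma nrmM z w : nrm (z * w) = nrm z * nrm w.
Proof. by apply: complexI; rewrite rmorphM /= -!normE normrM. Qed.

Lemma nrmV z : nrm z^-1 = (nrm z)^-1.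
Proof. by apply: complexI; rewrite fmorphV /= -!normE normfV. Qed.

Lemma nrmX z n : nrm (z ^+ n) = nrm z ^+ n.
Proof. by apply: complexI; rewrite rmorphXn /= -!normE normrX. Qed.

Lemma nrm1 : nrm (1 : R[i]) = 1.
Proof. by rewrite /nrm normr1. Qed.

Lemma nrmR r : nrm r%:C = `|r|.
Proof. by rewrite /nrm normc_def /= expr0n addr0 sqrtr_sqr. Qed.

Lemma nrmJ z : nrm z^* = nrm z.
Proof. by rewrite /nrm normcJ. Qed.

Lemma sqr_nrm z : nrm z ^+ 2 = complex.Re z ^+ 2 + complex.Im z ^+ 2.
Proof. by apply: complexI; rewrite rmorphXn /= -normE -add_Re2_Im2. Qed.

Lemma nrm_Re z : `|complex.Re z| <= nrm z.
Proof. by rewrite -lecR -normE normc_ge_Re. Qed.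

Lemma nrm_Im z : `|complex.Im z| <= nrm z.
Proof.
rewrite -(@ler_pXn2r _ 2) ?nnegrE ?nrm_ge0 // sqr_nrm real_normK ?num_real //.
by rewrite lerDr sqr_ge0.
Qed.

Lemma nrm_ReIm z : nrm z <= `|complex.Re z| + `|complex.Im z|.
Proof.
rewrite -(@ler_pXn2r _ 2) ?nnegrE ?nrm_ge0 ?addr_ge0 // sqr_nrm sqrrD.
rewrite !real_normK ?num_real // lerD2r lerDl.
by rewrite mulrn_wge0 // mulr_ge0.
Qed.

Lemma nrmZ {V : normedModType R[i]} z (x : V) : nrm (z *: x) = nrm z * nrm x.
Proof. by apply: complexI; rewrite rmorphM /= -!normE normrZ. Qed.

End RealNorm.

Section Convergence.
Context {R : realType} {X : normedModType R[i]}.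

Lemma cvg_nrmP {I : Type} (F : set_system I) {FF : Filter F} (u : I -> X) (l : X) :
  u @ F --> l <-> forall e : R, 0 < e -> \forall i \near F, nrm (u i - l) < e.
Proof.
rewrite cvgrPdist_lt; split=> h e e0.
  have := h e%:C; rewrite ltcR => /(_ e0); apply: filterS => i.
  by rewrite normE ltcR nrmC.
(* A positive element of [R[i]] is real, so radii in [R] suffice. *)
have er : (complex.Re e)%:C = e by rewrite RRe_real // gtr0_real.
rewrite -er in e0 *; rewrite ltcR in e0.
have := h _ e0; apply: filterS => i.
by rewrite normE ltcR nrmC.
Qed.

Lemma cvg_nrm {I : Type} (F : set_system I) {FF : Filter F} (u : I -> X) (l : X) :
  u @ F --> l <-> nrm (u i - l) @[i --> F] --> (0 : R).
Proof.
rewrite cvg_nrmP cvgr0Pnorm_lt; split=> h e e0; have := h e e0;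
  by apply: filterS => i; rewrite ger0_norm ?nrm_ge0.
Qed.

Lemma seq_cvgP (u : nat -> X) (l : X) :
  u @ \oo --> l <->
  forall e : R, 0 < e -> exists N, forall n, (N <= n)%N -> nrm (u n - l) < e.
Proof.
by rewrite cvg_nrmP; split=> h e /h [N] => [_ hN|hN]; exists N => // n;
  apply: hN.
Qed.

Lemma right_cvgP (u : R -> X) (l : X) :
  u t @[t --> 0^'+] --> l <->
  forall e, 0 < e ->
    exists2 d, 0 < d & forall t, 0 < t -> t < d -> nrm (u t - l) < e.
Proof.
rewrite cvg_nrmP; split=> h e /h.
  case=> d /= d0 hd; exists d => // t t0 td; apply: hd => //.
  by rewrite /ball_ /= sub0r normrN gtr0_norm.
case=> d d0 hd; exists d => //= t.
by rewrite /ball_ /= sub0r normrN => td t0; apply: hd; rewrite // -(gtr0_norm t0).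
Qed.

Lemma cvg_seq_right (u : R -> X) (l : X) (v : nat -> R) :
  u t @[t --> 0^'+] --> l -> (forall n, 0 < v n) -> v @ \oo --> (0 : R) ->
  (u (v n)) @[n --> \oo] --> l.
Proof.
move=> /right_cvgP h v0 vc; apply/seq_cvgP => e /h [d d0 hd].
have /cvgr0Pnorm_lt/(_ d d0) [N _ hN] := vc.
by exists N => n /hN /=; rewrite gtr0_norm ?v0 // => ?; apply: hd.
Qed.

Lemma cvg_nrm_comp {I : Type} (F : set_system I) {FF : Filter F} (u : I -> X)
    (l : X) :
  u @ F --> l -> nrm (u i) @[i --> F] --> nrm l.
Proof.
move=> /cvg_nrmP h; apply/cvgrPdist_lt => e /h; apply: filterS => i; apply: le_lt_trans.
rewrite ler_norml lerNl opprB nrm_lerB /=.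
by have := nrm_lerB l (u i); rewrite nrmC.
Qed.

Lemma nlim_uniq {I : Type} (F : set_system I) {FF : ProperFilter F}
    (u : I -> X) (l l' : X) : u @ F --> l -> u @ F --> l' -> l = l'.
Proof. by move=> ul ul'; apply: (norm_cvg_unique ul ul'). Qed.

Lemma nrm_le_lim {I : Type} (F : set_system I) {FF : ProperFilter F}
    (u : I -> X) (l : X) (c : R) :
  u @ F --> l -> (\forall i \near F, nrm (u i) <= c) -> nrm l <= c.
Proof.
move=> /cvg_nrmP h uc; apply/ler_addgt0Pr => e /h ue.
near F => i; have ui : nrm (u i) <= c by near: i.
have : nrm (u i - l) < e by near: i.
have := nrm_lerB l (u i); rewrite (nrmC l); lra.
Unshelve. all: by end_near. Qed.

End Convergence.

Section Complete.
Context {R : realType} {X : completeNormedModType R[i]}.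

Lemma complete_seq (u : nat -> X) :
  (forall e : R, 0 < e -> exists N, forall m n,
     (N <= m)%N -> (N <= n)%N -> nrm (u m - u n) < e) ->
  exists l : X, u @ \oo --> l.
Proof.
move=> h; suff : cvg (u @ \oo) by move=> ?; exists (lim (u @ \oo)).
apply: cauchy_cvg; apply: cauchy_exP => e e0.
have er : (complex.Re e)%:C = e by rewrite RRe_real // gtr0_real.
rewrite -er in e0 *; rewrite ltcR in e0.
have [N hN] := h _ e0; exists (u N); exists N => // n /= Nn.
by rewrite -ball_normE /ball_ /= normE ltcR hN.
Qed.

Lemma complete_le (u : nat -> X) (v : nat -> R) :
  v @ \oo --> (0 : R) ->
  (forall m n, (m <= n)%N -> nrm (u m - u n) <= v m) -> exists l : X, u @ \oo --> l.
Proof.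
move=> /cvgr0Pnorm_lt v0 uv; apply: complete_seq => e e0.
have [N _ hN] := v0 e e0; exists N => m n Nm Nn.
wlog mn : m n Nm Nn / (m <= n)%N.
  by case: (leqP m n) => [|/ltnW] mn; [|rewrite nrmC]; apply.
by rewrite (le_lt_trans (uv _ _ mn)) // (le_lt_trans (ler_norm _)) // hN.
Qed.

End Complete.

(** * Orthogonal projection *)

Section Hilbert.
Context {R : realType} {X : completeNormedModType R[i]}
        {dot : {dot X for @Num.conj R[i]}}
        (norm_dot : forall x : X, `|x| ^+ 2 = dot x x).
Implicit Types (x y z : X) (c : R[i]).

Definition rdot x y : R := complex.Re (dot x y).

Lemma dotC x y : dot x y = (dot y x)^*.
Proof. by rewrite hermC expr0 mul1r. Qed.

Lemma dotDl x y z : dot (x + y) z = dot x z + dot y z.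
Proof. by rewrite linearDl. Qed.

Lemma dotBl x y z : dot (x - y) z = dot x z - dot y z.
Proof. by rewrite linearBl. Qed.

Lemma dotZl c x z : dot (c *: x) z = c * dot x z.
Proof. by rewrite linearZl_LR. Qed.

Lemma dotNl x y : dot (- x) y = - dot x y.
Proof. by rewrite linearNl. Qed.

Lemma dotNr x y : dot x (- y) = - dot x y.
Proof. by rewrite linearNr. Qed.

Lemma dotDr x y z : dot z (x + y) = dot z x + dot z y.
Proof. by rewrite linearDr. Qed.

Lemma dotBr x y z : dot z (x - y) = dot z x - dot z y.
Proof. by rewrite linearBr. Qed.

Lemma dotZr c x z : dot z (c *: x) = c^* * dot z x.
Proof. by rewrite linearZr_LR. Qed.

Lemma dot0l x : dot 0 x = 0.
Proof. by rewrite linear0l. Qed.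

Lemma dot0r x : dot x 0 = 0.
Proof. by rewrite linear0r. Qed.

Lemma rdotC x y : rdot x y = rdot y x.
Proof. by rewrite /rdot dotC; case: (dot y x). Qed.

Lemma rdotDl x y z : rdot (x + y) z = rdot x z + rdot y z.
Proof. by rewrite /rdot dotDl raddfD. Qed.

Lemma rdotBl x y z : rdot (x - y) z = rdot x z - rdot y z.
Proof. by rewrite /rdot dotBl raddfB. Qed.

Lemma rdotDr x y z : rdot z (x + y) = rdot z x + rdot z y.
Proof. by rewrite /rdot dotDr raddfD. Qed.

Lemma rdotBr x y z : rdot z (x - y) = rdot z x - rdot z y.
Proof. by rewrite /rdot dotBr raddfB. Qed.

Lemma rdotZ (r : R) x y : rdot (r%:C *: x) y = r * rdot x y.
Proof. by rewrite /rdot dotZl; case: (dot x y) => a b /=; rewrite mul0r subr0. Qed.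

Lemma nrm2 x : nrm x ^+ 2 = rdot x x.
Proof.
apply: complexI.
by rewrite rmorphXn /= -normE norm_dot /rdot -norm_dot normE -rmorphXn.
Qed.

Lemma dotxx x : dot x x = (nrm x ^+ 2)%:C.
Proof. by rewrite -norm_dot normE -rmorphXn. Qed.

Lemma nrm2D x y : nrm (x + y) ^+ 2 = nrm x ^+ 2 + 2 * rdot x y + nrm y ^+ 2.
Proof. by rewrite !nrm2 !(rdotDl, rdotDr) (rdotC y x); ring. Qed.

Lemma nrm2B x y : nrm (x - y) ^+ 2 = nrm x ^+ 2 - 2 * rdot x y + nrm y ^+ 2.
Proof. by rewrite !nrm2 !(rdotBl, rdotBr) (rdotC y x); ring. Qed.

Lemma rdot_le x y : rdot x y <= nrm x * nrm y.
Proof.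
have [->|x0] := eqVneq x 0; first by rewrite /rdot dot0l nrm0 mul0r.
have [->|y0] := eqVneq y 0; first by rewrite /rdot dot0r nrm0 mulr0.
have xy0 : 0 < nrm x * nrm y by rewrite mulr_gt0 ?nrm_gt0.
have := sqr_ge0 (nrm ((nrm y)%:C *: x - (nrm x)%:C *: y)).
rewrite nrm2B !nrmZ !nrmR !ger0_norm ?nrm_ge0 // rdotZ (rdotC x) rdotZ (rdotC y).
have -> : (nrm y * nrm x) ^+ 2 - 2 * (nrm y * (nrm x * rdot x y)) +
  (nrm x * nrm y) ^+ 2 = 2 * (nrm x * nrm y) * (nrm x * nrm y - rdot x y).
  by ring.
by rewrite pmulr_rge0 ?subr_ge0 // mulr_gt0 // ltr0n.
Qed.

(** Multiplying [x] by the conjugate of [dot x y] makes the product real, which reduces the claim to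
    [rdot_le]. *)
Lemma CauchySchwarz_nrm x y : nrm (dot x y) <= nrm x * nrm y.
Proof.
have [->|d0] := eqVneq (dot x y) 0; first by rewrite nrm0 mulr_ge0 ?nrm_ge0.
have d_gt0 : 0 < nrm (dot x y) by rewrite nrm_gt0.
rewrite -(ler_pM2l d_gt0) -expr2 mulrA.
rewrite -[X in X * nrm x]nrmJ -nrmZ (le_trans _ (rdot_le _ _)) //.
rewrite /rdot dotZl sqr_nrm; case: (dot x y) => a b /=; lra.
Qed.

Lemma dot_inj x y : (forall z, dot z x = dot z y) -> x = y.
Proof.
move=> h; apply/eqP; rewrite -subr_eq0 -nrm_eq0 -sqrf_eq0 nrm2 /rdot.
by rewrite dotBr h subrr.
Qed.

Lemma cvg_dotl (u : nat -> X) (l : X) z :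
  u @ \oo --> l -> dot (u n) z @[n --> \oo] --> (dot l z : R[i]^o).
Proof.
move=> ul; apply/cvg_nrm; move/cvg_nrm: ul => ul.
apply: (@squeeze_cvgr _ _ _ _ (fun=> 0) (fun n => nrm (u n - l) * nrm z)).
- by near=> n; rewrite nrm_ge0 -dotBl CauchySchwarz_nrm.
- exact: cvg_cst.
- by rewrite -(mul0r (nrm z)); apply: cvgM => //; apply: cvg_cst.
Unshelve. all: by end_near. Qed.

Lemma cvg_dotr (u : nat -> X) (l : X) z :
  u @ \oo --> l -> dot z (u n) @[n --> \oo] --> (dot z l : R[i]^o).
Proof.
move=> /cvg_nrm ul; apply/cvg_nrm.
apply: (@squeeze_cvgr _ _ _ _ (fun=> 0) (fun n => nrm z * nrm (u n - l))).
- by near=> n; rewrite nrm_ge0 -dotBr CauchySchwarz_nrm.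
- exact: cvg_cst.
- by rewrite -(mulr0 (nrm z)); apply: cvgM => //; apply: cvg_cst.
Unshelve. all: by end_near. Qed.

Definition seq_closed (G : set (X * X)) : Prop :=
  forall (u v : nat -> X) x y, (forall n, G (u n, v n)) ->
    u @ \oo --> x -> v @ \oo --> y -> G (x, y).

Definition submodule (G : set (X * X)) : Prop :=
  G (0, 0) /\ forall c p q, G p -> G q -> G (c *: p + q).

Lemma submoduleD G p q : submodule G -> G p -> G q -> G (p + q).
Proof. by move=> [_ h] Gp Gq; have := h 1 _ _ Gp Gq; rewrite scale1r. Qed.

Lemma submoduleZ G c p : submodule G -> G p -> G (c *: p).
Proof. by move=> [h0 h] Gp; have := h c _ _ Gp h0; rewrite [_ + _]addr0. Qed.

Lemma submoduleB G p q : submodule G -> G p -> G q -> G (p - q).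
Proof. by move=> [_ h] Gp Gq; have := h (-1) _ _ Gq Gp; rewrite scaleN1r addrC. Qed.

(** The product carries its Hilbert norm through [val]. A minimizing sequence is Cauchy by the
    parallelogram law, and minimality along lines through the limit gives orthogonality. *)
Theorem graph_projection G : submodule G -> seq_closed G ->
  forall f g, exists x y, G (x, y) /\
    forall x' y', G (x', y') -> dot (f - x) x' + dot (g - y) y' = 0.
Proof.
move=> sG cG f g.
pose val x y := nrm (f - x) ^+ 2 + nrm (g - y) ^+ 2.
pose S := [set r | exists2 p, G p & r = val p.1 p.2].
have S0 r : S r -> 0 <= r.
  by case=> p _ ->; rewrite addr_ge0 ?sqr_ge0.
have Sinf : has_inf S.
  by split; [exists (val 0 0); exists (0, 0) => //; case: sG|exists 0 => r /S0].
pose d := inf S.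
have dval x y : G (x, y) -> d <= val x y.
  by move=> h; apply: ge_inf => //; [case: Sinf|exists (x, y)].
have /choice[p hp] (n : nat) :
    exists p, G p /\ val p.1 p.2 < d + (harmonic n) ^+ 2.
  have e0 : 0 < (harmonic n : R) ^+ 2 by rewrite exprn_gt0 // invr_gt0 ltr0Sn.
  have [r [p Gp rE]] := inf_adherent e0 Sinf.
  by rewrite rE => rd; exists p.
pose u n := (p n).1; pose v n := (p n).2.
have Guv n : G (u n, v n) by case: (hp n); rewrite /u /v; case: (p n).
have huv n : val (u n) (v n) < d + (harmonic n) ^+ 2 by case: (hp n).
have par a b z : nrm (a - b) ^+ 2 = 2 * nrm (z - a) ^+ 2 + 2 * nrm (z - b) ^+ 2
    - 4 * nrm (z - (2^-1 : R)%:C *: (a + b)) ^+ 2.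
  rewrite !nrm2B nrmZ nrmR (rdotC z (_ *: _)) rdotZ exprMn nrm2D rdotDl.
  rewrite (rdotC a z) (rdotC b z).
  by rewrite ger0_norm ?invr_ge0 ?ler0n //; field.
(* The midpoint of two terms stays in [G], hence its value is at least [d]. *)
have mid m n : nrm (u m - u n) ^+ 2 + nrm (v m - v n) ^+ 2 <=
    2 * harmonic m ^+ 2 + 2 * harmonic n ^+ 2.
  rewrite (par (u m) (u n) f) (par (v m) (v n) g).
  have : G ((2^-1 : R)%:C *: (u m + u n), (2^-1 : R)%:C *: (v m + v n)).
    have := submoduleZ (2^-1 : R)%:C sG (submoduleD sG (Guv m) (Guv n)).
    by [].
  move=> /dval; have := huv m; have := huv n; rewrite /val; lra.
have h_le m n : (m <= n)%N -> (harmonic n : R) <= harmonic m.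
  by move=> mn; rewrite /= lef_pV2 ?posrE ?ltr0Sn // ler_nat ltnS.
have h_ge0 n : 0 <= (harmonic n : R) by rewrite invr_ge0 ler0n.
have dist m n : (m <= n)%N -> nrm (u m - u n) <= 2 * harmonic m /\
    nrm (v m - v n) <= 2 * harmonic m.
  move=> /h_le mn; have : harmonic n ^+ 2 <= (harmonic m : R) ^+ 2.
    by rewrite ler_pXn2r ?nnegrE.
  have := mid m n; have := sqr_ge0 (nrm (u m - u n)).
  have := sqr_ge0 (nrm (v m - v n)) => *.
  by split; rewrite -(@ler_pXn2r _ 2) ?nnegrE ?nrm_ge0 ?mulr_ge0 // exprMn; lra.
have h0 : (2 * harmonic n @[n --> \oo] --> (0 : R)).
  by rewrite -(mulr0 2); apply: cvgM; [exact: cvg_cst|exact: cvg_harmonic].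
have [x ux] := complete_le h0 (fun m n mn => (dist m n mn).1).
have [y vy] := complete_le h0 (fun m n mn => (dist m n mn).2).
have Gxy : G (x, y) by apply: cG ux vy.
exists x, y; split=> //.
have vd : val x y <= d.
  have fg (w : nat -> X) (l e : X) : w @ \oo --> l ->
      nrm (e - w n) ^+ 2 @[n --> \oo] --> nrm (e - l) ^+ 2.
    move=> wl; rewrite expr2; under eq_fun do rewrite expr2.
    have h : nrm (e - w n) @[n --> \oo] --> nrm (e - l).
      by apply: cvg_nrm_comp; apply: cvgB => //; exact: cvg_cst.
    exact: cvgM.
  have c1 : val (u n) (v n) @[n --> \oo] --> val x y.
    exact: (cvgD (fg _ _ f ux) (fg _ _ g vy)).
  have c2 : d + harmonic n ^+ 2 @[n --> \oo] --> d.
    rewrite -[X in _ --> X]addr0 -[X in _ + X](mulr0 0).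
    apply: cvgD; first exact: cvg_cst.
    by apply: cvgM; exact: cvg_harmonic.
  by apply: (ler_cvg_to c1 c2); near=> n; exact: ltW.
have re0 x' y' : G (x', y') -> rdot (f - x) x' + rdot (g - y) y' = 0.
  move=> h; set r := _ + _; set Q := nrm x' ^+ 2 + nrm y' ^+ 2.
  have Q1 : 0 < Q + 1 by rewrite ltr_wpDl ?addr_ge0 ?sqr_ge0.
  (* Moving by [r / (Q + 1)] lowers the value by [r^2 (Q + 2) / (Q + 1)^2], so minimality forces
     [r = 0]. The added 1 avoids dividing by zero. *)
  have := dval _ _ (submoduleD sG Gxy (submoduleZ (r / (Q + 1))%:C sG h)).
  move=> /= /(le_trans vd); rewrite /val !opprD !addrA.
  rewrite (nrm2B (f - x)) (nrm2B (g - y)).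
  rewrite !nrmZ !nrmR !exprMn !real_normK ?num_real //.
  rewrite (rdotC (f - x)) (rdotC (g - y)) !rdotZ (rdotC x') (rdotC y').
  have -> : nrm (f - x) ^+ 2 - 2 * (r / (Q + 1) * rdot (f - x) x') +
    (r / (Q + 1)) ^+ 2 * nrm x' ^+ 2 +
    (nrm (g - y) ^+ 2 - 2 * (r / (Q + 1) * rdot (g - y) y') +
    (r / (Q + 1)) ^+ 2 * nrm y' ^+ 2) =
    nrm (f - x) ^+ 2 + nrm (g - y) ^+ 2 - r ^+ 2 * (Q + 2) / (Q + 1) ^+ 2.
    by rewrite -[rdot (f - x) x'](addrK (rdot (g - y) y')) -/r /Q; field;
      rewrite -/Q gt_eqF.
  rewrite lerDl oppr_ge0 => {}h.
  apply/eqP; rewrite -sqrf_eq0 eq_le sqr_ge0 andbT.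
  have Q2 : 0 < Q + 2 by lra.
  by rewrite -(pmulr_lle0 _ Q2) -(pmulr_lle0 _ (exprn_gt0 2 (_ : 0 < (Q + 1)^-1)))
    ?invr_gt0 // exprVn.
move=> x' y' h; apply/eqP; rewrite eq_complex raddfD; apply/andP; split.
  by rewrite -/(rdot _ _) -/(rdot _ _) re0.
(* Testing against the multiple by ['i] exchanges real and imaginary parts. *)
have := re0 _ _ (submoduleZ 'i sG h); rewrite /rdot !dotZr.
case: (dot _ _) => a b; case: (dot _ _) => a' b' /=; lra.
Unshelve. all: by end_near. Qed.

End Hilbert.

(** * Unbounded normal operators *)

Section NormalOperators.
Context {R : realType} {X : completeNormedModType R[i]}
        {dot : {dot X for @Num.conj R[i]}}
        (norm_dot : forall x : X, `|x| ^+ 2 = dot x x).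
Implicit Types (A : set (X * X)) (x y z : X) (c l : R[i]).

Definition functional A : Prop := forall x y z, A (x, y) -> A (x, z) -> y = z.

Definition dense_dom A : Prop :=
  forall x (e : R), 0 < e -> exists p, A p /\ nrm (x - p.1) < e.

(** [normal_operator] with its topological conditions in sequential form. *)
Definition nop A : Prop :=
  [/\ submodule A, functional A, dense_dom A, seq_closed A
    & op_comp (adjoint dot A) A = op_comp A (adjoint dot A)].

Lemma submodule0 A : submodule A -> A (0, 0).
Proof. by case. Qed.

Lemma normal_operator_nop A : normal_operator dot A -> nop A.
Proof.
move=> [[A0 AL Af] dA cA AA]; split => //.
- move=> x e e0.
  have : [set y | ball x e%:C y] !=set0.
    by exists x; apply: ballxx; rewrite ltcR.
  case/dA => [|z [bz [w Az]]]; first by apply: ball_open; rewrite ltcR.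
  exists (z, w); split => //=; move: bz.
  by rewrite /= -ball_normE /ball_ /= normE ltcR.
- move=> u v x y Auv ux vy.
  apply: (@closed_cvg _ _ \oo _ (fun n => (u n, v n)) A cA); last exact: cvg_pair.
  exact: nearW.
Qed.

Lemma adjointP A x y :
  adjoint dot A (x, y) <-> forall u v, A (u, v) -> dot x v = dot y u.
Proof.
split=> h u v /h /= e; first by rewrite (dotC x) (dotC y) e.
by rewrite (dotC v) (dotC u) e.
Qed.

Lemma adjoint_submodule A : submodule (adjoint dot A).
Proof.
split=> [|c [x y] [x' y'] /adjointP h /adjointP h']; apply/adjointP => u v.
  by rewrite !dot0l.
move=> Auv; rewrite !(dotDl, dotZl) (h _ _ Auv) (h' _ _ Auv).
by [].
Qed.

Lemma adjoint_closed A : seq_closed (adjoint dot A).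
Proof.
move=> u v x y h ux vy; apply/adjointP => a b Aab.
have h1 : dot (u n) b @[n --> \oo] --> (dot x b : R[i]^o) by exact: cvg_dotl.
have h2 : dot (v n) a @[n --> \oo] --> (dot y a : R[i]^o) by exact: cvg_dotl.
apply: (nlim_uniq h1).
have -> : (fun n => dot (u n) b) = (fun n => dot (v n) a).
  by apply/funext => n; have /adjointP := h n; apply.
exact: h2.
Qed.

(** Pythagoras: for [u] in the domain close to [x], [|x|^2 <= |x|^2 + |u|^2 = |x - u|^2]. *)
Lemma dense_orth A x : dense_dom A -> (forall u v, A (u, v) -> dot x u = 0) ->
  x = 0.
Proof.
move=> dA h; apply/eqP; rewrite -nrm_eq0 eq_le nrm_ge0 andbT.
apply/ler_addgt0Pr => e e0; rewrite add0r.
have [[u v] [Auv /= xu]] := dA x e e0.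
have := sqr_ge0 (nrm u); have := nrm2B norm_dot x u.
rewrite /rdot (h _ _ Auv) /= mulr0 subr0 => E u0.
rewrite ltW // (le_lt_trans _ xu) // -(@ler_pXn2r _ 2) ?nnegrE ?nrm_ge0 //.
by rewrite E lerDl.
Qed.

Lemma adjoint_functional A : dense_dom A -> functional (adjoint dot A).
Proof.
move=> dA x y z /adjointP h /adjointP h'; apply/eqP; rewrite -subr_eq0.
apply/eqP/(dense_orth dA) => u v Auv.
by rewrite dotBl -(h _ _ Auv) -(h' _ _ Auv) subrr.
Qed.

(** Subtract from a pair of the double adjoint its projection on the graph of [A]. Orthogonality
    puts the rotated difference [(y - v, - (x - u))] in the adjoint, and pairing the two yields
    [|x - u|^2 + |y - v|^2 = 0]. *)
Lemma adjointK A : submodule A -> seq_closed A ->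
  adjoint dot (adjoint dot A) = A.
Proof.
move=> sA cA; apply/seteqP; split=> [[x y] Axy|[x y] Axy]; last first.
  by apply/adjointP => u v h; rewrite -(h _ _ Axy).
have sub : A `<=` adjoint dot (adjoint dot A).
  by move=> [a b] Aab; apply/adjointP => u v h; rewrite -(h _ _ Aab).
have [u [v [Auv orth]]] := graph_projection norm_dot sA cA x y.
have h : adjoint dot A (y - v, - (x - u)).
  apply/adjointP => a b /orth /eqP; rewrite addrC addr_eq0 => /eqP ->.
  by rewrite dotNl.
have : adjoint dot (adjoint dot A) (x - u, y - v).
  exact: (submoduleB (adjoint_submodule _) Axy (sub _ Auv)).
move=> /adjointP/(_ _ _ h); rewrite dotNr.
rewrite !(dotxx norm_dot) => /eqP; rewrite -subr_eq0 -opprD oppr_eq0.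
rewrite -rmorphD /= -(rmorph0 (real_complex R)) (inj_eq (@complexI R)).
rewrite paddr_eq0 ?sqr_ge0 // !sqrf_eq0 !nrm_eq0 !subr_eq0.
by case/andP => /eqP -> /eqP ->.
Qed.

(** Von Neumann's argument for the surjectivity of [1 + A' A]: project [(u, 0)] on the graph of [A];
    the residue [(u - x, - y)] is orthogonal to the graph, that is, [A' y = u - x]. *)
Lemma one_plus_AA_surj A u : submodule A -> seq_closed A ->
  exists x y, A (x, y) /\ adjoint dot A (y, u - x).
Proof.
move=> sA cA; have [x [y [Axy orth]]] := graph_projection norm_dot sA cA u 0.
exists x, y; split=> //; apply/adjointP => a b /orth.
by rewrite sub0r dotNl => /eqP; rewrite subr_eq0 => /eqP.
Qed.

Section Normal.
Context {A : set (X * X)} (nA : nop A).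
Local Notation A' := (adjoint dot A).

Let sA : submodule A. Proof. by case: nA. Qed.
Let fA : functional A. Proof. by case: nA. Qed.
Let dA : dense_dom A. Proof. by case: nA. Qed.
Let cA : seq_closed A. Proof. by case: nA. Qed.

Lemma nop_comp x y z : A (x, y) -> A' (y, z) -> exists2 y', A' (x, y') & A (y', z).
Proof.
case: nA => _ _ _ _ E Axy Ayz.
have : op_comp A' A (x, z) by exists y.
by rewrite E => -[y' /= h1 h2]; exists y'.
Qed.

Lemma nrm_comp x y z y' : A (x, y) -> A' (y, z) -> A' (x, y') -> A (y', z) ->
  nrm y' = nrm y.
Proof.
move=> Axy Ayz Axy' Ayz'; apply/eqP.
rewrite -(@eqrXn2 _ 2) ?nrm_ge0 // !(nrm2 norm_dot) /rdot.
have /adjointP/(_ _ _ Axy) -> := Ayz.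
have /adjointP/(_ _ _ Ayz') <- := Axy'.
by rewrite (dotC x); case: (dot z x).
Qed.

Let D2 : set (X * X) := [set p | A p /\ exists z, A' (p.2, z)].

(* The domain of [A* A] is a core of [A]. *)
Lemma nop_core x y : A (x, y) ->
  forall e : R, 0 < e -> exists p, D2 p /\ nrm (x - p.1) < e /\ nrm (y - p.2) < e.
Proof.
move=> Axy.
(* The closure of [D2], to which [graph_projection] applies; it lies in [A] because [A] is
   closed. *)
pose G := [set q : X * X | forall e : R, 0 < e ->
   exists p, D2 p /\ nrm (q.1 - p.1) < e /\ nrm (q.2 - p.2) < e].
have D2s : submodule D2.
  split=> [|c [a b] [a' b'] [/= h [z hz]] [/= h' [z' hz']]].
    by split; [exact: submodule0|exists 0; apply: submodule0; exact: adjoint_submodule].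
  split; first exact: (sA.2 c _ _ h h').
  by exists (c *: z + z'); exact: ((adjoint_submodule A).2 c _ _ hz hz').
have D2G : D2 `<=` G.
  by move=> p Dp e e0; exists p; rewrite !subrr !nrm0.
have sG : submodule G.
  split; first by apply: D2G; exact: submodule0.
  move=> c p q Gp Gq e e0.
  pose d := e / 2 / (nrm c + 1).
  have c0 : 0 < nrm c + 1 by rewrite ltr_wpDl ?nrm_ge0.
  have d0 : 0 < d by rewrite !divr_gt0.
  have [p' [Dp [p1 p2]]] := Gp d d0.
  have [q' [Dq [q1 q2]]] := Gq (e / 2) (divr_gt0 e0 (ltr0Sn _ _)).
  exists (c *: p' + q'); split; first exact: D2s.2.
  have H (a b a' b' : X) : nrm (a - a') < d -> nrm (b - b') < e / 2 ->
      nrm (c *: a + b - (c *: a' + b')) < e.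
    move=> ha hb; rewrite opprD addrACA -scalerBr.
    rewrite (le_lt_trans (nrmD _ _)) // nrmZ (splitr e) ltr_leD ?(ltW hb) //.
    rewrite (@le_lt_trans _ _ (nrm c * d)) ?ler_wpM2l ?nrm_ge0 ?(ltW ha) //.
    by rewrite /d mulrCA gtr_pMr ?divr_gt0 // ltr_pdivrMr // mul1r ltrDl.
  by split; apply: H.
have cG : seq_closed G.
  move=> u v a b Guv /seq_cvgP ua /seq_cvgP vb e e0.
  have e20 : 0 < e / 2 by rewrite divr_gt0.
  have [N hN] := ua _ e20; have [M hM] := vb _ e20.
  pose n := maxn N M.
  have [p [Dp [/= p1 p2]]] := Guv n _ e20.
  exists p; split=> //=; split.
  - rewrite (le_lt_trans (nrm_sub (u n) _ _)) // (splitr e) ltrD // nrmC hN //.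
    exact: leq_maxl.
  - rewrite (le_lt_trans (nrm_sub (v n) _ _)) // (splitr e) ltrD // nrmC hM //.
    exact: leq_maxr.
have GA : G `<=` A.
  move=> [a b] Gab.
  have /choice[p hp] (n : nat) : exists p, D2 p /\
      nrm (a - p.1) < harmonic n /\ nrm (b - p.2) < harmonic n.
    by apply: Gab; rewrite invr_gt0 ltr0Sn.
  apply: (cA (u := fun n => (p n).1) (v := fun n => (p n).2)).
  - by move=> n; have [[+ _] _] := hp n; case: (p n).
  - apply/cvg_nrm; apply: (squeeze_cvgr _ (cvg_cst 0) cvg_harmonic).
    by near=> n; rewrite nrm_ge0 nrmC ltW //; have [_ []] := hp n.
  - apply/cvg_nrm; apply: (squeeze_cvgr _ (cvg_cst 0) cvg_harmonic).
    by near=> n; rewrite nrm_ge0 nrmC ltW //; have [_ []] := hp n.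
have [x0 [y0 [G0 orth]]] := graph_projection norm_dot sG cG x y.
(* Solve [x' + A' A x' = x - x0]. As [(x', A x')] is in [D2], orthogonality reads
   [<x - x0, x'> + <x - x0, A' A x'> = 0], that is, [|x - x0|^2 = 0]. *)
have [x' [y' [Axy' Ay']]] := one_plus_AA_surj (x - x0) sA cA.
have Auv : A (x - x0, y - y0) := submoduleB sA Axy (GA _ G0).
have /orth : G (x', y') by apply: D2G; split => //; exists (x - x0 - x').
have /adjointP/(_ _ _ Auv) := Ay' => E0.
rewrite (dotC (y - y0)) E0 -dotC -dotDr addrCA subrr addr0.
move/eqP; rewrite -norm_dot sqrf_eq0 normr_eq0 => /eqP u0.
rewrite u0 in Auv; have := fA Auv (submodule0 sA) => v0.
move/eqP: u0; rewrite subr_eq0 => /eqP ->.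
by move/eqP: v0; rewrite subr_eq0 => /eqP ->.
Unshelve. all: by end_near. Qed.

(** On the core, [|A' u| = |A u|] by [nrm_comp]. Along an approximation of [(x, y)] from the core,
    the images under [A'] are thus Cauchy, and [A'] is closed. *)
Lemma nop_adjoint_ex x y : A (x, y) -> exists2 y', A' (x, y') & nrm y' = nrm y.
Proof.
move=> Axy.
have /choice[p hp] (n : nat) : exists p, D2 p /\
    nrm (x - p.1) < harmonic n /\ nrm (y - p.2) < harmonic n.
  by apply: nop_core; rewrite // invr_gt0 ltr0Sn.
have Ap n : A ((p n).1, (p n).2) by have [[+ _] _] := hp n; case: (p n).
have /choice[z hz] (n : nat) : exists z, A' ((p n).2, z) by have [[_ +] _] := hp n.
have /choice[w hw] (n : nat) : exists w, A' ((p n).1, w) /\ A (w, z n).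
  by have [w ? ?] := nop_comp (Ap n) (hz n); exists w.
have ph n : nrm (y - (p n).2) <= harmonic n by apply/ltW; have [_ []] := hp n.
have wn m n : nrm (w m - w n) = nrm ((p m).2 - (p n).2).
  apply: (nrm_comp (submoduleB sA (Ap m) (Ap n))).
  - exact: (submoduleB (adjoint_submodule A) (hz m) (hz n)).
  - exact: (submoduleB (adjoint_submodule A) (hw m).1 (hw n).1).
  - exact: (submoduleB sA (hw m).2 (hw n).2).
have wn' n : nrm (w n) = nrm (p n).2.
  by apply: (nrm_comp (Ap n) (hz n)); case: (hw n).
have pc : (fun n => (p n).2) @ \oo --> y.
  apply/cvg_nrm; apply: (squeeze_cvgr _ (cvg_cst 0) cvg_harmonic).
  by near=> n; rewrite nrm_ge0 nrmC ph.
have [y' wy'] : exists l : X, w @ \oo --> l.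
  apply: (complete_le (v := fun n => 2 * harmonic n)).
    by rewrite -(mulr0 2); apply: cvgM; [exact: cvg_cst|exact: cvg_harmonic].
  move=> m n mn; rewrite wn (le_trans (nrm_sub y _ _)) // nrmC.
  have := ph m; have := ph n.
  have : (harmonic n : R) <= harmonic m.
    by rewrite /= lef_pV2 ?posrE ?ltr0Sn // ler_nat ltnS.
  lra.
exists y'.
  apply: (adjoint_closed (u := fun n => (p n).1) (v := w)) => //.
    by move=> n; case: (hw n).
  apply/cvg_nrm; apply: (squeeze_cvgr _ (cvg_cst 0) cvg_harmonic).
  by near=> n; rewrite nrm_ge0 nrmC ltW //; have [_ []] := hp n.
have h : nrm (w n) @[n --> \oo] --> nrm y.
  by under eq_fun do rewrite wn'; exact: cvg_nrm_comp.
exact: (cvg_unique (@Rhausdorff R) (cvg_nrm_comp wy') h).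
Unshelve. all: by end_near. Qed.

Lemma nop_adjoint : nop A'.
Proof.
split; [exact: adjoint_submodule|exact: adjoint_functional| |exact: adjoint_closed|].
  move=> x e /(dA x) [[u v] [Auv xu]].
  by have [v' Auv' _] := nop_adjoint_ex Auv; exists (u, v').
by rewrite adjointK //; case: nA.
Qed.

End Normal.

Section Resolvent.
Context {A : set (X * X)} (nA : nop A).
Local Notation A' := (adjoint dot A).

Let sA : submodule A. Proof. by case: nA. Qed.
Let cA : seq_closed A. Proof. by case: nA. Qed.

Lemma nop_adjoint_ex' x y : A' (x, y) -> exists2 y', A (x, y') & nrm y' = nrm y.
Proof.
by move=> /(nop_adjoint_ex (nop_adjoint nA)); rewrite adjointK.
Qed.

Lemma nop_nrm x y y' : A (x, y) -> A' (x, y') -> nrm y' = nrm y.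
Proof.
move=> Axy Axy'; have [z Axz <-] := nop_adjoint_ex nA Axy.
by congr nrm; case: (nop_adjoint nA) => _ + _ _ _; apply; first exact: Axy'.
Qed.

Lemma nop_shift_nrm l x y y' : A (x, y) -> A' (x, y') ->
  nrm (l *: x - y) = nrm (l^* *: x - y').
Proof.
move=> Axy Axy'; apply/eqP; rewrite -(@eqrXn2 _ 2) ?nrm_ge0 //; apply/eqP.
rewrite !(nrm2B norm_dot) !nrmZ nrmJ (nop_nrm Axy Axy'); congr (_ - 2 * _ + _).
rewrite /rdot !dotZl (dotC x y').
have /adjointP/(_ _ _ Axy) <- := Axy'.
by case: l => a b; case: (dot x y) => a' b' /=; ring.
Qed.

(** The lower bound makes the range of [l - A] closed. A vector [g] orthogonal to it satisfies
    [A' g = l^* *: g], so [(l - A) g = 0] by [nop_shift_nrm], and the lower bound gives [g = 0]. *)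
Lemma nop_surj l (c : R) : 0 < c ->
  (forall x y, A (x, y) -> c * nrm x <= nrm (l *: x - y)) ->
  forall f, exists x y, A (x, y) /\ l *: x - y = f.
Proof.
move=> c0 hc f.
(* The range, placed in the first factor so that [graph_projection] serves as the projection theorem
   of [X]. *)
pose G := [set q : X * X | (exists p, A p /\ q.1 = l *: p.1 - p.2) /\ q.2 = 0].
have sG : submodule G.
  split=> [|k p q [[p' [Ap E1]] Ep] [[q' [Aq E2]] Eq]].
    by split=> //; exists (0, 0); split; rewrite /= ?scaler0 ?subr0 //; exact: submodule0.
  split; last by rewrite /= Ep Eq scaler0 addr0.
  exists (k *: p' + q'); split; first exact: sA.2.
  by rewrite /= E1 E2 (scalerDr l) scalerBr !scalerA (mulrC k) opprD addrACA.
have cG : seq_closed G.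
  move=> u v x y Guv ux vy.
  have /choice[p hp] (n : nat) : exists p, A p /\ u n = l *: p.1 - p.2.
    by have [] := Guv n.
  have Ap n : A ((p n).1, (p n).2) by have [+ _] := hp n; case: (p n).
  have up n : u n = l *: (p n).1 - (p n).2 by have [] := hp n.
  have [a pa] : exists a : X, (fun n => (p n).1) @ \oo --> a.
    apply: complete_seq => e e0.
    have ce0 : 0 < c * e / 2 by rewrite divr_gt0 ?mulr_gt0.
    have /seq_cvgP/(_ _ ce0)[N hN] := ux.
    exists N => m n Nm Nn.
    have := hc _ _ (submoduleB sA (Ap m) (Ap n)).
    have -> : l *: ((p m).1 - (p n).1) - ((p m).2 - (p n).2) = u m - u n.
      rewrite !up scalerBr !opprB addrACA [RHS]addrACA; congr (_ + _).
      exact: addrC.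
    move=> h; rewrite -(ltr_pM2l c0) (le_lt_trans h) //.
    rewrite (le_lt_trans (nrm_sub x _ _)) // (nrmC x).
    by have := hN _ Nm; have := hN _ Nn; lra.
  have pb : (fun n => (p n).2) @ \oo --> l *: a - x.
    have -> : (fun n => (p n).2) = (fun n => l *: (p n).1 - u n).
      by apply/funext => n; rewrite up opprB addrC subrK.
    by apply: cvgB => //; apply: cvgZr.
  split=> /=.
    exists (a, l *: a - x); split; last by rewrite /= opprB addrC subrK.
    exact: (cA Ap pa pb).
  have v0 : v = fun=> 0 by apply/funext => n; have [] := Guv n.
  by rewrite v0 in vy; exact: (nlim_uniq vy (cvg_cst 0)).
have [x [y [[[p [Ap /= xp]] y0] orth]]] := graph_projection norm_dot sG cG f 0.
exists p.1, p.2; split; first by case: (p) Ap.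
rewrite -xp; apply/eqP; rewrite eq_sym -subr_eq0; apply/eqP.
set g := f - x.
have hg : A' (g, l^* *: g).
  apply/adjointP => u v Auv.
  have Gv : G (l *: u - v, 0) by split => //; exists (u, v).
  have := orth _ _ Gv; rewrite dot0r addr0 dotBr dotZr => /eqP.
  by rewrite subr_eq0 dotZl => /eqP.
have [w Agw _] := nop_adjoint_ex' hg.
have := hc _ _ Agw; rewrite (nop_shift_nrm l Agw hg) subrr nrm0 pmulr_rle0 //.
by move=> h; apply/eqP; rewrite -nrm_eq0 eq_le h nrm_ge0.
Qed.

End Resolvent.

End NormalOperators.

(** * Bounded operators and resolvents *)

Section BoundedOperators.
Context {R : realType} {X : completeNormedModType R[i]}.
Implicit Types (f g : X -> X) (x y : X) (c : R[i]).

(** A predicate on bare functions, so that iterates, sums and pointwise limits need no bundling. *)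
Definition blin f : Prop :=
  (forall c x y, f (c *: x + y) = c *: f x + f y) /\
  exists C : R, forall x, nrm (f x) <= C * nrm x.

Lemma blin0 f : blin f -> f 0 = 0.
Proof.
by case=> h _; have := h (-1) 0 0; rewrite scaler0 addr0 scaleN1r addNr.
Qed.

Lemma blinD f x y : blin f -> f (x + y) = f x + f y.
Proof. by case=> h _; have := h 1 x y; rewrite !scale1r. Qed.

Lemma blinZ f c x : blin f -> f (c *: x) = c *: f x.
Proof. by move=> h; rewrite -[c *: x]addr0 h.1 (blin0 h) addr0. Qed.

Lemma blinN f x : blin f -> f (- x) = - f x.
Proof. by move=> h; rewrite -scaleN1r (blinZ _ _ h) scaleN1r. Qed.

Lemma blinB f x y : blin f -> f (x - y) = f x - f y.
Proof. by move=> h; rewrite (blinD _ _ h) (blinN _ h). Qed.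

Lemma blin_sum f I (r : seq I) (P : pred I) (u : I -> X) : blin f ->
  f (\sum_(i <- r | P i) u i) = \sum_(i <- r | P i) f (u i).
Proof.
move=> h; elim/big_rec2 : _ => [|i a b _ <-]; first exact: blin0.
by rewrite (blinD _ _ h).
Qed.

Lemma blin_bound f : blin f -> exists2 C : R, 0 < C & forall x, nrm (f x) <= C * nrm x.
Proof.
case=> _ [C hC]; exists (`|C| + 1); first by rewrite ltr_wpDl.
move=> x; rewrite (le_trans (hC x)) // ler_wpM2r ?nrm_ge0 //.
by rewrite (le_trans (ler_norm _)) // lerDl.
Qed.

Lemma blin_cvg f {I : Type} (F : set_system I) {FF : Filter F} (u : I -> X) (l : X) :
  blin f -> u @ F --> l -> f (u i) @[i --> F] --> f l.
Proof.
move=> bf /cvg_nrmP ul; have [C C0 hC] := blin_bound bf.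
apply/cvg_nrmP => e e0; have := ul (e / C) (divr_gt0 e0 C0); apply: filterS => i.
rewrite ltr_pdivlMr // mulrC; apply: le_lt_trans.
by rewrite -(blinB _ _ bf).
Qed.

Lemma blin_id : blin id.
Proof. by split=> //; exists 1 => x; rewrite mul1r. Qed.

Lemma blin_comp f g : blin f -> blin g -> blin (fun x => f (g x)).
Proof.
move=> bf bg; split; first by move=> c x y; rewrite bg.1 bf.1.
have [C C0 hC] := blin_bound bf; have [D D0 hD] := blin_bound bg.
exists (C * D) => x; rewrite (le_trans (hC _)) // -mulrA ler_wpM2l // ltW //.
Qed.

Lemma blin_scale c f : blin f -> blin (fun x => c *: f x).
Proof.
move=> bf; split=> [d x y|]; first by rewrite bf.1 scalerDr !scalerA mulrC.
have [C C0 hC] := blin_bound bf; exists (nrm c * C) => x.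
by rewrite nrmZ -mulrA ler_wpM2l ?nrm_ge0.
Qed.

Lemma blin_add f g : blin f -> blin g -> blin (fun x => f x + g x).
Proof.
move=> bf bg; split=> [c x y|]; first by rewrite bf.1 bg.1 scalerDr addrACA.
have [C C0 hC] := blin_bound bf; have [D D0 hD] := blin_bound bg.
by exists (C + D) => x; rewrite mulrDl (le_trans (nrmD _ _)) // lerD.
Qed.

Lemma blin_sub f g : blin f -> blin g -> blin (fun x => f x - g x).
Proof.
move=> bf bg; have := blin_add bf (blin_scale (-1) bg).
by congr blin; apply/funext => x; rewrite scaleN1r.
Qed.

Lemma blin_iter f n : blin f -> blin (iter n f).
Proof.
by move=> bf; elim: n => [|n IHn]; [exact: blin_id|exact: blin_comp].
Qed.

(** [S] maps some ball of radius [r] into the unit ball; rescaling [x] to norm [r / 2] gives the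
    constant [2 / r]. *)
Lemma linear_blin (S : {linear X -> X}) : continuous S -> blin S.
Proof.
move=> cS; split=> [c x y|]; first exact: linearP.
have /cvg_nrmP/(_ 1 ltr01)/nbhs_ballP[d /= d0 hd] := cS 0.
have dr : (complex.Re d)%:C = d by rewrite RRe_real // gtr0_real.
rewrite -dr ltcR in d0; set r := complex.Re d in dr d0.
exists (2 / r) => x; have [->|x0] := eqVneq x 0.
  by rewrite linear0 nrm0 mulr0.
have n0 : 0 < nrm x by rewrite nrm_gt0.
have k0 : 0 < r / 2 / nrm x by rewrite !divr_gt0.
have /hd /= : ball 0 d ((r / 2 / nrm x)%:C *: x).
  rewrite -ball_normE /ball_ /= sub0r normrN normE nrmZ nrmR gtr0_norm // divfK ?gt_eqF //.
  by rewrite -dr ltcR ltr_pdivrMr // ltr_pMr // ltr1n.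
rewrite linear0 subr0 linearZ nrmZ nrmR gtr0_norm // => /ltW.
rewrite mulrC -ler_pdivlMr // => /le_trans; apply.
rewrite (_ : 1 / _ = 2 / r * nrm x) //; field.
by rewrite !gt_eqF.
Qed.

Lemma blin_linear f : blin f ->
  exists2 S : {linear X -> X}, continuous S & forall x, S x = f x.
Proof.
move=> bf; pose S : {linear X -> X} := HB.pack f (GRing.isLinear.Build _ _ _ _ _ bf.1).
by exists S => // x; exact: blin_cvg.
Qed.

End BoundedOperators.

(** * Resolvents and the bicommutant of a normal operator *)

Section Resolvents.
Context {R : realType} {X : completeNormedModType R[i]}
        {dot : {dot X for @Num.conj R[i]}}
        (norm_dot : forall x : X, `|x| ^+ 2 = dot x x).
Implicit Types (A : set (X * X)) (x y : X) (l : R[i]) (S B : X -> X).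

Definition resolvent A l S : Prop := blin S /\
  forall f x, (exists2 y, A (x, y) & l *: x - y = f) <-> x = S f.

Lemma resolvent_setP A l : resolvent_set A l <-> exists S, resolvent A l S.
Proof.
split=> [[S cS hS]|[S [bS hS]]]; first by exists S; split => //; exact: linear_blin.
by have [S' cS' SS'] := blin_linear bS; exists S' => // f x; rewrite SS'.
Qed.

Lemma resolvent_bound A l S : resolvent A l S ->
  exists2 c : R, 0 < c & forall x y, A (x, y) -> c * nrm x <= nrm (l *: x - y).
Proof.
case=> /blin_bound[C C0 hC] hS; exists C^-1; first by rewrite invr_gt0.
move=> x y Axy; rewrite ler_pdivrMl // (le_trans _ (hC _)) //.
by have /hS <- : exists2 y', A (x, y') & l *: x - y' = l *: x - y by exists y.
Qed.

Lemma resolventP A l S f : resolvent A l S -> exists2 y, A (S f, y) & l *: S f - y = f.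
Proof. by case=> _ h; apply/h. Qed.

Lemma resolventE A l S x y : resolvent A l S -> A (x, y) -> S (l *: x - y) = x.
Proof. by case=> _ h Axy; apply/esym/h; exists y. Qed.

Lemma bound_resolvent A l (c : R) : nop (dot := dot) A -> 0 < c ->
  (forall x y, A (x, y) -> c * nrm x <= nrm (l *: x - y)) ->
  exists S, resolvent A l S.
Proof.
move=> nA c0 hc; have [sA fA _ _ _] := nA.
have /choice[S hS] (f : X) : exists x, exists2 y, A (x, y) & l *: x - y = f.
  by have [x [y [? ?]]] := nop_surj norm_dot nA c0 hc f; exists x, y.
have SE f x y : A (x, y) -> l *: x - y = f -> x = S f.
  move=> Axy E; have [w Aw Ew] := hS f; apply/eqP; rewrite -subr_eq0 -nrm_eq0.
  have := hc _ _ (submoduleB sA Axy Aw).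
  have -> : l *: (x - S f) - (y - w) = (l *: x - y) - (l *: S f - w).
    by rewrite scalerBr !opprB addrACA [RHS]addrACA; congr (_ + _); exact: addrC.
  by rewrite E Ew subrr nrm0 pmulr_rle0 // eq_le nrm_ge0 andbT.
exists S; split; last first.
  by move=> f x; split=> [[y Axy E]|->]; [exact: SE E|exact: hS].
split.
  move=> k f g; have [u Au Eu] := hS f; have [v Av Ev] := hS g.
  apply/esym; apply: (SE _ _ (k *: u + v) (sA.2 k _ _ Au Av)).
  rewrite -[in RHS]Eu -[in RHS]Ev (scalerDr l) scalerBr !scalerA (mulrC l).
  by rewrite opprD addrACA.
exists c^-1 => f; have [u Au Eu] := hS f.
by rewrite ler_pdivlMl // -{2}Eu hc.
Qed.

Lemma resolvent_comm A l S B : functional A -> resolvent A l S -> blin B ->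
  (forall x, B (S x) = S (B x)) -> forall x y, A (x, y) -> A (B x, B y).
Proof.
move=> fA rS bB BS x y Axy.
have := resolventP (B (l *: x - y)) rS; rewrite -BS (resolventE rS Axy).
case=> w Aw /eqP; rewrite (blinB _ _ bB) (blinZ _ _ bB).
by rewrite (inj_eq (addrI _)) eqr_opp => /eqP <-.
Qed.

Lemma resolvent_commE A l S B : resolvent A l S -> blin B ->
  (forall x y, A (x, y) -> A (B x, B y)) -> forall x, B (S x) = S (B x).
Proof.
move=> rS bB BA x; have [y Ay <-] := resolventP x rS.
rewrite (resolventE rS Ay) (blinB _ _ bB) (blinZ _ _ bB).
by rewrite (resolventE rS (BA _ _ Ay)).
Qed.

Section Normal.
Context {A : set (X * X)} (nA : nop (dot := dot) A).
Local Notation A' := (adjoint dot A).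

(** Commutation with [A'] is part of the definition; deducing it from commutation with [A] would be
    Fuglede's theorem. *)
Definition comm B : Prop :=
  [/\ blin B, forall x y, A (x, y) -> A (B x, B y)
   & forall x y, A' (x, y) -> A' (B x, B y)].

(** [N] and [N'] are mutually adjoint elements of the bicommutant of [A]. Such
    operators are normal and commute with each other, and the bicommutant is
    closed under algebraic operations and bounded strong limits; this is what
    stands in for a functional calculus of [A]. *)
Definition bicomm (N N' : X -> X) : Prop :=
  [/\ comm N, comm N', forall x y, dot (N x) y = dot x (N' y)
   & forall B, comm B -> forall x, B (N x) = N (B x) /\ B (N' x) = N' (B x)].

(** With [x = S (S' f)], both [x] and [A x] are in the common domain of [A] and [A'], so [nop_comp]
    lets the factors of [(l^* - A') (l - A) x = f] be exchanged. Then [(l^* - A') x] equals [S f],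
    and applying [S'] recovers [x]. *)
Lemma resolvent_adjoint_comm l S S' : resolvent A l S -> resolvent A' l^* S' ->
  forall f, S (S' f) = S' (S f).
Proof.
move=> rS rS' f; set y := S' f; set x := S y.
have sA : submodule A by case: nA.
have sA' := adjoint_submodule (dot := dot) A.
have fA' : functional A' by case: (nop_adjoint norm_dot nA).
have [w Ayw Ew] := resolventP f rS'; rewrite -/y in Ayw Ew.
have [v Axv Ev] := resolventP y rS; rewrite -/x in Axv Ev.
have [y2 Ay2 _] := nop_adjoint_ex' norm_dot nA Ayw.
have vE : v = l *: x - y by rewrite -Ev opprB addrC subrK.
have Av : A (v, l *: v - y2).
  by rewrite {1}vE; exact: (submoduleB sA (submoduleZ l sA Axv) Ay2).
have [q Avq _] := nop_adjoint_ex norm_dot nA Av.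
have [x' Axx' Axq] := nop_comp nA Axv Avq.
have wE : w = l *: x' - q.
  apply: (fA' _ _ _ Ayw); rewrite -Ev.
  exact: (submoduleB sA' (submoduleZ l sA' Axx') Avq).
have Au : A (l^* *: x - x', l^* *: v - q).
  exact: (submoduleB sA (submoduleZ l^* sA Axv) Axq).
have uE : l *: (l^* *: x - x') - (l^* *: v - q) = f.
  rewrite -Ew wE -Ev !scalerBr !scalerA (mulrC l) !opprB.
  by rewrite addrACA [RHS]addrACA; congr (_ + _); exact: addrC.
have Su := resolventE rS Au; rewrite uE in Su.
by rewrite Su (resolventE rS' Axx').
Qed.

Lemma resolvent_bicomm l S : resolvent A l S -> exists S', bicomm S S'.
Proof.
move=> rS; have fA : functional A by case: nA.
have nA' := nop_adjoint norm_dot nA.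
have fA' : functional A' by case: nA'.
have [c c0 hc] := resolvent_bound rS.
have [S' rS'] : exists S', resolvent A' l^* S'.
  apply: (bound_resolvent nA' c0) => x y Axy.
  have [y' Axy' _] := nop_adjoint_ex' norm_dot nA Axy.
  by rewrite -(nop_shift_nrm norm_dot nA _ Axy' Axy) hc.
have SS' := resolvent_adjoint_comm rS rS'.
exists S'; split.
- split; [exact: rS.1|exact: (resolvent_comm fA rS rS.1)|].
  exact: (resolvent_comm fA' rS' rS.1).
- split; [exact: rS'.1| |exact: (resolvent_comm fA' rS' rS'.1)].
  exact: (resolvent_comm fA rS rS'.1).
- move=> f g; have [y Ay Ey] := resolventP f rS.
  have [w Aw Ew] := resolventP g rS'.
  rewrite -{2}Ey -{1}Ew dotBr dotBl dotZr dotZl (Aw _ _ Ay) /=.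
  by rewrite -[Num.conj _]/(conjc _) conjcK.
- move=> B [bB BA BA'] x; split.
    exact: (resolvent_commE rS bB BA).
  exact: (resolvent_commE rS' bB BA').
Qed.

Lemma bicomm_sym N N' : bicomm N N' -> bicomm N' N.
Proof.
move=> [cN cN' adj h]; split => // [x y|B /h hB x].
  by rewrite (dotC x) adj -dotC.
by split; case: (hB x).
Qed.

Lemma bicomm_blin N N' : bicomm N N' -> blin N.
Proof. by case=> -[]. Qed.

Lemma bicommC N N' M M' x : bicomm N N' -> bicomm M M' -> N (M x) = M (N x).
Proof. by move=> [_ _ _ h] [cM _ _ _]; have [] := h _ cM x. Qed.

Lemma bicomm_nrm N N' x : bicomm N N' -> nrm (N' x) = nrm (N x).
Proof.
move=> hN; have [_ _ adj _] := hN; have [_ _ adj' _] := bicomm_sym hN.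
apply/eqP; rewrite -(@eqrXn2 _ 2) ?nrm_ge0 // !(nrm2 norm_dot) /rdot.
by rewrite adj' adj (bicommC x hN (bicomm_sym hN)).
Qed.

(** [|N x|^2 = <x, N' N x>] and [|N' N x| = |N N x|]. In this form (paranormality) normality enters
    the search for approximate eigenvalues. *)
Lemma bicomm_logconvex N N' x : bicomm N N' ->
  nrm (N x) ^+ 2 <= nrm (N (N x)) * nrm x.
Proof.
move=> hN; have [_ _ adj _] := hN.
rewrite (nrm2 norm_dot) /rdot adj mulrC -(bicomm_nrm _ hN).
exact: (rdot_le norm_dot).
Qed.

Lemma bicomm_id : bicomm id id.
Proof. by split => //; split => //; exact: blin_id. Qed.

Lemma comm_comp B C : comm B -> comm C -> comm (fun x => B (C x)).
Proof.
move=> [bB h1 h2] [bC h1' h2']; split; first exact: blin_comp.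
  by move=> x y /h1'/h1.
by move=> x y /h2'/h2.
Qed.

Lemma comm_scale c B : comm B -> comm (fun x => c *: B x).
Proof.
have sA : submodule A by case: nA.
have sA' := adjoint_submodule (dot := dot) A.
move=> [bB h1 h2]; split; first exact: blin_scale.
  by move=> x y /h1 /(submoduleZ c sA).
by move=> x y /h2 /(submoduleZ c sA').
Qed.

Lemma comm_add B C : comm B -> comm C -> comm (fun x => B x + C x).
Proof.
have sA : submodule A by case: nA.
have sA' := adjoint_submodule (dot := dot) A.
move=> [bB h1 h2] [bC h1' h2']; split; first exact: blin_add.
  by move=> x y h; exact: (submoduleD sA (h1 _ _ h) (h1' _ _ h)).
by move=> x y h; exact: (submoduleD sA' (h2 _ _ h) (h2' _ _ h)).
Qed.

Lemma bicomm_comp N N' M M' : bicomm N N' -> bicomm M M' ->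
  bicomm (fun x => N (M x)) (fun x => M' (N' x)).
Proof.
move=> [cN cN' a h] [cM cM' a' h']; split; [exact: comm_comp|exact: comm_comp| |].
  by move=> x y; rewrite a a'.
move=> B cB x; split.
  by rewrite (h _ cB _).1 (h' _ cB _).1.
by rewrite (h' _ cB _).2 (h _ cB _).2.
Qed.

Lemma bicomm_scale c N N' : bicomm N N' ->
  bicomm (fun x => c *: N x) (fun x => c^* *: N' x).
Proof.
move=> [cN cN' a h]; split; [exact: comm_scale|exact: comm_scale| |].
  by move=> x y; rewrite dotZl dotZr a -[Num.conj _]/(conjc _) conjcK.
move=> B cB x; have [bB _ _] := cB; rewrite !(blinZ _ _ bB).
by have [-> ->] := h B cB x.
Qed.

Lemma bicomm_add N N' M M' : bicomm N N' -> bicomm M M' ->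
  bicomm (fun x => N x + M x) (fun x => N' x + M' x).
Proof.
move=> [cN cN' a h] [cM cM' a' h']; split; [exact: comm_add|exact: comm_add| |].
  by move=> x y; rewrite dotDl dotDr a a'.
move=> B cB x; have [bB _ _] := cB; rewrite !(blinD _ _ bB).
by have [-> ->] := h B cB x; have [-> ->] := h' B cB x.
Qed.

Lemma bicomm_sub N N' M M' : bicomm N N' -> bicomm M M' ->
  bicomm (fun x => N x - M x) (fun x => N' x - M' x).
Proof.
move=> hN /(bicomm_scale (-1)) /(bicomm_add hN).
rewrite rmorphN1; congr bicomm; apply/funext => x; by rewrite scaleN1r.
Qed.

Lemma bicomm_iter N N' n : bicomm N N' -> bicomm (iter n N) (iter n N').
Proof.
move=> h; elim: n => [|n IHn]; first exact: bicomm_id.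
have := bicomm_comp h IHn; congr bicomm.
by apply/funext => x; rewrite -iterSr.
Qed.

Lemma comm_lim (N_ : nat -> X -> X) (C : R) N : (forall n, comm (N_ n)) ->
  (forall n x, nrm (N_ n x) <= C * nrm x) ->
  (forall x, N_ n x @[n --> \oo] --> N x) -> comm N.
Proof.
have cA : seq_closed A by case: nA.
have cA' := adjoint_closed norm_dot (A := A).
move=> cN bN lN; split; last 2 first.
- move=> x y h; apply: (cA _ _ _ _ _ (lN x) (lN y)) => n.
  by have [_ + _] := cN n; apply.
- move=> x y h; apply: (cA' _ _ _ _ _ (lN x) (lN y)) => n.
  by have [_ _ +] := cN n; apply.
split=> [c x y|]; last first.
  by exists C => x; apply: (nrm_le_lim (lN x)); exact: nearW.
apply: (nlim_uniq (lN _)).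
have -> : (fun n => N_ n (c *: x + y)) = (fun n => c *: N_ n x + N_ n y).
  by apply/funext => n; have [[-> _] _ _] := cN n.
by apply: cvgD; [apply: cvgZr|].
Qed.

(** The adjoints converge strongly too, since normality of [N_ m - N_ n] gives its adjoint the same
    norm on each vector. *)
Lemma bicomm_lim (N_ N_' : nat -> X -> X) (C : R) N :
  (forall n, bicomm (N_ n) (N_' n)) ->
  (forall n x, nrm (N_ n x) <= C * nrm x) ->
  (forall x, N_ n x @[n --> \oo] --> N x) -> exists N', bicomm N N'.
Proof.
move=> hN bN lN.
have /choice[N' lN'] (x : X) : exists l : X, N_' n x @[n --> \oo] --> l.
  apply: complete_seq => e e0.
  have /seq_cvgP/(_ (e / 2) (divr_gt0 e0 (ltr0Sn _ _)))[K hK] := lN x.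
  exists K => m n Km Kn; rewrite (bicomm_nrm _ (bicomm_sub (hN m) (hN n))).
  rewrite (le_lt_trans (nrm_sub (N x) _ _)) // (nrmC (N x)).
  by have := hK _ Km; have := hK _ Kn; lra.
have cN : comm N by apply: (comm_lim _ bN lN) => n; case: (hN n).
have cN' : comm N'.
  apply: (comm_lim (C := C) _ _ lN') => [n|n x]; first by case: (hN n).
  by rewrite (bicomm_nrm _ (hN n)).
exists N'; split => //.
- move=> x y; apply: (nlim_uniq (cvg_dotl norm_dot (z := y) (lN x))).
  have -> : (fun n => dot (N_ n x) y) = (fun n => dot x (N_' n y)).
    by apply/funext => n; case: (hN n).
  exact: (cvg_dotr norm_dot).
- move=> B cB x; have [bB _ _] := cB.
  have lim (M_ : nat -> X -> X) M : (forall x, M_ n x @[n --> \oo] --> M x) ->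
      (forall n x, B (M_ n x) = M_ n (B x)) -> B (M x) = M (B x).
    move=> lM hM; apply: (nlim_uniq (blin_cvg bB (lM x))).
    by under eq_fun do rewrite hM; exact: lM.
  split; [apply: lim lN _|apply: lim lN' _] => n y;
    by have [_ _ _ /(_ B cB y)[]] := hN n.
Qed.

End Normal.
End Resolvents.

(** * Joint approximate eigenvalues *)

Lemma bernoulli (R : realType) (d : R) n : 0 <= d <= 1 ->
  1 - n%:R * d <= (1 - d) ^+ n.
Proof.
move=> /andP[d0 d1]; elim: n => [|n IHn]; first by rewrite mul0r subr0 expr0.
rewrite exprS (le_trans _ (ler_wpM2l _ IHn)) ?subr_ge0 // -natr1.
rewrite -subr_ge0; set e := (X in 0 <= X).
by rewrite (_ : e = n%:R * d ^+ 2) ?mulr_ge0 ?sqr_ge0 // /e; ring.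
Qed.

Lemma cluster_circle (R : realType) (m : R) (z : nat -> R[i]) :
  (forall n, nrm (z n) = m) ->
  exists w, forall e, 0 < e -> forall N, exists2 n, (N <= n)%N & nrm (z n - w) < e.
Proof.
move=> zm; pose u n := (complex.Re (z n), complex.Im (z n)).
pose K := `[- m, m]%classic `*` `[- m, m]%classic : set (R * R).
have cK : compact K by apply: compact_setX; exact: segment_compact.
have uK n : K (u n).
  by split; rewrite /= in_itv /= -ler_norml -(zm n) ?nrm_Re ?nrm_Im.
have [[a b] [_ ab]] : K `&` cluster (u @ \oo) !=set0.
  by apply: cK; exists 0%N => // n _; exact: uK.
exists (a +i* b) => e e0 N.
have e20 : 0 < e / 2 by rewrite divr_gt0.
have h1 : (u @ \oo) [set u n | n in [set n | (N <= n)%N]].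
  by exists N => // n Nn; exists n.
have h2 : nbhs (a, b) (ball a (e / 2) `*` ball b (e / 2)).
  by exists (ball a (e / 2), ball b (e / 2)) => //; split; apply: nbhsx_ballx.
have [p [[n Nn <-] [/= ha hb]]] := ab _ _ h1 h2.
exists n => //; rewrite (le_lt_trans (nrm_ReIm _)) // (splitr e) ltrD //.
  by move: ha; rewrite -ball_normE /ball_ /= distrC; case: (z n).
by move: hb; rewrite -ball_normE /ball_ /= distrC; case: (z n).
Qed.

Section JointApproximateEigenvalues.
Context {R : realType} {X : completeNormedModType R[i]}
        {dot : {dot X for @Num.conj R[i]}}
        (norm_dot : forall x : X, `|x| ^+ 2 = dot x x).
Implicit Types (x y : X) (z w c : R[i]) (F J : X -> X).

(* Splitting the sum into its two halves and using the parallelogram law, the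
   value of [z ^+ (2 ^ n)] can be chosen, up to sign, before [z] itself. *)
Lemma large_exponential_sum n (a : nat -> X) c : nrm c = 1 ->
  exists2 z, z ^+ (2 ^ n) = c &
    \sum_(k < 2 ^ n) nrm (a k) ^+ 2 <= nrm (\sum_(k < 2 ^ n) z ^+ k *: a k) ^+ 2.
Proof.
elim: n a c => [|n IHn] a c c1.
  exists c; first by rewrite expn0 expr1.
  by rewrite expn0 !big_ord1 expr0 scale1r.
pose d := sqrtc c; have dc : d ^+ 2 = c := sqr_sqrtc c.
have d1 : nrm d = 1.
  by apply/eqP; rewrite -(@eqrXn2 _ 2) ?nrm_ge0 // -nrmX dc c1 expr1n.
pose b k := a (2 ^ n + k)%N.
pose S := \sum_(k < 2 ^ n) nrm (a k) ^+ 2 + \sum_(k < 2 ^ n) nrm (b k) ^+ 2.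
have [e [e2 e1 eS]] : exists e : R[i], [/\ e ^+ 2 = c, nrm e = 1 &
    S <= \sum_(k < 2 ^ n) nrm (a k + e *: b k) ^+ 2].
  have : \sum_(k < 2 ^ n) nrm (a k + d *: b k) ^+ 2 +
      \sum_(k < 2 ^ n) nrm (a k + (- d) *: b k) ^+ 2 = 2 * S.
    rewrite /S -!big_split /= mulr_sumr; apply: eq_bigr => k _.
    by rewrite scaleNr (nrm2D norm_dot) (nrm2B norm_dot) nrmZ d1 mul1r; ring.
  case: (lerP S (\sum_(k < 2 ^ n) nrm (a k + d *: b k) ^+ 2)) => h E.
    by exists d.
  by exists (- d); rewrite sqrrN nrmN; split => //; lra.
have [z ze zS] := IHn (fun k => a k + e *: b k) e e1.
exists z; first by rewrite expnS mulnC exprM ze.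
rewrite expnS mul2n -addnn !big_split_ord /= (le_trans eS) // (le_trans zS) //.
rewrite le_eqVlt; apply/orP; left; apply/eqP; congr (nrm _ ^+ 2).
rewrite -big_split /=; apply: eq_bigr => k _.
by rewrite exprD ze scalerDr !scalerA mulrC.
Qed.

(** The ratios [|J^(k+1) x| / |J^k x|] are nondecreasing in [k], and the first one is [|J x|]. *)
Lemma paranormal_iter J x : (forall x, nrm (J x) ^+ 2 <= nrm (J (J x)) * nrm x) ->
  nrm x = 1 -> forall k, nrm (J x) ^+ k <= nrm (iter k J x).
Proof.
move=> hJ x1; have [/eqP J0|J0] := boolP (nrm (J x) == 0).
  by case=> [|k]; rewrite ?x1 // J0 expr0n /= nrm_ge0.
have a1 : 0 < nrm (J x) by rewrite lt_def J0 nrm_ge0.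
suff h k : nrm (iter k J x) * nrm (J x) <= nrm (iter k.+1 J x) /\
    nrm (J x) ^+ k <= nrm (iter k J x) by move=> k; case: (h k).
elim: k => [|k [IH1 IH2]]; first by rewrite /= x1 mul1r.
have a0 : 0 < nrm (iter k J x) by rewrite (lt_le_trans _ IH2) // exprn_gt0.
split; last by rewrite exprSr (le_trans _ IH1) // ler_wpM2r // ltW.
rewrite -(ler_pM2r a0) (le_trans _ (hJ (iter k J x))) // -mulrA expr2.
by rewrite ler_wpM2l ?nrm_ge0 // mulrC.
Qed.

(* For [y := \sum_(k < 2 ^ n) v ^+ k *: J^k x] with [|v| = m^-1], the vector
   [J y - v^-1 *: y] telescopes and stays bounded, while a suitable [v] makes
   the square of the norm of [y] grow like [2 ^ n]. *)
Lemma joint_approx_circle F J (m C e1 d e : R) n x :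
  blin F -> blin J -> (forall x, F (J x) = J (F x)) ->
  (forall x, nrm (J x) ^+ 2 <= nrm (J (J x)) * nrm x) ->
  (forall x, nrm (J x) <= C * nrm x) -> m <= C ->
  0 < m -> 0 < e1 -> 0 < d -> d * (4 * 2 ^+ n) <= 1 -> 0 < e ->
  (forall x, nrm (F x) <= e1 * nrm x -> nrm (J x) <= m * (1 + d) * nrm x) ->
  18 * m ^+ 2 <= e ^+ 2 * 2 ^+ n ->
  nrm x = 1 -> m * (1 - d) <= nrm (J x) ->
  nrm (F x) <= e1 * (m * (1 - d) / C) ^+ (2 ^ n) ->
  nrm (F x) * (\sum_(k < 2 ^ n) (C / m) ^+ k) <= e ->
  exists z, nrm z = m /\
    exists2 y, nrm y = 1 & nrm (F y) <= e /\ nrm (J y - z *: y) <= e.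
Proof.
move=> bF bJ FJ pJ hC mC m0 e10 d0 dn e0 hm he x1 Jx Fx1 Fx2.
have C0 : 0 < C by exact: lt_le_trans mC.
pose N := (2 ^ n)%N.
have NE : (N%:R : R) = 2 ^+ n by rewrite natrX.
have N1 : 1 <= 2 ^+ n :> R by rewrite exprn_ege1 // ler1n.
have d1 : d <= 4^-1.
  rewrite -[4^-1]mul1r ler_pdivlMr // (le_trans _ dn) // ler_wpM2l ?(ltW d0) //.
  by rewrite ler_pMr.
have mu0 : 0 < m * (1 - d) by rewrite mulr_gt0 //; lra.
set q := m * (1 - d) / C in Fx1.
have q0 : 0 < q by rewrite divr_gt0.
have q1 : q <= 1 by rewrite ler_pdivrMr // mul1r (le_trans _ mC) // ger_pMr //; lra.
have qE : m * (1 - d) = C * q by rewrite /q [RHS]mulrC divfK // gt_eqF.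
clearbody q.
have lowJ k : (m * (1 - d)) ^+ k <= nrm (iter k J x).
  by rewrite (le_trans _ (paranormal_iter pJ x1 k)) // lerXn2r ?nnegrE ?nrm_ge0 ?(ltW mu0).
have FJk k : nrm (F (iter k J x)) <= C ^+ k * nrm (F x).
  elim: k => [|k IHk]; first by rewrite expr0 mul1r.
  by rewrite iterS FJ (le_trans (hC _)) // exprS -mulrA ler_wpM2l // ltW.
(* [hm] keeps applying along the iterates: [|F J^k x| <= C^k |F x| <= e1 (C q)^k <= e1 |J^k x|] for
   [k <= N], as [q <= 1]. *)
have upJ k : (k <= N)%N -> nrm (iter k J x) <= (m * (1 + d)) ^+ k.
  elim: k => [|k IHk] kN; first by rewrite x1 expr0.
  rewrite iterS (le_trans (hm _ _)) //.
    rewrite (le_trans (FJk k)) // (le_trans (ler_wpM2l (exprn_ge0 k (ltW C0)) Fx1)) //.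
    rewrite mulrCA ler_pM2l // (le_trans _ (lowJ k)) //.
    rewrite qE exprMn ler_wpM2l ?exprn_ge0 ?(ltW C0) //.
    by rewrite ler_wiXn2l ?(ltW q0) // ltnW.
  rewrite exprS ler_wpM2l ?IHk ?(ltnW kN) // mulr_ge0 ?(ltW m0) //; lra.
(* Here [k d <= 2 N d <= 1 / 2] by the choice of [d]. The exponent goes up to [2 N] because squared
   norms are bounded below. *)
have bern k : (k <= 2 * N)%N -> 2^-1 <= (1 - d) ^+ k.
  move=> kN; apply: le_trans (bernoulli k _); last by lra.
  have : k%:R * d <= 2 * N%:R * d.
    by rewrite ler_wpM2r ?(ltW d0) // -natrM ler_nat.
  rewrite NE; lra.
have up2 : (1 + d) ^+ N <= 2.
  have h : (1 - d) ^+ N * (1 + d) ^+ N <= 1.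
    by rewrite -exprMn exprn_ile1 // ?mulr_ge0; nra.
  have h' : 2^-1 <= (1 - d) ^+ N by rewrite bern // leq_pmull.
  have p0 : 0 <= (1 + d) ^+ N by rewrite exprn_ge0 //; lra.
  have : 2^-1 * (1 + d) ^+ N <= 1 by exact: le_trans (ler_wpM2r p0 h') h.
  lra.
(* With [c = 1], [z0] is a root of unity; dividing by [m ^+ k] makes all summands of size about
   1. *)
have [z0 z0N hz] := large_exponential_sum n
  (fun k => (m^-1)%:C ^+ k *: iter k J x) nrm1.
have z01 : nrm z0 = 1.
  apply/eqP; rewrite -(@eqrXn2 _ N) ?nrm_ge0 ?expn_gt0 // -nrmX z0N expr1n.
  by rewrite nrm1.
set y := \sum_(k < 2 ^ n) (z0 ^+ k *: _) in hz.
pose v := z0 * (m^-1)%:C.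
have nv : nrm v = m^-1 by rewrite nrmM z01 mul1r nrmR gtr0_norm // invr_gt0.
have v0 : v != 0 by rewrite -nrm_eq0 nv invr_eq0 gt_eqF.
have yE : y = \sum_(k < 2 ^ n) v ^+ k *: iter k J x.
  by apply: eq_bigr => k _; rewrite scalerA exprMn.
have vy : J y - v^-1 *: y = v^-1 *: (v ^+ N *: iter N J x - x).
  rewrite yE (blin_sum _ _ _ bJ) scaler_sumr -sumrB.
  have := telescope_sumr (fun k => v ^+ k *: iter k J x) (leq0n N).
  rewrite big_mkord expr0 scale1r /= => <-; rewrite scaler_sumr.
  apply: eq_bigr => k _; rewrite scalerBr !scalerA (blinZ _ _ bJ).
  by rewrite exprS mulrA mulVf // mul1r.
have mV k : m ^+ k * m^-1 ^+ k = 1 by rewrite -exprMn mulfV ?gt_eqF // expr1n.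
have ny : 1 <= nrm y /\ N%:R <= 2 * nrm y ^+ 2.
  have h k : (k < N)%N -> (1 - d) ^+ (2 * k) <=
      nrm ((m^-1)%:C ^+ k *: iter k J x) ^+ 2.
    move=> kN; rewrite nrmZ nrmX nrmR gtr0_norm ?invr_gt0 // mulnC exprM.
    have m1 : 0 <= m^-1 by rewrite invr_ge0 ltW.
    have d1' : 0 <= 1 - d by lra.
    rewrite lerXn2r ?nnegrE ?mulr_ge0 ?exprn_ge0 ?nrm_ge0 //.
    by rewrite -(ler_pM2l (exprn_gt0 k m0)) [X in _ <= X]mulrA mV mul1r -exprMn lowJ.
  split.
    rewrite -(@ler_pXn2r _ 2) ?nnegrE ?nrm_ge0 // expr1n (le_trans _ hz) //.
    have N0 : (0 < 2 ^ n)%N by rewrite expn_gt0.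
    rewrite (bigD1 (Ordinal N0)) //= expr0 scale1r x1 expr1n lerDl.
    by apply: sumr_ge0 => k _; rewrite sqr_ge0.
  suff : 2^-1 * N%:R <= \sum_(k < 2 ^ n) nrm ((m^-1)%:C ^+ k *: iter k J x) ^+ 2.
    by move: hz => hz h'; have := le_trans h' hz; lra.
  have -> : 2^-1 * N%:R = \sum_(k < 2 ^ n) (2^-1 : R).
    by rewrite sumr_const card_ord mulr_natr.
  apply: ler_sum => k _; rewrite (le_trans _ (h k (ltn_ord k))) // bern //.
  by rewrite leq_pmul2l // ltnW.
have y0 : 0 < nrm y by case: ny => + _; apply: lt_le_trans.
(* After telescoping, only the end terms of norm at most 2 and 1 remain, times [|v^-1| = m]. *)
have nJ : nrm (J y - v^-1 *: y) <= 3 * m.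
  rewrite vy nrmZ nrmV nv invrK mulrC ler_wpM2r ?(ltW m0) //.
  rewrite (le_trans (nrmB _ _)) // x1 nrmZ nrmX nv.
  have : m^-1 ^+ N * nrm (iter N J x) <= 2.
    by rewrite (le_trans _ up2) // -(ler_pM2l (exprn_gt0 N m0)) mulrA mV mul1r -exprMn upJ.
  lra.
have nF : nrm (F y) <= e.
  rewrite yE (blin_sum _ _ _ bF) (le_trans (nrm_sum _ _ _)) //.
  rewrite (le_trans _ Fx2) // mulr_sumr; apply: ler_sum => k _.
  rewrite (blinZ _ _ bF) nrmZ nrmX nv exprMn.
  have -> : nrm (F x) * (C ^+ k * m^-1 ^+ k) = m^-1 ^+ k * (C ^+ k * nrm (F x)).
    by ring.
  by rewrite ler_wpM2l ?exprn_ge0 ?invr_ge0 ?(ltW m0).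
exists v^-1; split; first by rewrite nrmV nv invrK.
exists ((nrm y)^-1%:C *: y).
  by rewrite nrmZ nrmR gtr0_norm ?invr_gt0 // mulVf // gt_eqF.
split.
  rewrite (blinZ _ _ bF) nrmZ nrmR gtr0_norm ?invr_gt0 //.
  rewrite ler_pdivrMl // (le_trans nF) // ler_peMl ?(ltW e0) //.
  by case: ny.
rewrite (blinZ _ _ bJ) scalerA [v^-1 * _]mulrC -scalerA -scalerBr nrmZ nrmR.
rewrite gtr0_norm ?invr_gt0 // ler_pdivrMl //.
(* Origin of 18: [2 (3 m)^2 <= e^2 N <= 2 e^2 |y|^2]. *)
rewrite (le_trans nJ) // -(@ler_pXn2r _ 2) //;
  try by rewrite nnegrE mulr_ge0 // ltW.
rewrite !exprMn.
have : e ^+ 2 * N%:R <= e ^+ 2 * (2 * nrm y ^+ 2).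
  by rewrite ler_wpM2l ?sqr_ge0 //; case: ny.
rewrite NE; lra.
Qed.

End JointApproximateEigenvalues.

(** * Joint approximate spectra of [A] and operators in its bicommutant *)

Section ApproximateSpectrum.
Context {R : realType} {X : completeNormedModType R[i]}
        {dot : {dot X for @Num.conj R[i]}}
        (norm_dot : forall x : X, `|x| ^+ 2 = dot x x).
Implicit Types (x y : X) (z w c l : R[i]) (F J N S : X -> X).

(* [|w|] is the norm of [J] on approximate null vectors of [F]: for [F = 0]
   this is an approximate eigenvalue of modulus [||J||], and for [F = N - mu]
   it completes [mu] to a joint approximate eigenvalue of [(N, J)]. *)
Theorem joint_approx_eigenvalue F J :
  blin F -> blin J -> (forall x, F (J x) = J (F x)) ->
  (forall x, nrm (J x) ^+ 2 <= nrm (J (J x)) * nrm x) ->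
  (forall e : R, 0 < e -> exists2 x, nrm x = 1 & nrm (F x) <= e) ->
  exists w,
    (forall e : R, 0 < e -> exists2 y, nrm y = 1 &
       nrm (F y) <= e /\ nrm (J y - w *: y) <= e) /\
    (forall h : R, 0 < h -> exists2 e : R, 0 < e & forall x, nrm x = 1 ->
       nrm (F x) <= e -> nrm (J x) <= nrm w + h).
Proof.
move=> bF bJ FJ pJ hF.
have [C C0 hC] := blin_bound bJ.
(* Its supremum [m] is the norm of [J] on approximate null vectors of [F]. Maximality keeps [|J x|]
   below [m (1 + d) |x|] on such vectors, and paranormality keeps the iterates from shrinking faster
   than the powers of [m (1 - d)]. *)
pose E := [set r : R | 0 <= r /\ forall e : R, 0 < e ->
  exists2 x, nrm x = 1 & nrm (F x) <= e /\ r <= nrm (J x)].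
have E0 : E 0.
  by split=> // e /hF [x x1 Fx]; exists x => //; rewrite nrm_ge0.
have supE : has_sup E.
  split; first by exists 0.
  exists C => r [_ /(_ 1 ltr01) [x x1 [_ rJ]]].
  by rewrite (le_trans rJ) // (le_trans (hC _)) // x1 mulr1.
pose m := sup E.
have m0 : 0 <= m by apply: sup_upper_bound.
have upm (h : R) : 0 < h -> exists2 e : R, 0 < e & forall x, nrm x = 1 ->
    nrm (F x) <= e -> nrm (J x) <= m + h.
  move=> h0; apply: contrapT => nh.
  suff /(sup_upper_bound supE) : E (m + h) by rewrite gerDl leNgt h0.
  split; first by rewrite addr_ge0 // ltW.
  move=> e e0; apply: contrapT => ne; apply: nh; exists e => // x x1 Fx.
  by rewrite leNgt; apply/negP => Jx; apply: ne; exists x => //; rewrite (ltW Jx).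
suff [w wm hw] : exists2 w, nrm w = m & forall e : R, 0 < e ->
    exists2 y, nrm y = 1 & nrm (F y) <= e /\ nrm (J y - w *: y) <= e.
  by exists w; rewrite wm.
move: m0; rewrite le_eqVlt => /predU1P[m0|m0].
  exists 0; rewrite ?nrm0 // => e e0; have [d d0 hd] := upm e e0.
  have [|x x1 Fx] := hF (Num.min e d); first by rewrite lt_min e0.
  move: Fx; rewrite le_min => /andP[Fe Fd]; exists x => //; split => //.
  by rewrite scale0r subr0 (le_trans (hd _ x1 Fd)) // -m0 add0r.
have circ (e : R) : 0 < e -> exists z, nrm z = m /\
    exists2 y, nrm y = 1 & nrm (F y) <= e /\ nrm (J y - z *: y) <= e.
  move=> e0; pose n := Num.bound (18 * m ^+ 2 / e ^+ 2).
  have n2 : n%:R <= 2 ^+ n :> R by rewrite -natrX ler_nat ltnW // ltn_expl.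
  have he : 18 * m ^+ 2 <= e ^+ 2 * 2 ^+ n.
    have g0 : 0 <= 18 * m ^+ 2 / e ^+ 2.
      by apply: divr_ge0; [apply: mulr_ge0; rewrite ?ler0n ?sqr_ge0|exact: sqr_ge0].
    rewrite -ler_pdivrMl ?exprn_gt0 // (le_trans _ n2) // mulrC ltW //.
    exact: archi_boundP.
  have p0 : 0 < 2 ^+ n :> R by rewrite exprn_gt0.
  pose d : R := (4 * 2 ^+ n)^-1.
  have d0 : 0 < d by rewrite invr_gt0 mulr_gt0.
  have dn : d * (4 * 2 ^+ n) <= 1 by rewrite mulVf // gt_eqF // mulr_gt0.
  have d1 : d < 1.
    rewrite invf_lt1 ?mulr_gt0 // (@lt_le_trans _ _ 4) ?ltr1n // ler_peMr //.
    by rewrite exprn_ege1 // ler1n.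
  have md0 : 0 < m * d by rewrite mulr_gt0.
  have [e1 e10 he1] := upm (m * d) md0.
  have hm x : nrm (F x) <= e1 * nrm x -> nrm (J x) <= m * (1 + d) * nrm x.
    have [->|x0] := eqVneq x 0; first by rewrite (blin0 bJ) nrm0 !mulr0.
    have x0' : 0 < nrm x by rewrite nrm_gt0.
    have := he1 ((nrm x)^-1%:C *: x).
    rewrite (blinZ _ _ bF) (blinZ _ _ bJ) !nrmZ nrmR gtr0_norm ?invr_gt0 //.
    rewrite mulVf ?gt_eqF // !ler_pdivrMl // => /(_ erefl) h.
    by rewrite mulrC => /h; rewrite mulrC mulrDr mulr1.
  (* A bound of [J] that also dominates [m], as [joint_approx_circle] asks. *)
  pose D := C + m.
  have D0 : 0 < D by rewrite addr_gt0.
  pose q := m * (1 - d) / D.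
  have q0 : 0 < q by rewrite !divr_gt0 // mulr_gt0 // subr_gt0.
  pose S := \sum_(k < 2 ^ n) (D / m) ^+ k.
  have S0 : 0 <= S by apply: sumr_ge0 => k _; rewrite exprn_ge0 // divr_ge0 // ltW.
  (* The first entry keeps the iterates of [x] approximate null vectors of [F], the second does so
     for their weighted sum. *)
  pose e2 := Num.min (e1 * q ^+ (2 ^ n)) (e / (S + 1)).
  have e20 : 0 < e2.
    by rewrite lt_min mulr_gt0 ?exprn_gt0 // divr_gt0 // ltr_wpDl.
  have [r [r0 Er] mr] := sup_adherent md0 supE.
  have [x x1 [Fx Jx]] := Er e2 e20.
  move: Fx; rewrite le_min => /andP[Fx1 Fx2].
  apply: (joint_approx_circle norm_dot bF bJ FJ pJ _ _ m0 e10 d0 dn e0 hm he x1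
    _ Fx1 _).
  - by move=> y; rewrite (le_trans (hC y)) // ler_wpM2r ?nrm_ge0 // lerDl ltW.
  - by rewrite lerDr ltW.
  - by rewrite mulrBr mulr1 (le_trans (ltW mr)).
  - rewrite -/S (le_trans (ler_wpM2r S0 Fx2)) // mulrAC ler_pdivrMr ?ltr_wpDl //.
    by rewrite ler_pM2l // lerDl.
have /choice[z hz] (n : nat) := circ (harmonic n) ltac:(by rewrite invr_gt0 ltr0Sn).
have [w hw] := cluster_circle (fun n => (hz n).1).
exists w.
  apply/eqP; rewrite -subr_eq0 -normr_eq0 eq_le normr_ge0 andbT.
  apply/ler_addgt0Pr => e e0; rewrite add0r; have [n _ zw] := hw e e0 0%N.
  rewrite -(hz n).1 ler_norml lerNl opprB.
  have := nrm_lerB w (z n); have := nrm_lerB (z n) w; rewrite (nrmC w) => h1 h2.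
  by rewrite (le_trans h1) ?(le_trans h2) ?ltW.
move=> e e0; have e20 : 0 < e / 2 by rewrite divr_gt0.
have /cvgr0Pnorm_lt/(_ _ e20)[M _ hM] := @cvg_harmonic R.
have [n Mn zw] := hw _ e20 M.
have hn : harmonic n < e / 2 by apply: le_lt_trans (hM n Mn); exact: ler_norm.
move: (harmonic n) hn (hz n) => h hn.
case=> _ [y y1 [Fy Jy]]; exists y => //; split; first lra.
rewrite (le_trans (nrm_sub (z n *: y) _ _)) // -scalerBl nrmZ y1 mulr1.
by move: Jy zw; lra.
Qed.

Context {A : set (X * X)} (nA : nop (dot := dot) A).
Local Notation A' := (adjoint dot A).

(** By [bound_resolvent], a lower bound on [l - A] already gives a resolvent, so every point of the
    spectrum is an approximate eigenvalue. *)
Lemma spectrumP l : spectrum A l <-> forall e : R, 0 < e ->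
  exists x y, [/\ A (x, y), nrm x = 1 & nrm (y - l *: x) <= e].
Proof.
have sA : submodule A by case: nA.
split=> [nl e e0|h /resolvent_setP [S /resolvent_bound[c c0 hc]]]; last first.
  have [x [y [Axy x1]]] := h (c / 2) ltac:(by rewrite divr_gt0).
  by have := hc _ _ Axy; rewrite x1 mulr1 nrmC => h1 h2; have := le_trans h1 h2; lra.
apply: contrapT => ne; apply: nl; apply/resolvent_setP.
apply: (bound_resolvent norm_dot nA e0) => x y Axy.
have [->|x0] := eqVneq x 0; first by rewrite nrm0 mulr0 nrm_ge0.
have x0' : 0 < nrm x by rewrite nrm_gt0.
rewrite leNgt; apply/negP => h; apply: ne.
exists ((nrm x)^-1%:C *: x), ((nrm x)^-1%:C *: y); split.
- exact: (submoduleZ (nrm x)^-1%:C sA Axy).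
- by rewrite nrmZ nrmR gtr0_norm ?invr_gt0 // mulVf // gt_eqF.
rewrite scalerA mulrC -scalerA -scalerBr nrmZ nrmR gtr0_norm ?invr_gt0 //.
by rewrite ler_pdivrMl // mulrC nrmC ltW.
Qed.

Definition joint_spectrum N (mu l : R[i]) : Prop := forall e : R, 0 < e ->
  exists x y, [/\ A (x, y), nrm x = 1, nrm (y - l *: x) <= e
    & nrm (N x - mu *: x) <= e].

Lemma joint_spectrum_spectrum N mu l : joint_spectrum N mu l -> spectrum A l.
Proof.
by move=> h; apply/spectrumP => e /h[x [y [Axy x1 xy _]]]; exists x, y.
Qed.

(** [joint_approx_eigenvalue] is used twice: for [N S] with [F = 0], which gives [mu] of modulus the
    norm of [N S], then for [S] with [F = N S - mu], which gives [w]. From [S x ~ w x] follow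
    [A ~ l0 - w^-1] and [N ~ mu / w] on [S x]; if [w = 0], boundedness of [N] forces [mu = 0]. The
    vector [x0] supplies a unit vector for the first use. *)
Lemma joint_spectrum_resolvent N N' l0 S x0 : bicomm (dot := dot) (A := A) N N' ->
  resolvent A l0 S -> x0 != 0 ->
  exists mu, (forall x, nrm (N (S x)) <= nrm mu * nrm x) /\
    (mu = 0 \/ exists2 w, w != 0 & joint_spectrum N (mu / w) (l0 - w^-1)).
Proof.
move=> hN rS x00; have sA : submodule A by case: nA.
have [S' hS] := resolvent_bicomm norm_dot nA rS.
have hG := bicomm_comp hN hS.
have bN := bicomm_blin hN; have bS := rS.1; have bG := bicomm_blin hG.
have n0 : 0 < nrm x0 by rewrite nrm_gt0.
have b0 : blin (fun _ : X => 0 : X).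
  by split=> [c x y|]; [rewrite scaler0 addr0|exists 0 => x; rewrite mul0r nrm0].
have [mu [mu1 mu2]] : exists mu,
    (forall e : R, 0 < e -> exists2 y, nrm y = 1 &
      nrm (0 : X) <= e /\ nrm (N (S y) - mu *: y) <= e) /\
    (forall h : R, 0 < h -> exists2 e : R, 0 < e & forall x, nrm x = 1 ->
       nrm (0 : X) <= e -> nrm (N (S x)) <= nrm mu + h).
  apply: (joint_approx_eigenvalue (F := fun=> 0)) => //.
  - by move=> x; rewrite (blin0 bG).
  - by move=> x; exact: (bicomm_logconvex norm_dot _ hG).
  - move=> e e0; exists ((nrm x0)^-1%:C *: x0); last by rewrite nrm0 ltW.
    by rewrite nrmZ nrmR gtr0_norm ?invr_gt0 // mulVf // gt_eqF.
exists mu; split.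
  move=> x; have [->|xn0] := eqVneq x 0; first by rewrite (blin0 bG) nrm0 mulr0.
  have x0' : 0 < nrm x by rewrite nrm_gt0.
  apply/ler_addgt0Pr => e e0.
  have [d d0 hd] := mu2 (e / nrm x) (divr_gt0 e0 x0').
  have := hd ((nrm x)^-1%:C *: x).
  rewrite (blinZ _ _ bG) !nrmZ nrmR gtr0_norm ?invr_gt0 // mulVf ?gt_eqF //.
  rewrite nrm0 => /(_ erefl (ltW d0)).
  by rewrite ler_pdivrMl // mulrDr mulrCA mulfV ?gt_eqF // mulr1 mulrC.
have [w [hw _]] : exists w,
    (forall e : R, 0 < e -> exists2 y, nrm y = 1 &
      nrm (N (S y) - mu *: y) <= e /\ nrm (S y - w *: y) <= e) /\
    (forall h : R, 0 < h -> exists2 e : R, 0 < e & forall x, nrm x = 1 ->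
       nrm (N (S x) - mu *: x) <= e -> nrm (S x) <= nrm w + h).
  apply: (joint_approx_eigenvalue (F := fun x => N (S x) - mu *: x)) => //.
  - exact: blin_sub bG (blin_scale mu blin_id).
  - by move=> x; rewrite (blinB _ _ bS) (blinZ _ _ bS) (bicommC _ hN hS).
  - by move=> x; exact: (bicomm_logconvex norm_dot _ hS).
  - by move=> e /mu1 [y y1 [_ hy]]; exists y.
have [CN CN0 hCN] := blin_bound bN.
have [w0|w0] := eqVneq w 0; [left|right].
  apply/eqP; rewrite -nrm_eq0 eq_le nrm_ge0 andbT.
  apply/ler_addgt0Pr => e e0; rewrite add0r.
  have d0 : 0 < e / (1 + CN) by rewrite divr_gt0 // addr_gt0.
  have [y y1 [h1 h2]] := hw _ d0.
  move: h2; rewrite w0 scale0r subr0 => h2.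
  have h3 : nrm (N (S y)) <= CN * (e / (1 + CN)).
    by rewrite (le_trans (hCN _)) // ler_wpM2l // ltW.
  have := nrm_lerB (mu *: y) (N (S y)); rewrite nrmC nrmZ y1 mulr1.
  have : e / (1 + CN) + CN * (e / (1 + CN)) = e.
    by rewrite -{1}[e / _]mul1r -mulrDl mulrC divfK // gt_eqF // addr_gt0.
  lra.
exists w => // e e0.
have nw : 0 < nrm w by rewrite nrm_gt0.
(* Both errors on [u = S x] are at most [K d]. The first entry of [d] ensures [|u| >= |w| / 2], so
   the second keeps the errors below [e] after normalizing [u]. *)
pose K := 1 + (nrm w)^-1 + nrm (mu / w).
have K0 : 0 < K by rewrite ltr_wpDr ?nrm_ge0 // addr_gt0 // invr_gt0.
pose d := Num.min (nrm w / 2) (e * (nrm w / 2) / K).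
have d0 : 0 < d by rewrite lt_min !(divr_gt0, mulr_gt0).
have [x x1 [h1 h2]] := hw _ d0.
have [v Av vE] := resolventP x rS; set u := S x in Av vE h1 h2.
have dK : d * K <= e * (nrm w / 2) by rewrite -ler_pdivlMr // ge_min lexx orbT.
have dw : d <= nrm w / 2 by rewrite ge_min lexx.
have nu : nrm w / 2 <= nrm u.
  have := nrm_lerB (w *: x) u; rewrite nrmC nrmZ x1 mulr1; lra.
have u0 : 0 < nrm u by rewrite (lt_le_trans _ nu) // divr_gt0.
have small (c : R) y : nrm y <= c * d -> 0 <= c -> c <= K -> nrm ((nrm u)^-1%:C *: y) <= e.
  move=> yc c0 cK; rewrite nrmZ nrmR gtr0_norm ?invr_gt0 // ler_pdivrMl //.
  rewrite (le_trans yc) // (le_trans (ler_wpM2r (ltW d0) cK)) // mulrC.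
  by rewrite (le_trans dK) // mulrC ler_wpM2r // ltW.
exists ((nrm u)^-1%:C *: u), ((nrm u)^-1%:C *: v); split.
- exact: (submoduleZ (nrm u)^-1%:C sA Av).
- by rewrite nrmZ nrmR gtr0_norm ?invr_gt0 // mulVf // gt_eqF.
- rewrite scalerA mulrC -scalerA -scalerBr; apply: (small (nrm w)^-1).
  + have -> : v - (l0 - w^-1) *: u = w^-1 *: (u - w *: x).
      rewrite scalerBl scalerBr scalerA mulVf // scale1r -vE !opprB.
      exact: addrCA.
    by rewrite nrmZ nrmV ler_pM2l ?invr_gt0.
  + by rewrite invr_ge0 ltW.
  + by rewrite /K addrAC lerDr addr_ge0 ?nrm_ge0.
- rewrite (blinZ _ _ bN) scalerA [mu / w * _]mulrC -scalerA -scalerBr.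
  apply: (small (1 + nrm (mu / w))).
  + have -> : N u - (mu / w) *: u = (N u - mu *: x) - (mu / w) *: (u - w *: x).
      by rewrite scalerBr scalerA divfK // opprB addrA subrK.
    rewrite (le_trans (nrmB _ _)) // nrmZ mulrDl mul1r lerD //.
    by rewrite ler_wpM2l ?nrm_ge0.
  + by rewrite addr_ge0 ?nrm_ge0.
  + by rewrite /K addrAC lerDl invr_ge0 ltW.
Qed.

End ApproximateSpectrum.

(** * The implicit Euler scheme *)

Section RealExponential.
Context {R : realType}.
Implicit Types u : R.

Lemma invr_le_expR u : 0 <= u <= 2^-1 -> (1 - u)^-1 <= expR (2 * u).
Proof.
move=> /andP[u0 u1]; apply: le_trans (expR_ge1Dx _).
have p : 0 < 1 - u by lra.
by rewrite -[_^-1]mul1r ler_pdivrMr //; nra.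
Qed.

Lemma expR_le1D u : 0 <= u <= 2^-1 -> expR u <= 1 + 2 * u.
Proof.
move=> /andP[u0 u1]; have p : 0 < 1 - u by lra.
have h : 1 - u <= expR (- u) by exact: expR_ge1Dx.
rewrite -[expR u]invrK -expRN (@le_trans _ _ (1 - u)^-1) //.
  by rewrite lef_pV2 ?posrE ?expR_gt0.
by rewrite -[_^-1]mul1r ler_pdivrMr //; nra.
Qed.

End RealExponential.

Section Telescope.
Context {R : realType} {X : completeNormedModType R[i]}.

(** [P^n - Q^n] is the sum of the [P^(n - 1 - i) Q^i (P - Q)]: power bounds turn an error per step
    into a global one. *)
Lemma telescope_iter (P Q : X -> X) (M1 M2 : R) n x : blin P -> blin Q ->
  (forall x, P (Q x) = Q (P x)) -> 0 <= M1 ->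
  (forall k x, (k <= n)%N -> nrm (iter k P x) <= M1 * nrm x) ->
  (forall k x, (k <= n)%N -> nrm (iter k Q x) <= M2 * nrm x) ->
  nrm (iter n P x - iter n Q x) <= n%:R * (M1 * M2 * nrm (P x - Q x)).
Proof.
move=> bP bQ PQ M10 hP hQ.
have PQk k y : P (iter k Q y) = iter k Q (P y).
  by elim: k => //= k IHk; rewrite PQ IHk.
have E k : iter k P x - iter k Q x =
    \sum_(i < k) iter (k - i.+1) P (iter i Q (P x - Q x)).
  elim: k => [|k IHk]; first by rewrite big_ord0 subrr.
  rewrite big_ord_recr /= subnn /=.
  have -> : \sum_(i < k) iter (k - i) P (iter i Q (P x - Q x)) =
      P (\sum_(i < k) iter (k - i.+1) P (iter i Q (P x - Q x))).
    rewrite (blin_sum _ _ _ bP); apply: eq_bigr => i _.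
    by rewrite -iterS -subSn.
  rewrite -IHk (blinB _ _ bP) PQk (blinB _ _ (blin_iter k bQ)).
  by rewrite -iterS addrA subrK -iterSr.
rewrite E (le_trans (nrm_sum _ _ _)) // -[X in X%:R]card_ord mulr_natl -sumr_const.
apply: ler_sum => i _; rewrite (le_trans (hP _ _ _)) ?leq_subr // -mulrA.
by rewrite ler_wpM2l // hQ // ltnW.
Qed.

End Telescope.

Section ImplicitEuler.
Context {R : realType} {X : completeNormedModType R[i]}
        {dot : {dot X for @Num.conj R[i]}}
        (norm_dot : forall x : X, `|x| ^+ 2 = dot x x)
        {A : set (X * X)} (nA : nop (dot := dot) A)
        {w : R} (w_gt0 : 0 < w)
        (spA : forall l : R[i], spectrum A l -> complex.Re l <= w).
Implicit Types (x y : X) (l : R[i]) (s t : R) (N J S : X -> X).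
Local Notation A' := (adjoint dot A).

(** In [joint_spectrum_resolvent], [|mu / z| <= K], and since [l - z^-1] is in the spectrum,
    [|z^-1| >= Re l - w]; multiply. *)
Lemma joint_spectrum_resolvent_bound N N' l S (K : R) :
  bicomm (dot := dot) (A := A) N N' -> resolvent A l S -> w < complex.Re l ->
  0 <= K -> (forall mu l, joint_spectrum (A := A) N mu l -> nrm mu <= K) ->
  forall x, nrm (N (S x)) <= K / (complex.Re l - w) * nrm x.
Proof.
move=> hN rS wl K0 hK x.
have p : 0 < complex.Re l - w by rewrite subr_gt0.
have bG := blin_comp (bicomm_blin hN) rS.1.
have [->|x0] := eqVneq x 0; first by rewrite (blin0 bG) nrm0 mulr0.
have [mu [hmu h]] := joint_spectrum_resolvent norm_dot nA hN rS x0.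
rewrite (le_trans (hmu x)) // ler_wpM2r ?nrm_ge0 //.
case: h => [->|[z z0 hz]]; first by rewrite nrm0 divr_ge0 // ltW.
have := spA (joint_spectrum_spectrum norm_dot nA hz).
rewrite raddfB /= => h.
have nz : complex.Re l - w <= nrm z^-1.
  by rewrite (le_trans _ (nrm_Re _)) // (le_trans _ (ler_norm _)) //; lra.
rewrite -[mu](divfK z0) nrmM ler_pM ?nrm_ge0 ?(hK _ _ hz) //.
by rewrite -[nrm z]invrK -nrmV lef_pV2 ?posrE // (lt_le_trans p).
Qed.

Lemma joint_spectrum_id mu l : joint_spectrum (A := A) id mu l -> nrm mu <= 1.
Proof.
move=> h; apply/ler_addgt0Pr => e /h [x [y [_ x1 _]]].
have := nrm_lerB (mu *: x) x; rewrite nrmZ x1 mulr1 nrmC; lra.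
Qed.

(** [J = (1 - s A)^-1]. The last clause with [N = id] bounds [J]; for a general
    [N], the limit [s --> 0] bounds [N] by its joint spectrum with [A]. *)
Definition euler_step s J : Prop :=
  [/\ exists J', bicomm (dot := dot) (A := A) J J',
      forall f, exists2 y, A (J f, y) & J f - s%:C *: y = f,
      forall x y, A (x, y) -> J (x - s%:C *: y) = x
    & forall N N' (K : R), bicomm (dot := dot) (A := A) N N' -> 0 <= K ->
      (forall mu l, joint_spectrum (A := A) N mu l -> nrm mu <= K) ->
      forall x, nrm (N (J x)) <= K * expR (2 * (s * w)) * nrm x].

Lemma ex_euler_step s : 0 < s -> s * w <= 2^-1 -> exists J, euler_step s J.
Proof.
move=> s0 sw.
have ws : w < complex.Re (s^-1%:C).
  rewrite /= -(ltr_pM2l s0) mulfV ?gt_eqF //; lra.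
have [S rS] : exists S, resolvent A s^-1%:C S.
  apply/resolvent_setP; apply: contrapT => /spA; rewrite leNgt ws //.
have [S' hS] := resolvent_bicomm norm_dot nA rS.
exists (fun f => S (s^-1%:C *: f)); split.
- have h := bicomm_comp hS (bicomm_scale nA s^-1%:C (bicomm_id (A := A))).
  by eexists; exact: h.
- move=> f; have [y Ay yE] := resolventP (s^-1%:C *: f) rS; exists y => //.
  move/(congr1 (fun x => s%:C *: x)): yE.
  by rewrite scalerBr !scalerA -rmorphM mulfV ?gt_eqF // !scale1r.
- move=> x y Axy; rewrite scalerBr !scalerA -rmorphM mulVf ?gt_eqF // scale1r.
  exact: resolventE rS Axy.
- move=> N N' K hN K0 hK x.
  rewrite (le_trans (joint_spectrum_resolvent_bound hN rS ws K0 hK _)) //.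
  rewrite nrmZ nrmR gtr0_norm ?invr_gt0 // mulrA ler_wpM2r ?nrm_ge0 //.
  rewrite -mulrA ler_wpM2l // -invfM /= mulrBl mulVf ?gt_eqF // mulrC.
  by rewrite invr_le_expR // sw andbT mulr_ge0 ?ltW.
Qed.

(** [(1 - s A)^-1], and the identity where this inverse is not known to exist. *)
Definition euler s : X -> X :=
  match pselect (0 < s /\ s * w <= 2^-1) with
  | left h => projT1 (cid (ex_euler_step h.1 h.2))
  | right _ => id
  end.

Lemma eulerP s : 0 < s -> s * w <= 2^-1 -> euler_step s (euler s).
Proof.
move=> s0 sw; rewrite /euler; case: pselect => [h|[]//].
by case: cid.
Qed.

Lemma euler0 s : s <= 0 -> euler s = id.
Proof.
move=> s0; rewrite /euler; case: pselect => // h; exfalso.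
by case: h; rewrite ltNge s0.
Qed.

Lemma euler_bicomm s : exists J', bicomm (dot := dot) (A := A) (euler s) J'.
Proof.
rewrite /euler; case: pselect => [h|_]; first by case: cid => J [].
by exists id; exact: bicomm_id.
Qed.

Lemma euler_blin s : blin (euler s).
Proof. by have [J' /bicomm_blin] := euler_bicomm s. Qed.

Lemma eulerC s t x : euler s (euler t x) = euler t (euler s x).
Proof.
have [J' hJ] := euler_bicomm s; have [J2 hJ2] := euler_bicomm t.
exact: bicommC hJ hJ2.
Qed.

Lemma euler_id s x y : 0 <= s -> s * w <= 2^-1 -> A (x, y) ->
  euler s (x - s%:C *: y) = x.
Proof.
rewrite le_eqVlt => /predU1P[<- _ _|s0 sw Axy]; last first.
  by have [_ _ + _] := eulerP s0 sw; apply.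
by rewrite euler0 // scale0r subr0.
Qed.

Lemma euler_comm s x y : A (x, y) -> A (euler s x, euler s y).
Proof. by have [J' [[_ + _] _ _ _]] := euler_bicomm s; apply. Qed.

Lemma euler_dom s f : 0 < s -> s * w <= 2^-1 -> exists y, A (euler s f, y).
Proof. by move=> s0 sw; have [_ /(_ f)[y Ay _] _ _] := eulerP s0 sw; exists y. Qed.

Lemma euler_nrm s x : 0 <= s -> nrm (euler s x) <= expR (2 * (s * w)) * nrm x.
Proof.
move=> s0; have [[s1 sw]|h] := pselect (0 < s /\ s * w <= 2^-1).
  have [_ _ _ h] := eulerP s1 sw.
  have := h id id 1 (bicomm_id (A := A)) ler01; rewrite mul1r; apply.
  exact: joint_spectrum_id.
have -> : euler s = id by rewrite /euler; case: pselect.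
by rewrite ler_peMl ?nrm_ge0 // -expR0 ler_expR !mulr_ge0 // ltW.
Qed.

Lemma euler_sub s x y : 0 <= s -> s * w <= 2^-1 -> A (x, y) ->
  euler s x - x = s%:C *: euler s y.
Proof.
move=> s0 sw Axy; rewrite -[X in _ - X](euler_id s0 sw Axy).
by rewrite (blinB _ _ (euler_blin s)) (blinZ _ _ (euler_blin s)) opprB addrC subrK.
Qed.

Lemma euler_iter_nrm n s x : 0 <= s ->
  nrm (iter n (euler s) x) <= expR (2 * (n%:R * s * w)) * nrm x.
Proof.
move=> s0; elim: n => [|n IHn]; first by rewrite !mul0r mulr0 expR0 mul1r.
rewrite iterS (le_trans (euler_nrm _ s0)) //.
rewrite (le_trans (ler_wpM2l (expR_ge0 _) IHn)) // [X in X <= _]mulrA -expRD.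
by rewrite -natr1 le_eqVlt; apply/orP; left; apply/eqP; congr (expR _ * _); ring.
Qed.

Lemma euler_nrm1 s x : 0 <= s -> s * w <= 2^-1 -> nrm (euler s x) <= expR 1 * nrm x.
Proof.
move=> s0 sw; rewrite (le_trans (euler_nrm _ s0)) // ler_wpM2r ?nrm_ge0 //.
by rewrite ler_expR; lra.
Qed.

Lemma euler_cvg x (e : R) : 0 < e -> exists2 d, 0 < d & forall s, 0 < s -> s < d ->
  s * w <= 2^-1 /\ nrm (euler s x - x) < e.
Proof.
move=> e0; have [_ _ dA _ _] := nA.
set c := expR (1 : R); have c0 : 0 < c by exact: expR_gt0.
have c1 : 1 <= c by rewrite -expR0 ler_expR.
have [[u v] [Auv /= xu]] := dA x _ (divr_gt0 e0 (mulr_gt0 (ltr0Sn R 3) c0)).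
pose K := 2 * c * nrm v + 1.
have K0 : 0 < K by rewrite ltr_wpDl // !mulr_ge0 ?nrm_ge0 ?ltW.
exists (Num.min (2^-1 / w) (e / K)).
  by rewrite lt_min !divr_gt0.
move=> s s0; rewrite lt_min !ltr_pdivlMr // => /andP[/ltW sw sK].
split => //.
have := xu; rewrite ltr_pdivlMr ?mulr_gt0 // => xu'.
have h1 : nrm (euler s x - euler s u) <= c * nrm (x - u).
  by rewrite -(blinB _ _ (euler_blin s)) euler_nrm1 // ltW.
have h2 : nrm (euler s u - u) <= s * (c * nrm v).
  rewrite (euler_sub (ltW s0) sw Auv) nrmZ nrmR gtr0_norm //.
  by rewrite ler_wpM2l ?(ltW s0) // euler_nrm1 // ltW.
have h3 : nrm (u - x) <= c * nrm (x - u) by rewrite nrmC ler_peMl ?nrm_ge0.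
have := nrm_sub (euler s u) (euler s x) x; have := nrm_sub u (euler s u) x.
move: sK; rewrite /K mulrDr mulr1; lra.
Qed.

(** Two Euler steps send [x] into the domain of [A^2], where the local error of the scheme is of
    second order. *)
Lemma dense_dom2 x (e : R) : 0 < e ->
  exists u v z, [/\ A (u, v), A (v, z) & nrm (x - u) < e].
Proof.
move=> e0; set c := expR (1 : R); have c0 : 0 < c by exact: expR_gt0.
have [d d0 hd] := euler_cvg x (divr_gt0 e0 (addr_gt0 (@ltr01 R) c0)).
pose s := d / 2.
have s0 : 0 < s by rewrite divr_gt0.
have [sw h] := hd s s0 ltac:(by rewrite /s; lra).
have [v Av] := euler_dom x s0 sw.
have [z Az] := euler_dom v s0 sw.
exists (euler s (euler s x)), (euler s v), z; split => //; first exact: euler_comm.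
rewrite nrmC (le_lt_trans (nrm_sub (euler s x) _ _)) //.
rewrite -(blinB _ _ (euler_blin s)).
have h' : nrm (euler s (euler s x - x)) <= c * nrm (euler s x - x).
  by rewrite euler_nrm1 // ltW.
move: h; rewrite ltr_pdivlMr ?addr_gt0 //; lra.
Qed.

(** The last clause of [euler_step] at a step so small that [N (euler s x)] is close to [N x];
    [s w <= 1 / 2] gives the factor [expR 1]. *)
Lemma joint_spectrum_bound N N' (K : R) :
  bicomm (dot := dot) (A := A) N N' -> 0 <= K ->
  (forall mu l, joint_spectrum (A := A) N mu l -> nrm mu <= K) ->
  forall x, nrm (N x) <= K * expR 1 * nrm x.
Proof.
move=> hN K0 hK x; have bN := bicomm_blin hN; have [C C0 hC] := blin_bound bN.
apply/ler_addgt0Pr => e e0.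
have [d d0 hd] := euler_cvg x (divr_gt0 e0 C0).
have s0 : 0 < d / 2 by rewrite divr_gt0.
have [sw h] := hd _ s0 ltac:(lra).
have [_ _ _ /(_ N N' K hN K0 hK x) b] := eulerP s0 sw.
have h' : nrm (N (euler (d / 2) x) - N x) <= e.
  rewrite -(blinB _ _ bN) (le_trans (hC _)) // mulrC -ler_pdivlMr // ltW //.
have := nrm_lerB (N x) (N (euler (d / 2) x)); rewrite (nrmC (N x)).
have b' : nrm (N (euler (d / 2) x)) <= K * expR 1 * nrm x.
  rewrite (le_trans b) // ler_wpM2r ?nrm_ge0 // ler_wpM2l // ler_expR; lra.
lra.
Qed.

(** Since [(1 - s A) (1 - t A) = 1 - (s + t) A + s t A^2], the difference is [- s t A^2] composed
    with three Euler steps, each bounded by [expR 1]. *)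
Lemma euler_add s t x y z : 0 <= s -> 0 <= t -> (s + t) * w <= 2^-1 ->
  A (x, y) -> A (y, z) ->
  nrm (euler s (euler t x) - euler (s + t) x) <= s * t * expR 3 * nrm z.
Proof.
move=> s0 t0 stw Axy Ayz.
have sA : submodule A by case: nA.
have sw : s * w <= 2^-1.
  by move: stw; rewrite mulrDl; have := mulr_ge0 t0 (ltW w_gt0); lra.
have tw : t * w <= 2^-1.
  by move: stw; rewrite mulrDl; have := mulr_ge0 s0 (ltW w_gt0); lra.
have st0 : 0 <= s + t by rewrite addr_ge0.
have bs := euler_blin s; have bt := euler_blin t; have bst := euler_blin (s + t).
have E1 : euler s (euler t (x - (s + t)%:C *: y + (s * t)%:C *: z)) = x.
  have -> : x - (s + t)%:C *: y + (s * t)%:C *: z =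
      (x - s%:C *: y) - t%:C *: (y - s%:C *: z).
    rewrite scalerBr scalerA -rmorphM opprB addrA [t * s]mulrC.
    rewrite [RHS]addrAC; congr (_ + _).
    by rewrite rmorphD scalerDl opprD addrA.
  have h : A (x - s%:C *: y, y - s%:C *: z).
    exact: (submoduleB sA Axy (submoduleZ s%:C sA Ayz)).
  by rewrite (euler_id t0 tw h) (euler_id s0 sw Axy).
have E2 := euler_id st0 stw Axy.
pose f := euler s (euler t (euler (s + t) z)).
have -> : euler s (euler t x) - euler (s + t) x = - ((s * t)%:C *: f).
  rewrite -[in X in X - _]E2 -[in X in _ - X]E1.
  rewrite (eulerC (s + t) s) (eulerC (s + t) t) -(blinB _ _ bs) -(blinB _ _ bt).
  rewrite -(blinB _ _ bst) opprD addrA subrr sub0r (blinN _ bst) (blinZ _ _ bst).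
  by rewrite (blinN _ bt) (blinZ _ _ bt) (blinN _ bs) (blinZ _ _ bs).
rewrite nrmN nrmZ nrmR ger0_norm ?mulr_ge0 // -[_ * _ * _ * nrm z]mulrA.
rewrite ler_wpM2l ?mulr_ge0 // /f.
rewrite (le_trans (euler_nrm1 _ s0 sw)) //.
have -> : (3 : R) = 1 + (1 + 1) by ring.
rewrite !expRD -mulrA ler_wpM2l ?expR_ge0 //.
rewrite (le_trans (euler_nrm1 _ t0 tw)) // -mulrA ler_wpM2l ?expR_ge0 //.
exact: euler_nrm1.
Qed.

End ImplicitEuler.

Section Sequences.
Context {R : realType} {X : completeNormedModType R[i]}.

Lemma cvg_inv_exp2 (c : R) : c / 2 ^+ k @[k --> \oo] --> (0 : R).
Proof.
rewrite -(mulr0 c); apply: cvgM; first exact: cvg_cst.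
under eq_fun do rewrite -exprVn.
by apply: cvg_expr; rewrite ger0_norm ?invr_ge0 // invf_lt1 // ltr1n.
Qed.

Lemma geometric_cvg (u : nat -> X) (c : R) K :
  (forall k, (K <= k)%N -> nrm (u k.+1 - u k) <= c / 2 ^+ k) ->
  exists l : X, u @ \oo --> l /\ nrm (l - u K) <= 2 * c / 2 ^+ K.
Proof.
move=> hu.
have c0 : 0 <= c.
  have := le_trans (nrm_ge0 _) (hu K (leqnn K)).
  by rewrite pmulr_lge0 // invr_gt0 exprn_gt0.
have b m j : (K <= m)%N ->
    nrm (u (m + j)%N - u m) <= 2 * c / 2 ^+ m - 2 * c / 2 ^+ (m + j).
  move=> Km; elim: j => [|j IHj]; first by rewrite addn0 !subrr nrm0.
  rewrite addnS (le_trans (nrm_sub (u (m + j)%N) _ _)) //.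
  have := hu (m + j)%N (leq_trans Km (leq_addr _ _)).
  have -> : c / 2 ^+ (m + j) = 2 * c / 2 ^+ (m + j) - 2 * c / 2 ^+ (m + j).+1.
    by rewrite exprS; field; rewrite gt_eqF ?exprn_gt0.
  lra.
have b' m j : (K <= m)%N -> nrm (u (m + j)%N - u m) <= 2 * c / 2 ^+ m.
  move=> /(b m j) /le_trans; apply; rewrite gerBl.
  by apply: divr_ge0; rewrite ?exprn_ge0 ?mulr_ge0 ?ler0n.
have [l ul] : exists l : X, u @ \oo --> l.
  apply: complete_seq => e e0.
  have /cvgr0Pnorm_lt/(_ e e0)[M _ hM] := cvg_inv_exp2 (2 * (2 * c)).
  exists (maxn K M) => m n; rewrite !geq_max => /andP[Km Mm] /andP[Kn Mn].
  wlog mn : m n Km Mm Kn Mn / (m <= n)%N.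
    by move=> H; case: (leqP m n) => [|/ltnW] mn; [|rewrite nrmC]; apply: H.
  rewrite nrmC -(subnKC mn) (le_lt_trans (b' _ _ Km)) //.
  apply: le_lt_trans (hM m Mm); rewrite (le_trans _ (ler_norm _)) //.
  by rewrite -[X in _ <= X]mulrA ler_peMl ?divr_ge0 ?mulr_ge0 ?exprn_ge0 // ler1n.
exists l; split=> //.
apply: (@nrm_le_lim _ _ _ \oo _ (fun k => u k - u K)).
  by apply: cvgB => //; exact: cvg_cst.
by exists K => // k /= Kk; rewrite -(subnKC Kk) b'.
Qed.

Lemma cvg_bounded_comp (f : nat -> X -> X) (M : R) (u : nat -> X) (a b : X) :
  (forall k, blin (f k)) -> (forall k x, nrm (f k x) <= M * nrm x) ->
  u @ \oo --> a -> f k a @[k --> \oo] --> b -> f k (u k) @[k --> \oo] --> b.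
Proof.
move=> bf fM ua fb.
have -> : (fun k => f k (u k)) = (fun k => f k (u k - a) + f k a).
  by apply/funext => k; rewrite (blinB _ _ (bf k)) subrK.
rewrite -[b]add0r; apply: cvgD => //.
apply/cvg_nrm; apply: (squeeze_cvgr (f := fun=> 0)
  (h := fun k => M * nrm (u k - a))).
- by near=> k; rewrite nrm_ge0 subr0 fM.
- exact: cvg_cst.
- rewrite -(mulr0 M); apply: cvgM; first exact: cvg_cst.
  by apply/cvg_nrm.
Unshelve. all: by end_near. Qed.

Lemma iter_comp (f g : X -> X) n x : (forall x, f (g x) = g (f x)) ->
  iter n (fun x => f (g x)) x = iter n f (iter n g x).
Proof.
move=> fg; elim: n => //= n ->.
have h k y : g (iter k f y) = iter k f (g y) by elim: k => //= k IH; rewrite -fg IH.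
by rewrite h.
Qed.

End Sequences.

Section EulerSemigroup.
Context {R : realType} {X : completeNormedModType R[i]}
        {dot : {dot X for @Num.conj R[i]}}
        (norm_dot : forall x : X, `|x| ^+ 2 = dot x x)
        {A : set (X * X)} (nA : nop (dot := dot) A)
        {w : R} (w_gt0 : 0 < w)
        (spA : forall l : R[i], spectrum A l -> complex.Re l <= w).
Implicit Types (x y z : X) (s t h : R).

Local Notation euler := (euler norm_dot nA w_gt0 spA).
Local Notation J := euler.

(** Dyadic subdivision gives [E t k.+1 = E (t / 2) k \o E (t / 2) k], so [euler_approx_add] yields
    convergence in [k] as well as the semigroup law. *)
Definition euler_approx t k : X -> X := iter (2 ^ k) (J (t / 2 ^+ k)).
Local Notation E := euler_approx.

Let JC s t x : J s (J t x) = J t (J s x).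
Proof. exact: eulerC. Qed.

Lemma euler_approx_blin t k : blin (E t k).
Proof. by apply: blin_iter; exact: euler_blin. Qed.

Lemma step_mulK t k : (2 ^ k)%:R * (t / 2 ^+ k) = t.
Proof. by rewrite natrX mulrC divfK // gt_eqF // exprn_gt0. Qed.

Lemma step_ge0 t k : 0 <= t -> 0 <= t / 2 ^+ k.
Proof. by move=> t0; rewrite divr_ge0 // exprn_ge0. Qed.

Lemma step_le t k : 0 <= t -> t / 2 ^+ k <= t.
Proof.
by move=> t0; rewrite ler_pdivrMr ?exprn_gt0 // ler_peMr // exprn_ege1 // ler1n.
Qed.

Lemma iter_step_nrm t k j x : 0 <= t -> (j <= 2 ^ k)%N ->
  nrm (iter j (J (t / 2 ^+ k)) x) <= expR (2 * (t * w)) * nrm x.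
Proof.
move=> t0 jk; rewrite (le_trans (euler_iter_nrm _ _ _ _ _ _ (step_ge0 k t0))) //.
rewrite ler_wpM2r ?nrm_ge0 // ler_expR ler_pM2l // ler_pM2r //.
by rewrite -[X in _ <= X](step_mulK t k) ler_wpM2r ?step_ge0 // ler_nat.
Qed.

Lemma euler_approx_nrm t k x : 0 <= t ->
  nrm (E t k x) <= expR (2 * (t * w)) * nrm x.
Proof. by move=> t0; exact: iter_step_nrm. Qed.

Lemma euler_approx_mul s t k x : E s k (E t k x) =
  iter (2 ^ k) (fun x => J (s / 2 ^+ k) (J (t / 2 ^+ k) x)) x.
Proof. by rewrite iter_comp // => y; exact: eulerC. Qed.

(** By telescoping, [2 ^ k] steps with an error of order [s t / 4 ^ k] each. The factor 4 in the
    exponent comes from the two power bounds. *)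
Lemma euler_approx_add s t k x y z : 0 <= s -> 0 <= t ->
  (s + t) / 2 ^+ k * w <= 2^-1 -> A (x, y) -> A (y, z) ->
  nrm (E s k (E t k x) - E (s + t) k x) <=
    (expR (4 * ((s + t) * w)) * s * t * expR 3 * nrm z) / 2 ^+ k.
Proof.
move=> s0 t0 hw Axy Ayz.
have st0 : 0 <= s + t by rewrite addr_ge0.
rewrite euler_approx_mul.
set P := fun x => J _ (J _ x).
have bP : blin P by apply: blin_comp; exact: euler_blin.
have bQ : blin (J ((s + t) / 2 ^+ k)) by exact: euler_blin.
have PQ u : P (J ((s + t) / 2 ^+ k) u) = J ((s + t) / 2 ^+ k) (P u).
  by rewrite /P (JC (t / _) _ u) (JC (s / _)).
have hP j u : (j <= 2 ^ k)%N -> nrm (iter j P u) <= expR (2 * ((s + t) * w)) * nrm u.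
  move=> jk; rewrite iter_comp; last by move=> v; exact: eulerC.
  rewrite (le_trans (iter_step_nrm _ s0 jk)) // (mulrDl s t w) mulrDr expRD.
  rewrite -[X in _ <= X]mulrA.
  by rewrite ler_wpM2l ?expR_ge0 // iter_step_nrm.
have hQ j u : (j <= 2 ^ k)%N -> nrm (iter j (J ((s + t) / 2 ^+ k)) u) <=
  expR (2 * ((s + t) * w)) * nrm u by exact: iter_step_nrm.
rewrite (le_trans (telescope_iter x bP bQ PQ (expR_ge0 _) hP hQ)) //.
have := @euler_add _ _ _ norm_dot _ nA _ w_gt0 spA (s / 2 ^+ k) (t / 2 ^+ k) x y z
  (step_ge0 k s0) (step_ge0 k t0).
rewrite -mulrDl => /(_ hw Axy Ayz) h.
have M0 : 0 <= expR (2 * ((s + t) * w)) * expR (2 * ((s + t) * w)).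
  by rewrite mulr_ge0 ?expR_ge0.
rewrite (le_trans (ler_wpM2l (ler0n _ _) (ler_wpM2l M0 h))) // -expRD.
have -> : 2 * ((s + t) * w) + 2 * ((s + t) * w) = 4 * ((s + t) * w) by ring.
rewrite natrX le_eqVlt; apply/orP; left; apply/eqP; field.
by rewrite gt_eqF // exprn_gt0.
Qed.

Lemma euler_approxS t k x : E t k.+1 x = E (t / 2) k (E (t / 2) k x).
Proof.
rewrite euler_approx_mul /euler_approx expnSr iterM.
have -> : t / 2 / 2 ^+ k = t / 2 ^+ k.+1 by rewrite exprS invfM mulrA.
by apply: eq_iter.
Qed.

Lemma euler_approx_step t k x y z : 0 <= t -> t / 2 ^+ k * w <= 2^-1 ->
  A (x, y) -> A (y, z) ->
  nrm (E t k.+1 x - E t k x) <=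
    (expR (4 * (t * w)) * (t / 2) ^+ 2 * expR 3 * nrm z) / 2 ^+ k.
Proof.
move=> t0 hw Axy Ayz; rewrite euler_approxS.
have t20 : 0 <= t / 2 by rewrite divr_ge0.
have tt : t / 2 + t / 2 = t by rewrite -splitr.
have := @euler_approx_add (t / 2) (t / 2) k x y z t20 t20.
by rewrite tt => /(_ hw Axy Ayz); rewrite expr2 !mulrA.
Qed.

Lemma euler_approx_cvg2 t x y z : 0 <= t -> A (x, y) -> A (y, z) ->
  exists l : X, E t k x @[k --> \oo] --> l.
Proof.
move=> t0 Axy Ayz.
have /cvgr0Pnorm_lt/(_ (2^-1) ltac:(by rewrite invr_gt0))[K _ hK] := cvg_inv_exp2 (t * w).
have [|l [El _]] := @geometric_cvg _ _ (fun k => E t k x)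
    (expR (4 * (t * w)) * (t / 2) ^+ 2 * expR 3 * nrm z) K; last by exists l.
move=> k Kk; apply: (euler_approx_step t0 _ Axy Ayz).
have := hK k Kk; rewrite ger0_norm; last first.
  by rewrite divr_ge0 ?exprn_ge0 // mulr_ge0 // ltW.
by rewrite mulrAC => /ltW.
Qed.

Lemma euler_approx_cvg t x : 0 <= t -> exists l : X, E t k x @[k --> \oo] --> l.
Proof.
move=> t0; apply: complete_seq => e e0.
set M := expR (2 * (t * w)); have M0 : 0 < M by exact: expR_gt0.
have [u [y [z [Auy Ayz xu]]]] :=
  dense_dom2 norm_dot nA w_gt0 spA x (divr_gt0 e0 (mulr_gt0 (ltr0Sn R 3) M0)).
have [l /seq_cvgP/(_ (e / 4) ltac:(by rewrite divr_gt0))[K hK]] :=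
  euler_approx_cvg2 t0 Auy Ayz.
exists K => m n Km Kn.
have close k : nrm (E t k x - E t k u) < e / 4.
  rewrite -(blinB _ _ (euler_approx_blin t k)).
  rewrite (le_lt_trans (euler_approx_nrm _ _ t0)) // -/M.
  by move: xu; rewrite ltr_pdivlMr ?mulr_gt0 //; lra.
have := nrm_sub (E t m u) (E t m x) (E t n x).
have := nrm_sub (E t n u) (E t m u) (E t n x).
have := nrm_sub l (E t m u) (E t n u); have := hK m Km; have := hK n Kn.
rewrite (nrmC l) (nrmC (E t n u) (E t n x)).
have := close m; have := close n; lra.
Qed.

(** The identity at negative times, so that it is bounded and linear for every [t]. *)
Definition euler_limit t x : X :=
  match pselect (0 <= t) with
  | left h => projT1 (cid (euler_approx_cvg x h))
  | right _ => x
  end.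
Local Notation T := euler_limit.

Lemma euler_limitP t x : 0 <= t -> E t k x @[k --> \oo] --> T t x.
Proof. by move=> t0; rewrite /T; case: pselect => // h; case: cid. Qed.

Lemma euler_limit_bicomm t : 0 <= t ->
  exists N', bicomm (dot := dot) (A := A) (T t) N'.
Proof.
move=> t0.
have /choice[J' hJ'] (k : nat) : exists J', bicomm (dot := dot) (A := A) (E t k) J'.
  have [J' hJ'] := euler_bicomm norm_dot nA w_gt0 spA (t / 2 ^+ k).
  by exists (iter (2 ^ k) J'); exact: bicomm_iter.
apply: (bicomm_lim norm_dot nA hJ' (C := expR (2 * (t * w)))).
  by move=> k x; exact: euler_approx_nrm.
by move=> x; exact: euler_limitP.
Qed.

Lemma euler_limit_blin t : blin (T t).
Proof.
have [t0|t0] := lerP 0 t; first by have [N' /bicomm_blin] := euler_limit_bicomm t0.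
suff -> : T t = id by exact: blin_id.
apply/funext => x; rewrite /T; case: pselect => // h; exfalso.
by move: t0; rewrite ltNge h.
Qed.

Lemma euler_limit_nrm t x : 0 <= t -> nrm (T t x) <= expR (2 * (t * w)) * nrm x.
Proof.
move=> t0; apply: (@nrm_le_lim _ _ _ \oo _ (fun k => E t k x)); first exact: euler_limitP.
by apply: nearW => k; exact: euler_approx_nrm.
Qed.

Lemma euler_limit0 x : T 0 x = x.
Proof.
apply: (nlim_uniq (euler_limitP (lexx 0))).
have -> : (fun k => E 0 k x) = fun=> x.
  apply/funext => k; rewrite /euler_approx mul0r euler0 //.
  by elim: (2 ^ k)%N.
exact: cvg_cst.
Qed.

Lemma blin_dense2 (f g : X -> X) : blin f -> blin g ->
  (forall x y z, A (x, y) -> A (y, z) -> f x = g x) -> f =1 g.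
Proof.
move=> bf bg fg x; apply/eqP; rewrite -subr_eq0 -nrm_eq0 eq_le nrm_ge0 andbT.
have bfg := blin_sub bf bg; have [C C0 hC] := blin_bound bfg.
apply/ler_addgt0Pr => e e0; rewrite add0r.
have [u [y [z [Auy Ayz xu]]]] := dense_dom2 norm_dot nA w_gt0 spA x (divr_gt0 e0 C0).
have -> : f x - g x = f (x - u) - g (x - u).
  by rewrite (blinB _ _ bf) (blinB _ _ bg) (fg _ _ _ Auy Ayz) opprB addrA subrK.
by rewrite (le_trans (hC _)) // mulrC -ler_pdivlMr // ltW.
Qed.

Lemma euler_limitD s t x : 0 <= s -> 0 <= t -> T (s + t) x = T s (T t x).
Proof.
move=> s0 t0; have st0 : 0 <= s + t by rewrite addr_ge0.
apply: (blin_dense2 (euler_limit_blin (s + t))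
  (blin_comp (euler_limit_blin s) (euler_limit_blin t))) => {}x y z Axy Ayz.
have h1 : E s k (E t k x) @[k --> \oo] --> T s (T t x).
  apply: (cvg_bounded_comp (euler_approx_blin s) (fun k x => euler_approx_nrm k x s0)
    (euler_limitP t0)).
  exact: euler_limitP.
apply: nlim_uniq (euler_limitP st0) _.
have -> : (fun k => E (s + t) k x) =
    (fun k => E s k (E t k x) - (E s k (E t k x) - E (s + t) k x)).
  by apply/funext => k; rewrite opprB [RHS]addrC subrK.
rewrite -[X in _ --> X]subr0; apply: cvgB => //.
apply/cvg_nrm; under eq_fun do rewrite subr0.
have /cvgr0Pnorm_lt/(_ (2^-1) ltac:(by rewrite invr_gt0))[K _ hK] :=
  cvg_inv_exp2 ((s + t) * w).
apply: (squeeze_cvgr (f := fun=> 0) (h := fun k =>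
   (expR (4 * ((s + t) * w)) * s * t * expR 3 * nrm z) / 2 ^+ k)).
- exists K => // k Kk; rewrite nrm_ge0 /=.
  apply: (euler_approx_add s0 t0 _ Axy Ayz).
  have := hK k Kk; rewrite ger0_norm; last first.
    by rewrite divr_ge0 ?exprn_ge0 // mulr_ge0 // ltW.
  by rewrite mulrAC => /ltW.
- exact: cvg_cst.
- exact: cvg_inv_exp2.
Qed.

Lemma euler_limit_sub t x y : 0 <= t -> t * w <= 2^-1 -> A (x, y) ->
  nrm (T t x - x) <= t * expR 2 * nrm y.
Proof.
move=> t0 tw Axy.
apply: (@nrm_le_lim _ _ _ \oo _ (fun k => E t k x - x)).
  by apply: cvgB; [exact: euler_limitP|exact: cvg_cst].
apply: nearW => k; have ht := step_ge0 k t0.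
have hw : t / 2 ^+ k * w <= 2^-1.
  by rewrite (le_trans _ tw) // ler_wpM2r ?(ltW w_gt0) // step_le.
have hid j (u : X) : iter j id u = u by elim: j => //= j ->.
have bJ : blin (J (t / 2 ^+ k)) by exact: euler_blin.
have := @telescope_iter _ _ (J (t / 2 ^+ k)) id (expR (2 * (t * w))) 1 (2 ^ k) x
  bJ blin_id (fun _ => erefl) (expR_ge0 _) (fun j u => @iter_step_nrm t k j u t0).
rewrite hid => /(_ _)/le_trans; apply.
  by move=> j u _; rewrite hid mul1r.
rewrite (euler_sub _ _ _ _ ht hw Axy) nrmZ nrmR ger0_norm //.
have h1 : nrm (J (t / 2 ^+ k) y) <= expR 1 * nrm y by exact: euler_nrm1.
have h2 : expR (2 * (t * w)) <= expR 1 by rewrite ler_expR; lra.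
have -> : (2 ^ k)%:R * (expR (2 * (t * w)) * 1 *
    (t / 2 ^+ k * nrm (J (t / 2 ^+ k) y))) =
  (2 ^ k)%:R * (t / 2 ^+ k) * (expR (2 * (t * w)) * nrm (J (t / 2 ^+ k) y)) by ring.
rewrite step_mulK -mulrA ler_wpM2l // (_ : 2 = 1 + 1 :> R) // expRD -mulrA.
by rewrite ler_pM ?expR_ge0 ?nrm_ge0 // (_ : 1 + 1 = 2 :> R).
Qed.

(** [J t] is the approximation with [k = 0], so the whole geometric series of refinement errors
    bounds the distance to the limit. *)
Lemma euler_limit_step t x y z : 0 <= t -> t * w <= 2^-1 -> A (x, y) -> A (y, z) ->
  nrm (T t x - J t x) <= t ^+ 2 * expR 5 * nrm z.
Proof.
move=> t0 tw Axy Ayz.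
have [|l [El hl]] := @geometric_cvg _ _ (fun k => E t k x)
    (expR (4 * (t * w)) * (t / 2) ^+ 2 * expR 3 * nrm z) 0.
  move=> k _; apply: (euler_approx_step t0 _ Axy Ayz).
  by rewrite (le_trans _ tw) // ler_wpM2r ?(ltW w_gt0) // step_le.
move: hl; rewrite (nlim_uniq El (euler_limitP t0)) /euler_approx expn0 expr0 !divr1 /=.
move=> /le_trans; apply.
have h : expR (4 * (t * w)) * expR 3 <= expR 5.
  by rewrite -expRD ler_expR; lra.
have c0 : 0 <= (t ^+ 2 / 2) * nrm z by rewrite mulr_ge0 ?nrm_ge0 // divr_ge0 ?sqr_ge0.
have := ler_wpM2l c0 h.
have c1 : 0 <= t ^+ 2 * expR 5 * nrm z.
  by rewrite !mulr_ge0 ?nrm_ge0 ?expR_ge0 ?sqr_ge0.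
have -> : 2 * (expR (4 * (t * w)) * (t / 2) ^+ 2 * expR 3 * nrm z) =
  t ^+ 2 / 2 * nrm z * (expR (4 * (t * w)) * expR 3) by field.
move=> /le_trans; apply.
have -> : t ^+ 2 / 2 * nrm z * expR 5 = t ^+ 2 * expR 5 * nrm z / 2 by field.
lra.
Qed.

(** The second-order estimate needs the domain of [A^2], so [x] is first replaced by [x' = J s x],
    with [s] fixed by [e]; the error [x - x'] is controlled by [euler_limit_sub] uniformly in
    [h]. *)
Lemma euler_limit_generator x y : A (x, y) ->
  (h^-1)%:C *: (T h x - x) @[h --> 0^'+] --> y.
Proof.
move=> Axy; apply/right_cvgP => e e0.
set c := expR (2 : R); have c1 : 1 <= c by rewrite -expR0 ler_expR.
have c0 : 0 < c by exact: expR_gt0.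
have [d d0 hd] := euler_cvg norm_dot nA w_gt0 spA y
  (divr_gt0 e0 (mulr_gt0 (ltr0Sn R 3) c0)).
have s0 : 0 < d / 2 by rewrite divr_gt0.
have [sw hy] := hd _ s0 ltac:(lra).
set s := d / 2 in s0 sw hy.
pose x' := J s x; pose y' := J s y.
have Axy' : A (x', y') by exact: euler_comm.
have [z Ayz] : exists z, A (y', z) by exact: euler_dom.
have sA : submodule A by case: nA.
pose K := (expR 5 + expR 1) * nrm z + 1.
have K0 : 0 < K by rewrite ltr_wpDl // mulr_ge0 ?nrm_ge0 ?addr_ge0 ?expR_ge0.
exists (Num.min (2^-1 / w) (e / 2 / K)); first by rewrite lt_min !divr_gt0.
move=> h h0; rewrite lt_min !ltr_pdivlMr // => /andP[/ltW hw hK].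
have bT := euler_limit_blin h.
have n (v : X) : nrm ((h^-1)%:C *: v) = h^-1 * nrm v.
  by rewrite nrmZ nrmR gtr0_norm // invr_gt0.
have E1 : nrm ((h^-1)%:C *: (T h (x - x') - (x - x'))) <= c * nrm (y' - y).
  rewrite n ler_pdivrMl // (nrmC y') mulrA.
  exact: (euler_limit_sub (ltW h0) hw (submoduleB sA Axy Axy')).
have E2 : nrm ((h^-1)%:C *: (T h x' - J h x')) <= h * expR 5 * nrm z.
  rewrite n ler_pdivrMl // !mulrA -expr2.
  exact: (euler_limit_step (ltW h0) hw Axy' Ayz).
have E3 : (h^-1)%:C *: (J h x' - x') = J h y'.
  rewrite (euler_sub _ _ _ _ (ltW h0) hw Axy') scalerA -rmorphM mulVf ?gt_eqF //.
  by rewrite scale1r.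
have E4 : nrm (J h y' - y') <= h * expR 1 * nrm z.
  rewrite (euler_sub _ _ _ _ (ltW h0) hw Ayz) nrmZ nrmR gtr0_norm // -mulrA.
  by rewrite ler_wpM2l ?(ltW h0) // euler_nrm1 // ltW.
have -> : (h^-1)%:C *: (T h x - x) - y =
    (h^-1)%:C *: (T h (x - x') - (x - x')) + (h^-1)%:C *: (T h x' - J h x') +
    (J h y' - y') + (y' - y).
  have V (p q r : X) : p + q + (r - y') + (y' - y) = p + q + r - y.
    by rewrite !addrA subrK.
  have W (a b u : X) : a - b - (x - x') + (b - u) + (u - x') = a - x.
    rewrite opprB [X in X + _]addrAC (addrA (a - b)) subrK [LHS]addrAC.
    by rewrite (addrA (a - u)) subrK addrA subrK.
  by rewrite -E3 (blinB _ _ bT) V -!scalerDr W.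
rewrite (le_lt_trans (nrmD _ _)) // (@le_lt_trans _ _ (c * nrm (y' - y) +
   h * expR 5 * nrm z + h * expR 1 * nrm z + nrm (y' - y))) //.
  by rewrite lerD2r (le_trans (nrmD _ _)) // lerD // (le_trans (nrmD _ _)) // lerD.
have h1 : nrm (y' - y) <= c * nrm (y' - y) by rewrite ler_peMl ?nrm_ge0.
move: hy; rewrite ltr_pdivlMr ?mulr_gt0 // -/y' => hy.
have : h * expR 5 * nrm z + h * expR 1 * nrm z <= h * K.
  by rewrite -!mulrA -mulrDr -mulrDl ler_pM2l // lerDl.
lra.
Qed.

End EulerSemigroup.

(** * Generation *)

Section Generation.
Context {R : realType} {X : completeNormedModType R[i]}
        {dot : {dot X for @Num.conj R[i]}}
        (norm_dot : forall x : X, `|x| ^+ 2 = dot x x)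
        {A : set (X * X)} (nA : nop (dot := dot) A)
        {w : R} (w_gt0 : 0 < w)
        (spA : forall l : R[i], spectrum A l -> complex.Re l <= w).
Implicit Types (x y z : X) (s t h : R).

Local Notation J := (euler norm_dot nA w_gt0 spA).
Local Notation T := (euler_limit norm_dot nA w_gt0 spA).

(** Let [u = J s (x - s z)]. The difference [d = x - u] has derivative [s^-1 d] at 0, so [|T h d|]
    grows at rate [s^-1 = 8 w], while [euler_limit_nrm] and [expR_le1D] allow only [4 w]. Hence
    [d = 0]. *)
Lemma euler_limit_generator_sub x z :
  (h^-1)%:C *: (T h x - x) @[h --> 0^'+] --> z -> A (x, z).
Proof.
move=> xz; pose s := (8 * w)^-1.
have s0 : 0 < s by rewrite invr_gt0 mulr_gt0.
have sw : s * w <= 2^-1.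
  by rewrite /s invfM -mulrA mulVf ?gt_eqF // mulr1 lef_pV2 ?posrE // ler_nat.
have [_ /(_ (x - s%:C *: z))[v Auv uv] _ _] := eulerP norm_dot nA w_gt0 spA s0 sw.
set u := J s _ in Auv uv.
pose d := x - u; pose e := z - v.
have de : d = s%:C *: e.
  have xE : x = u - s%:C *: v + s%:C *: z by rewrite uv subrK.
  by rewrite /d {1}xE scalerBr addrAC [u - _]addrC addrK addrC.
have lim : (h^-1)%:C *: (T h d - d) @[h --> 0^'+] --> e.
  have -> : (fun h : R => (h^-1)%:C *: (T h d - d)) =
      (fun h : R => (h^-1)%:C *: (T h x - x) - (h^-1)%:C *: (T h u - u)).
    apply/funext => h; rewrite -scalerBr (blinB _ _ (euler_limit_blin _ _ _ _ h)).
    congr (_ *: _); rewrite !opprB addrACA [RHS]addrACA; congr (_ + _).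
    exact: addrC.
  by apply: cvgB => //; exact: euler_limit_generator.
suff d0 : d = 0.
  have e0 : e = 0.
    apply/eqP; have := de; rewrite d0 => /esym/eqP; rewrite scaler_eq0.
    by rewrite -nrm_eq0 nrmR gtr0_norm // gt_eqF.
  by move/subr0_eq : d0 => ->; move/subr0_eq : e0 => ->.
apply/eqP; rewrite -nrm_eq0 eq_le nrm_ge0 andbT -(pmulr_rle0 _ w_gt0).
apply/ler_addgt0Pr => r r0; rewrite add0r.
move/right_cvgP: lim => /(_ r r0)[p p0 hp].
pose h := Num.min (p / 2) (4^-1 / w).
have h0 : 0 < h by rewrite lt_min !divr_gt0.
have hp' : h < p by rewrite (@le_lt_trans _ _ (p / 2)) ?ge_min ?lexx //; lra.
have hw : h * w <= 4^-1 by rewrite -ler_pdivlMr // ge_min lexx orbT.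
have := hp h h0 hp'; set q := _ - e => qr.
have E : T h d = (1 + h / s)%:C *: d + h%:C *: q.
  rewrite /q (scalerBr h%:C) scalerA -rmorphM mulfV ?gt_eqF // scale1r.
  have -> : h%:C *: e = (h / s)%:C *: d.
    by rewrite [in RHS]de scalerA -rmorphM divfK ?gt_eqF.
  rewrite rmorphD scalerDl scale1r -[T h d - d - _]addrA -opprD.
  by rewrite [RHS]addrC subrK.
have h2 : 0 <= h * w + h * w <= 2^-1.
  by apply/andP; split; [rewrite addr_ge0 ?mulr_ge0 ?ltW|lra].
have b1 := euler_limit_nrm norm_dot nA w_gt0 spA d (ltW h0).
have b2 : nrm (T h d) <= (1 + 2 * (h * w + h * w)) * nrm d.
  rewrite (le_trans b1) // ler_wpM2r ?nrm_ge0 //.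
  by rewrite (_ : 2 * (h * w) = h * w + h * w) ?expR_le1D //; ring.
have b3 : (1 + h / s) * nrm d - h * nrm q <= nrm (T h d).
  have hs : 0 <= 1 + h / s by rewrite addr_ge0 // divr_ge0 ?ltW.
  have := nrm_lerB ((1 + h / s)%:C *: d) (- (h%:C *: q)).
  by rewrite opprK -E nrmN !nrmZ !nrmR (ger0_norm hs) (gtr0_norm h0).
have hs : h / s = 8 * (h * w) by rewrite /s invrK; ring.
rewrite -(ler_pM2l h0).
have : h * nrm q <= h * r by rewrite ler_wpM2l ?(ltW h0) // ltW.
have := mulr_ge0 (mulr_ge0 (ltW h0) (ltW w_gt0)) (nrm_ge0 d).
rewrite hs in b3; lra.
Qed.

Theorem ex_semigroup : exists T : R -> {linear X -> X}, generates A T.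
Proof.
have /choice[S hS] (t : R) : exists S : {linear X -> X}, continuous S /\
    forall x, S x = T t x.
  have [S cS SE] := blin_linear (euler_limit_blin norm_dot nA w_gt0 spA t).
  by exists S.
have SE t x : S t x = T t x by have [_] := hS t.
exists S; split; last first.
  apply/seteqP; split=> -[x z] /=; rewrite /generator /=.
    under eq_fun do rewrite SE; exact: euler_limit_generator_sub.
  by move=> Axz; under eq_fun do rewrite SE; exact: euler_limit_generator.
split.
- by move=> t _; have [] := hS t.
- by move=> x; rewrite SE euler_limit0.
- by move=> s t s0 t0 x; rewrite /= !SE euler_limitD.
- move=> x; apply/right_cvgP => e e0.
  set c := expR (1 : R); have c0 : 0 < c by exact: expR_gt0.
  have [_ _ dA _ _] := nA.
  have [[u v] [Auv /= xu]] :=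
    dA x _ (divr_gt0 e0 (mulr_gt0 (ltr0Sn R 1) (addr_gt0 (@ltr01 R) c0))).
  pose K := expR 2 * nrm v + 1.
  have K0 : 0 < K by rewrite ltr_wpDl // mulr_ge0 ?nrm_ge0 ?expR_ge0.
  exists (Num.min (2^-1 / w) (e / 2 / K)); first by rewrite lt_min !divr_gt0.
  move=> t t0; rewrite lt_min !ltr_pdivlMr // => /andP[/ltW tw tK]; rewrite SE.
  have bT := euler_limit_blin norm_dot nA w_gt0 spA t.
  have b1 : nrm (T t x - T t u) <= c * nrm (x - u).
    rewrite -(blinB _ _ bT) (le_trans (euler_limit_nrm _ _ _ _ _ (ltW t0))) //.
    by rewrite ler_wpM2r ?nrm_ge0 // ler_expR; lra.
  have b2 := euler_limit_sub norm_dot nA w_gt0 spA (ltW t0) tw Auv.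
  have b3 : t * expR 2 * nrm v <= t * K by rewrite -mulrA ler_pM2l // lerDl.
  have := nrm_sub (T t u) (T t x) x; have := nrm_sub u (T t u) x.
  rewrite (nrmC u); move: xu; rewrite ltr_pdivlMr ?mulr_gt0 ?addr_gt0 //; lra.
Qed.

End Generation.

(** * The principle of uniform boundedness *)

Section UniformBoundedness.
Context {R : realType} {X : completeNormedModType R[i]}.

Lemma cvg_nrm_bounded (u : nat -> X) (l : X) : u @ \oo --> l ->
  exists C : R, forall n, nrm (u n) <= C.
Proof.
move=> /seq_cvgP/(_ 1 ltr01)[N hN].
exists (\sum_(i < N) nrm (u i) + nrm l + 1) => n.
have s0 : 0 <= \sum_(i < N) nrm (u i) by apply: sumr_ge0 => i _; exact: nrm_ge0.
have [nN|Nn] := ltnP n N.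
  rewrite (bigD1 (Ordinal nN)) //= -!addrA lerDl !addr_ge0 ?nrm_ge0 //.
  by apply: sumr_ge0 => i _; exact: nrm_ge0.
have := hN n Nn; have := nrm_lerB (u n) l; lra.
Qed.

(* Failing a uniform bound, nested balls are built on the k-th of which some
   member of the family exceeds [k]; this only uses that
   [f xi] is the half difference of [f (x + xi)] and [f (x - xi)]. *)
Theorem uniform_boundedness (f : nat -> X -> X) : (forall n, blin (f n)) ->
  (forall x, exists C : R, forall n, nrm (f n x) <= C) ->
  exists C : R, forall n x, nrm (f n x) <= C * nrm x.
Proof.
move=> bf pf; apply: contrapT => nC.
have unb (C : R) : exists n v, C * nrm v < nrm (f n v).
  apply: contrapT => h; apply: nC; exists C => n x; rewrite leNgt; apply/negP => fx.
  by apply: h; exists n, x.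
(* One refinement of the ball with centre [p.2.1] and radius [p.2.2]; positivity of the radius is a
   premise inside, so that [choice] yields a total function. *)
have step (p : nat * (X * R)) : exists q : X * R, 0 < p.2.2 ->
    [/\ 0 < q.2, q.2 <= p.2.2 / 2, nrm (q.1 - p.2.1) <= p.2.2 / 2 &
      exists n, forall y, nrm (y - q.1) <= q.2 -> p.1%:R < nrm (f n y)].
  case: p => k [x r] /=; have [r0|] := ltrP 0 r; last by exists (x, r).
  have r20 : 0 < r / 2 by rewrite divr_gt0.
  have [n [v hv]] := unb ((k%:R + 1) / (r / 2)).
  have v0 : 0 < nrm v.
    rewrite nrm_gt0; apply/eqP => v0; move: hv.
    by rewrite v0 (blin0 (bf n)) nrm0 mulr0 ltxx.
  pose xi := (r / 2 / nrm v)%:C *: v.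
  have nxi : nrm xi = r / 2.
    by rewrite nrmZ nrmR gtr0_norm ?divr_gt0 // divfK // gt_eqF.
  have fxi : k%:R + 1 < nrm (f n xi).
    rewrite (blinZ _ _ (bf n)) nrmZ nrmR gtr0_norm ?divr_gt0 //.
    rewrite mulrAC ltr_pdivlMr //; move: hv.
    by rewrite mulrAC ltr_pdivrMr // [_ * (r / 2)]mulrC.
  have [x' [nx' fx']] : exists x', nrm (x' - x) <= r / 2 /\ k%:R + 1 < nrm (f n x').
    have [h|h] := ltrP (k%:R + 1) (nrm (f n (x + xi))).
      by exists (x + xi); rewrite [x + xi]addrC addrK nxi [xi + x]addrC.
    exists (x - xi); rewrite [x - xi]addrC addrK nrmN nxi [- xi + x]addrC; split => //.
    have := nrmB (f n (x + xi)) (f n (x - xi)).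
    have -> : f n (x + xi) - f n (x - xi) = 2%:R *: f n xi.
      rewrite (blinD _ _ (bf n)) (blinB _ _ (bf n)) opprB addrC addrA subrK.
      by rewrite scaler_nat mulr2n.
    rewrite nrmZ.
    have -> : nrm (2%:R : R[i]) = 2.
      by rewrite -(rmorph_nat (real_complex R)) nrmR ger0_norm.
    by move: h; lra.
  have [C C0 hC] := blin_bound (bf n).
  (* Within [C^-1] of [x'] the value of [f n] changes by at most 1, which is why [k%:R + 1] was
     exceeded at the centre. *)
  exists (x', Num.min (r / 2) C^-1) => _ /=; split => //.
  - by rewrite lt_min r20 invr_gt0.
  - by rewrite ge_min lexx.
  exists n => y; rewrite le_min => /andP[_ yx].
  have : nrm (f n (y - x')) <= 1.
    by rewrite (le_trans (hC _)) // -ler_pdivlMl // mulr1.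
  rewrite (blinB _ _ (bf n)); have := nrm_lerB (f n x') (f n y).
  rewrite (nrmC (f n x')); lra.
have [F hF] := choice step.
pose fix s k : X * R := if k is k'.+1 then F (k', s k') else (0, 1).
have s0 k : 0 < (s k).2.
  by elim: k => [|k IHk] //=; have [] := hF (k, s k) IHk.
have ss k := hF (k, s k) (s0 k).
have r2 k : (s k).2 <= 1 / 2 ^+ k.
  elim: k => [|k IHk]; first by rewrite /= expr0 divr1.
  have [_ h _ _] := ss k; rewrite (le_trans h) //= exprS invfM mulrA mulrAC.
  by rewrite ler_wpM2r ?invr_ge0.
have ball m j : nrm ((s (m + j)%N).1 - (s m).1) + (s (m + j)%N).2 <= (s m).2.
  elim: j => [|j IHj]; first by rewrite addn0 subrr nrm0 add0r.
  rewrite addnS (le_trans _ IHj) //.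
  have [_ h1 h2 _] := ss (m + j)%N.
  have := nrm_sub (s (m + j)%N).1 (s (m + j)%N.+1).1 (s m).1.
  by move: h1 h2 => /=; lra.
have ball' m j : nrm ((s (m + j)%N).1 - (s m).1) <= (s m).2.
  by have := ball m j; have := s0 (m + j)%N; lra.
have [l sl] : exists l : X, (fun k => (s k).1) @ \oo --> l.
  apply: (complete_le (v := fun k => 1 / 2 ^+ k)); first exact: cvg_inv_exp2.
  by move=> m n mn; rewrite nrmC -(subnKC mn) (le_trans (ball' _ _)).
have lk k : nrm (l - (s k).1) <= (s k).2.
  apply: (@nrm_le_lim _ _ _ \oo _ (fun n => (s n).1 - (s k).1)).
    by apply: cvgB => //; exact: cvg_cst.
  by exists k => // n /= kn; rewrite -(subnKC kn).
have [C hC] := pf l.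
have [_ _ _ [n /(_ l (lk (Num.bound C).+1))]] := ss (Num.bound C).
apply/negP; rewrite -leNgt (le_trans (hC n)) // ltW //.
by apply: archi_boundP; exact: le_trans (nrm_ge0 _) (hC n).
Qed.

End UniformBoundedness.

(** * Arbitrary semigroups generated by a normal operator *)

Section ComplexExponential.
Context {R : realType}.
Implicit Types (z l : R[i]) (h t : R).

Definition cexp z : R[i] :=
  (expR (complex.Re z))%:C * (cos (complex.Im z) +i* sin (complex.Im z)).

Lemma cexpD z l : cexp (z + l) = cexp z * cexp l.
Proof.
rewrite /cexp !raddfD /= expRD cosD sinD; case: z => a b; case: l => c d /=.
by apply/eqP; rewrite eq_complex /=; apply/andP; split; apply/eqP; ring.
Qed.

Lemma nrm_cexp z : nrm (cexp z) = expR (complex.Re z).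
Proof.
rewrite nrmM nrmR ger0_norm ?expR_ge0 //.
suff -> : nrm (cos (complex.Im z) +i* sin (complex.Im z)) = 1 by rewrite mulr1.
by apply/eqP; rewrite -(@eqrXn2 _ 2) ?nrm_ge0 // sqr_nrm /= cos2Dsin2 expr1n.
Qed.

Lemma cexp0 : cexp 0 = 1.
Proof. by rewrite /cexp /= expR0 cos0 sin0 mul1r. Qed.

Lemma cexpMn h l n : cexp ((n%:R * h)%:C * l) = cexp (h%:C * l) ^+ n.
Proof.
elim: n => [|n IHn]; first by rewrite mul0r mul0r cexp0 expr0.
by rewrite -natr1 mulrDl mul1r rmorphD mulrDl cexpD IHn exprSr.
Qed.

Lemma right_derivative (f : R -> R) (df : R) : is_derive (0 : R) 1 f df ->
  h^-1 * (f h - f 0) @[h --> 0^'+] --> df.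
Proof.
move=> [fd <-]; apply: cvg_dnbhs_at_right.
have := fd; rewrite /derivable => /cvg_lim.
have -> : (fun h => h^-1 * (f h - f 0)) =
    (fun h => h^-1 *: ((f \o shift 0) (h *: (1 : R)) - f 0)).
  by apply/funext => h /=; rewrite addr0 [h *: _]mulr1.
by move=> _; exact: fd.
Qed.

Lemma is_derive_mulr (c : R) : is_derive (0 : R) 1 (fun h => h * c) c.
Proof.
apply: is_derive_eq (is_deriveM (is_derive_id (0 : R) 1) (is_derive_cst c (0 : R) 1)) _.
by rewrite scaler0 add0r [_ *: _]mulr1.
Qed.

Lemma is_derive_exp_trig (g : R -> R) (dg a b : R) : is_derive (0 * b) 1 g dg ->
  is_derive (0 : R) 1 (fun h => expR (h * a) * g (h * b)) (a * g 0 + b * dg).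
Proof.
move=> gd.
have d1 := @is_derive1_comp R expR (fun h => h * a) 0 _ _
  (is_derive_expR (0 * a)) (is_derive_mulr a).
have d2 := @is_derive1_comp R g (fun h => h * b) 0 _ _ gd (is_derive_mulr b).
apply: is_derive_eq (is_deriveM d1 d2) _.
rewrite /= !mul0r expR0 mul1r.
by rewrite addrC; congr (_ + _); rewrite [LHS]mulrC ?mul1r ?mulr1 // mulrC.
Qed.

Lemma cexp_derivative l :
  (h^-1)%:C * (cexp (h%:C * l) - 1) @[h --> 0^'+] --> (l : R[i]^o).
Proof.
case: l => a b.
have c : h^-1 * (expR (h * a) * cos (h * b) - expR (0 * a) * cos (0 * b))
    @[h --> 0^'+] --> a.
  apply: (right_derivative (f := fun h => expR (h * a) * cos (h * b))).
  have := @is_derive_exp_trig cos _ a b (is_derive_cos (0 * b)).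
  by rewrite [in - sin _]mul0r sin0 oppr0 mulr0 addr0 cos0 mulr1.
have s : h^-1 * (expR (h * a) * sin (h * b) - expR (0 * a) * sin (0 * b))
    @[h --> 0^'+] --> b.
  apply: (right_derivative (f := fun h => expR (h * a) * sin (h * b))).
  have := @is_derive_exp_trig sin _ a b (is_derive_sin (0 * b)).
  by rewrite [in cos (0 * b)]mul0r sin0 mulr0 add0r cos0 mulr1.
apply/(@cvg_nrmP R R[i]^o R) => e e0; have e20 : 0 < e / 2 by rewrite divr_gt0.
move/cvgrPdist_lt: c => /(_ _ e20) c; move/cvgrPdist_lt: s => /(_ _ e20) s.
near=> h; rewrite (le_lt_trans (nrm_ReIm _)) // (splitr e) ltrD //.
- have : `|a - h^-1 * (expR (h * a) * cos (h * b) - expR (0 * a) * cos (0 * b))| < e / 2.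
    by near: h.
  rewrite !mul0r expR0 cos0 mulr1 distrC; congr (`|_| < _).
  by rewrite /cexp /= !(mul0r, mulr0, add0r, addr0, subr0, oppr0).
- have : `|b - h^-1 * (expR (h * a) * sin (h * b) - expR (0 * a) * sin (0 * b))| < e / 2.
    by near: h.
  rewrite !mul0r sin0 mulr0 distrC; congr (`|_| < _).
  by rewrite /cexp /= !(mul0r, mulr0, add0r, addr0, subr0, oppr0).
Unshelve. all: by end_near. Qed.

End ComplexExponential.

(** * Local boundedness of [C_0]-semigroups *)

Section LocalBound.
Context {R : realType} {X : completeNormedModType R[i]}
        {T : R -> {linear X -> X}} (CT : C0_semigroup T).
Implicit Types (x y : X) (s t h : R).

Lemma semigroup_blin t : 0 <= t -> blin (T t).
Proof. by move=> t0; apply: linear_blin; case: CT => + _ _ _; apply. Qed.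

Lemma semigroup0 x : T 0 x = x.
Proof. by case: CT => _ -> _ _. Qed.

Lemma semigroupD s t x : 0 <= s -> 0 <= t -> T (s + t) x = T s (T t x).
Proof. by move=> s0 t0; case: CT => _ _ h _; rewrite (h s t s0 t0). Qed.

Lemma semigroupC s t x : 0 <= s -> 0 <= t -> T s (T t x) = T t (T s x).
Proof. by move=> s0 t0; rewrite -!semigroupD // addrC. Qed.

Lemma semigroup_cvg x : T t x @[t --> 0^'+] --> x.
Proof. by case: CT. Qed.

Lemma semigroup_iter n s x : 0 <= s -> T (n%:R * s) x = iter n (T s) x.
Proof.
move=> s0; elim: n => [|n IHn]; first by rewrite mul0r semigroup0.
by rewrite -natr1 mulrDl mul1r addrC semigroupD ?mulr_ge0 // IHn.
Qed.

(** Otherwise there are times tending to 0 at which the operators are unbounded in norm, although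
    each orbit converges along them: this contradicts [uniform_boundedness]. *)
Lemma semigroup_bound0 : exists d M, [/\ 0 < d, 1 <= M
  & forall t x, 0 <= t -> t < d -> nrm (T t x) <= M * nrm x].
Proof.
apply: contrapT => nb.
have /choice[p hp] (n : nat) : exists p : R * X, [/\ 0 < p.1, p.1 < harmonic n
    & (n.+1%:R) * nrm p.2 < nrm (T p.1 p.2)].
  apply: contrapT => nex; apply: nb; exists (harmonic n), n.+1%:R; split.
  - by rewrite invr_gt0 ltr0Sn.
  - by rewrite ler1n.
  move=> t x; rewrite le_eqVlt => /predU1P[<- _|t0 tn].
    by rewrite semigroup0 ler_peMl ?nrm_ge0 // ler1n.
  by rewrite leNgt; apply/negP => h; apply: nex; exists (t, x).
have p0 n : 0 < (p n).1 by have [] := hp n.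
have pc : (fun n => (p n).1) @ \oo --> (0 : R).
  apply: (squeeze_cvgr _ (cvg_cst 0) cvg_harmonic).
  by near=> n; have [/ltW -> /ltW ->] := hp n.
have [C hC] : exists C : R, forall n x, nrm (T (p n).1 x) <= C * nrm x.
  apply: (uniform_boundedness (f := fun n => T (p n).1)).
    by move=> n; apply: semigroup_blin; exact: ltW.
  by move=> x; exact: (cvg_nrm_bounded (cvg_seq_right (@semigroup_cvg x) p0 pc)).
have [_ _] := hp (Num.bound `|C|).
apply/negP; rewrite -leNgt (le_trans (hC _ _)) // ler_wpM2r ?nrm_ge0 //.
rewrite (le_trans (ler_norm _)) // ltW // (lt_trans (archi_boundP _)) //.
by rewrite ltr_nat.
Unshelve. all: by end_near. Qed.

Lemma semigroup_bound (tau : R) : exists2 M : R, 0 < M &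
  forall t x, 0 <= t -> t <= tau -> nrm (T t x) <= M * nrm x.
Proof.
have [d [M [d0 M1 hM]]] := semigroup_bound0.
have M0 : 0 < M by exact: lt_le_trans M1.
pose n := Num.bound (`|tau| / d).
have nd : tau < n%:R * d.
  rewrite (le_lt_trans (ler_norm _)) // -ltr_pdivrMr //.
  by apply: archi_boundP; rewrite divr_ge0 // ltW.
exists (M ^+ n.+1); first by rewrite exprn_gt0.
move=> t x t0 tt; pose s := t / n.+1%:R.
have s0 : 0 <= s by rewrite divr_ge0.
have sd : s < d.
  rewrite ltr_pdivrMr ?ltr0Sn // (le_lt_trans tt) // (lt_le_trans nd) // mulrC.
  by rewrite ler_pM2l // ler_nat.
have -> : t = n.+1%:R * s by rewrite mulrC divfK // pnatr_eq0.
rewrite semigroup_iter //; elim: (n.+1) => [|k IHk]; first by rewrite mul1r.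
by rewrite iterS (le_trans (hM _ _ s0 sd)) // exprS -mulrA ler_pM2l.
Qed.

End LocalBound.

(** * Comparison of a semigroup with other evolutions *)

Section GenericSemigroup.
Context {R : realType} {X : completeNormedModType R[i]}
        {T : R -> {linear X -> X}} {A : set (X * X)} (gT : generates A T).
Implicit Types (x y : X) (s t h : R) (l : R[i]).

Let CT : C0_semigroup T := gT.1.

Lemma generatorP x y : A (x, y) <-> (h^-1)%:C *: (T h x - x) @[h --> 0^'+] --> y.
Proof. by rewrite -gT.2. Qed.

Lemma semigroup_comm t x y : 0 <= t -> A (x, y) -> A (T t x, T t y).
Proof.
move=> t0 /generatorP Axy; apply/generatorP/right_cvgP => e e0.
have bT := semigroup_blin CT t0.
have /right_cvgP/(_ e e0)[d d0 hd] :
    T t ((h^-1)%:C *: (T h x - x)) @[h --> 0^'+] --> T t y by exact: blin_cvg.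
exists d => // h h0 hh; have := hd h h0 hh.
by rewrite (blinZ _ _ bT) (blinB _ _ bT) semigroupC // ltW.
Qed.

Lemma halves_gt0 t k : 0 < t -> 0 < t / 2 ^+ k.
Proof. by move=> t0; rewrite divr_gt0 // exprn_gt0. Qed.

Lemma generator_halves t x y : 0 < t -> A (x, y) ->
  ((t / 2 ^+ k)^-1)%:C *: (T (t / 2 ^+ k) x - x) @[k --> \oo] --> y.
Proof.
move=> t0 /generatorP Axy.
apply: (cvg_seq_right (u := fun h => (h^-1)%:C *: (T h x - x)) Axy).
  by move=> k; exact: halves_gt0.
exact: cvg_inv_exp2.
Qed.

Lemma le_lim_nrm (v : nat -> X) (a : X) (c d : R) :
  v @ \oo --> a -> (forall k, c <= d * nrm (v k)) -> c <= d * nrm a.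
Proof.
move=> va h.
have h1 : d * nrm (v k) @[k --> \oo] --> d * nrm a.
  by apply: cvgM; [exact: cvg_cst|exact: cvg_nrm_comp].
by apply: (ler_cvg_to (cvg_cst c) h1); apply: nearW.
Qed.

(* Telescoping over a subdivision of [0, t] reduces a comparison with [T t] to
   one of generators. *)
Lemma semigroup_compare (Q : R -> X -> X) (M M2 t : R) k x : 0 < t -> 0 <= M ->
  (forall s x, 0 <= s -> s <= t -> nrm (T s x) <= M * nrm x) ->
  (forall h, 0 < h -> h <= t -> blin (Q h) /\ forall x, T h (Q h x) = Q h (T h x)) ->
  (forall j x, (j <= 2 ^ k)%N -> nrm (iter j (Q (t / 2 ^+ k)) x) <= M2 * nrm x) ->
  nrm (T t x - iter (2 ^ k) (Q (t / 2 ^+ k)) x) <= t * (M * M2) *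
    nrm (((t / 2 ^+ k)^-1)%:C *: (T (t / 2 ^+ k) x - x) -
         ((t / 2 ^+ k)^-1)%:C *: (Q (t / 2 ^+ k) x - x)).
Proof.
move=> t0 M0 hM hQ hM2; set s := t / 2 ^+ k.
have s0 : 0 < s by exact: halves_gt0.
have st : s <= t by exact: (step_le _ (ltW t0)).
have [bQ TQ] := hQ s s0 st.
rewrite -{1}(step_mulK t k) -/s (semigroup_iter CT) ?(ltW s0) //.
have bT := semigroup_blin CT (ltW s0).
rewrite (le_trans (telescope_iter (M1 := M) (M2 := M2) x bT bQ TQ M0 _ hM2)) //.
  move=> j u jk; rewrite -(semigroup_iter CT) ?(ltW s0) //.
  apply: hM; first by rewrite mulr_ge0 // ltW.
  by rewrite -[X in _ <= X](step_mulK t k) -/s ler_wpM2r ?(ltW s0) // ler_nat.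
rewrite -scalerBr opprB addrA subrK nrmZ nrmR gtr0_norm ?invr_gt0 //.
rewrite le_eqVlt; apply/orP; left; apply/eqP.
rewrite -[in RHS](step_mulK t k) -/s; field.
by rewrite gt_eqF.
Qed.

Lemma scale_quotient (r c l : R[i]) x :
  r *: (c *: x - x) - l *: x = (r * (c - 1) - l) *: x.
Proof. by rewrite !scalerBl -scalerA scalerBl scale1r. Qed.

(** [semigroup_compare] with the scalar semigroup [cexp (h l)], whose generator [l] differs from [A]
    on [x] by [y - l *: x]. *)
Lemma approx_eigenvector t l : 0 <= t -> exists2 C : R, 0 <= C & forall x y, A (x, y) ->
  nrm (T t x - cexp (t%:C * l) *: x) <= C * nrm (y - l *: x).
Proof.
rewrite le_eqVlt => /predU1P[<-|t0].
  exists 0 => // x y _.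
  by rewrite (semigroup0 CT) mul0r cexp0 scale1r subrr nrm0 mul0r.
have [M M0 hM] := semigroup_bound CT t.
pose M2 := expR (t * `|complex.Re l|).
have M20 : 0 <= M2 by exact: expR_ge0.
have iterE c n (x : X) : iter n (fun x => c *: x) x = c ^+ n *: x.
  by elim: n => [|n IHn]; rewrite ?expr0 ?scale1r //= IHn scalerA exprS.
exists (t * (M * M2)); first by rewrite !mulr_ge0 ?(ltW t0) ?(ltW M0).
move=> x y Axy.
have lim : ((t / 2 ^+ k)^-1)%:C *: (T (t / 2 ^+ k) x - x) -
    ((t / 2 ^+ k)^-1)%:C *: (cexp ((t / 2 ^+ k)%:C * l) *: x - x) @[k --> \oo] -->
    y - l *: x.
  apply: cvgB; first exact: generator_halves.
  have h := cvg_seq_right (u := fun h => (h^-1)%:C * (cexp (h%:C * l) - 1) : R[i]^o)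
    (@cexp_derivative R l) (fun k => halves_gt0 k t0) (cvg_inv_exp2 t).
  apply/cvg_nrmP => e e0; have n0 : 0 < nrm x + 1 by rewrite ltr_wpDl ?nrm_ge0.
  move/(@cvg_nrmP R R[i]^o nat): h => /(_ _ (divr_gt0 e0 n0)); apply: filterS => k.
  rewrite scale_quotient => qe.
  rewrite nrmZ (le_lt_trans (ler_wpM2l (nrm_ge0 _) (_ : nrm x <= nrm x + 1))) ?lerDl //.
  by rewrite -ltr_pdivlMr.
(* The left-hand side does not depend on the subdivision, so only the quotients on the right pass to
   the limit. *)
apply: (le_lim_nrm lim) => k.
have -> : cexp (t%:C * l) *: x =
    iter (2 ^ k) (fun x => cexp ((t / 2 ^+ k)%:C * l) *: x) x.
  by rewrite iterE -cexpMn step_mulK.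
apply: (semigroup_compare (Q := fun h x => cexp (h%:C * l) *: x) _ t0 (ltW M0) hM).
  by move=> h h0 _; split; [exact: blin_scale (blin_id)|move=> u; rewrite linearZ].
move=> j u jk; rewrite iterE nrmZ nrmX nrm_cexp ler_wpM2r ?nrm_ge0 //.
rewrite -expRM_natl ler_expR.
have -> : complex.Re ((t / 2 ^+ k)%:C * l) = t / 2 ^+ k * complex.Re l.
  by case: (l) => a b /=; rewrite mul0r subr0.
rewrite mulrA (@le_trans _ _ (j%:R * (t / 2 ^+ k) * `|complex.Re l|)) //.
  by rewrite ler_wpM2l ?ler_norm // mulr_ge0 // ltW // halves_gt0.
rewrite ler_wpM2r // -[X in _ <= X](step_mulK t k).
by rewrite ler_wpM2r ?(ltW (halves_gt0 k t0)) // ler_nat.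
Qed.

End GenericSemigroup.

Lemma le_eps (R : realType) (a b C : R) : 0 <= C ->
  (forall e, 0 < e -> a <= b + C * e) -> a <= b.
Proof.
move=> C0 h; apply/ler_addgt0Pr => e e0.
have c1 : 0 < C + 1 by rewrite ltr_wpDl.
rewrite (le_trans (h (e / (C + 1)) (divr_gt0 e0 c1))) // lerD2l.
by rewrite mulrCA ger_pMr // ler_pdivrMr // mul1r lerDl.
Qed.

(** * Uniqueness and normality of the generated semigroup *)

Section NormalGenerator.
Context {R : realType} {X : completeNormedModType R[i]}
        {dot : {dot X for @Num.conj R[i]}}
        (norm_dot : forall x : X, `|x| ^+ 2 = dot x x)
        {A : set (X * X)} (nA : nop (dot := dot) A)
        {T : R -> {linear X -> X}} (gT : generates A T).
Implicit Types (x y : X) (s t h : R) (l : R[i]).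

Let CT : C0_semigroup T := gT.1.

(** On approximate eigenvectors [T 1] acts as [exp l], so [1 + Re l <= exp (Re l) <= M]. *)
Lemma spectrum_half_plane : exists2 w : R, 0 < w &
  forall l, spectrum A l -> complex.Re l <= w.
Proof.
have [M M0 hM] := semigroup_bound CT 1.
exists M => // l /(spectrumP norm_dot nA) sl.
rewrite (@le_trans _ _ (1 + complex.Re l)) ?lerDr // (le_trans (expR_ge1Dx _)) //.
have [C C0 hC] := approx_eigenvector gT l ler01.
apply: (le_eps C0) => e /sl [x [y [Axy x1 xy]]].
have := hC x y Axy; have := hM 1 x ler01 (lexx 1); rewrite x1 mulr1 => h1 h2.
have := nrm_lerB (cexp (1%:C * l) *: x) (T 1 x).
rewrite nrmC nrmZ x1 mulr1 nrm_cexp rmorph1 mul1r => h3.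
have := ler_wpM2l C0 xy; move: h2; rewrite rmorph1 mul1r; lra.
Qed.

Section HalfPlane.
Context {w : R} (w_gt0 : 0 < w)
        (spA : forall l : R[i], spectrum A l -> complex.Re l <= w).

Local Notation J := (euler norm_dot nA w_gt0 spA).

Lemma semigroup_euler_comm t s x : 0 <= t -> T t (J s x) = J s (T t x).
Proof.
move=> t0; have bT := semigroup_blin CT t0.
have [[s0 sw]|h] := pselect (0 < s /\ s * w <= 2^-1); last first.
  have -> // : J s = id by rewrite /euler; case: pselect.
have [_ h1 h2 _] := eulerP norm_dot nA w_gt0 spA s0 sw.
have [y Ay yE] := h1 x; have := h2 _ _ (semigroup_comm gT t0 Ay).
by rewrite -(blinZ _ _ bT) -(blinB _ _ bT) yE.
Qed.

(** Euler steps commute with [T] and have the same derivative at 0 on the domain of [A], so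
    [semigroup_compare] identifies the limits. This places an arbitrary [T t] in the bicommutant. *)
Lemma semigroup_euler_limit t x : 0 <= t -> T t x = euler_limit norm_dot nA w_gt0 spA t x.
Proof.
rewrite le_eqVlt => /predU1P[<-|t0]; first by rewrite euler_limit0 (semigroup0 CT).
have [M M0 hM] := semigroup_bound CT t.
apply: (blin_dense2 norm_dot nA w_gt0 spA (semigroup_blin CT (ltW t0))
  (euler_limit_blin norm_dot nA w_gt0 spA t)) => {}x y z Axy Ayz.
apply/esym; apply: (nlim_uniq (euler_limitP (ltW t0))).
pose M2 := expR (2 * (t * w)).
have lim : ((t / 2 ^+ k)^-1)%:C *: (T (t / 2 ^+ k) x - x) -
    ((t / 2 ^+ k)^-1)%:C *: (J (t / 2 ^+ k) x - x) @[k --> \oo] --> (0 : X).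
  rewrite -(subrr y); apply: cvgB; first exact: (generator_halves gT t0 Axy).
  apply/cvg_nrmP => e e0.
  have [d d0 hd] := euler_cvg norm_dot nA w_gt0 spA y e0.
  have /cvgr0Pnorm_lt/(_ d d0)[N _ hN] := cvg_inv_exp2 t.
  exists N => // k Nk /=; have s0 := halves_gt0 k t0.
  have sd : t / 2 ^+ k < d by rewrite (le_lt_trans (ler_norm _)) // hN.
  have [sw h] := hd _ s0 sd.
  rewrite (euler_sub _ _ _ _ (ltW s0) sw Axy) scalerA -rmorphM mulVf ?gt_eqF //.
  by rewrite scale1r.
apply/cvg_nrm; apply: (squeeze_cvgr (f := fun=> 0) (h := fun k => t * (M * M2) *
    nrm (((t / 2 ^+ k)^-1)%:C *: (T (t / 2 ^+ k) x - x) -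
         ((t / 2 ^+ k)^-1)%:C *: (J (t / 2 ^+ k) x - x)))).
- apply: nearW => k; rewrite nrm_ge0 nrmC /=.
  apply: (semigroup_compare gT _ t0 (ltW M0) hM).
    move=> h h0 _; split; first exact: euler_blin.
    by move=> u; rewrite semigroup_euler_comm // ltW.
  by move=> j u jk; exact: (iter_step_nrm norm_dot nA w_gt0 spA u (ltW t0) jk).
- exact: cvg_cst.
- rewrite -(mulr0 (t * (M * M2))) -(nrm0 (V := X)).
  by apply: cvgM; [exact: cvg_cst|exact: cvg_nrm_comp].
Qed.

End HalfPlane.

Lemma semigroup_bicomm t : 0 <= t -> exists N', bicomm (dot := dot) (A := A) (T t) N'.
Proof.
move=> t0; have [w w0 spA] := spectrum_half_plane.
have [N' hN] := euler_limit_bicomm norm_dot nA w0 spA t0.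
exists N'; move: hN; congr bicomm; apply/funext => x.
by rewrite (semigroup_euler_limit w0 spA).
Qed.

End NormalGenerator.

(** * Spectra in a logarithmic region *)

Section ScalarEstimates.
Context {R : realType}.
Implicit Types (x y h t : R) (z l : R[i]).

Lemma mean_value_le (f df : R -> R) y :
  (forall x, is_derive x 1 f (df x)) -> (forall x, `|df x| <= 1) ->
  `|f y - f 0| <= `|y|.
Proof.
move=> fd df1.
have fc : continuous f.
  by move=> x; apply: differentiable_continuous; apply/derivable1_diffP; case: (fd x).
have [y0|/ltW y0] := lerP 0 y.
  have [c _ ->] := MVT_segment y0 (fun x _ => fd x) (continuous_subspaceT fc).
  by rewrite subr0 normrM ler_piMl.
have [c _ E] := MVT_segment y0 (fun x _ => fd x) (continuous_subspaceT fc).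
by rewrite distrC E sub0r normrM normrN ler_piMl.
Qed.

Lemma sin_le_norm y : `|sin y| <= `|y|.
Proof.
by have := mean_value_le y (@is_derive_sin R) (@cos_max R); rewrite sin0 subr0.
Qed.

Lemma cos_sub1_le_norm y : `|cos y - 1| <= `|y|.
Proof.
have := mean_value_le y (@is_derive_cos R); rewrite cos0; apply=> x.
by rewrite normrN sin_max.
Qed.

Lemma expR_sub1_le x : `|expR x - 1| <= `|x| * expR (Num.max x 0).
Proof.
have [x0|/ltW x0] := lerP 0 x.
  rewrite !ger0_norm ?subr_ge0 ?pexpR_ge1 //; last by rewrite -expR0 ler_expR.
  have h : expR (- x) * expR x = 1 by rewrite -expRD addNr expR0.
  have := ler_wpM2r (expR_ge0 x) (expR_ge1Dx (- x)); rewrite h mulrDl mul1r mulNr; lra.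
rewrite expR0 mulr1 !ler0_norm ?subr_le0 // -?expR0 ?ler_expR // expR0.
have := expR_ge1Dx x; lra.
Qed.

Lemma cexp_sub1_le z : nrm (cexp z - 1) <= 3 * nrm z * expR (Num.max (complex.Re z) 0).
Proof.
rewrite (le_trans (nrm_ReIm _)) //.
have hx := nrm_Re z; have hy := nrm_Im z.
case: z hx hy => x y /=; set r := nrm _ => hx hy.
rewrite !(mul0r, mulr0, add0r, addr0, subr0, oppr0).
set m := expR (Num.max x 0).
have m1 : 1 <= m by rewrite -expR0 ler_expR le_max lexx orbT.
have mx : expR x <= m by rewrite ler_expR le_max lexx.
have h1 : `|expR x * cos y - 1| <= `|expR x - 1| + `|cos y - 1|.
  have -> : expR x * cos y - 1 = (expR x - 1) * cos y + (cos y - 1) by ring.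
  rewrite (le_trans (ler_normD _ _)) // lerD2r normrM.
  by rewrite -[X in _ <= X]mulr1 ler_wpM2l // cos_max.
have h2 : `|expR x - 1| <= r * m.
  by rewrite (le_trans (expR_sub1_le x)) // ler_wpM2r ?expR_ge0.
have h3 : `|cos y - 1| <= r * m.
  rewrite (le_trans (cos_sub1_le_norm y)) // (le_trans hy) // ler_peMr //.
  exact: nrm_ge0.
have h4 : `|expR x * sin y| <= r * m.
  rewrite normrM mulrC ler_pM // ?(le_trans (sin_le_norm y)) //.
  by rewrite ger0_norm ?expR_ge0.
have -> : 3 * r * m = r * m + r * m + r * m by ring.
lra.
Qed.

Lemma log_regionP (w a b : R) l : 0 < b -> log_region w a b l ->
  complex.Re l <= w /\
  (complex.Im l != 0 -> complex.Re l <= a - b * ln `|complex.Im l|).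
Proof.
move=> b0; rewrite /log_region /mkset le_min => /andP[+ h]; rewrite lee_fin => lw.
split => // l0; by move: h; rewrite lne_EFin ?normr_gt0 //.
Qed.

Lemma log_region_intro (w a b : R) l : 0 < b -> complex.Re l <= w ->
  (complex.Im l != 0 -> complex.Re l <= a - b * ln `|complex.Im l|) ->
  log_region w a b l.
Proof.
move=> b0 lw h; rewrite /log_region /mkset le_min lee_fin lw andTb.
have [l0|l0] := eqVneq (complex.Im l) 0.
  rewrite l0 normr0 le0_lneNy ?lexx // gt0_muleNy ?lte_fin //.
  by rewrite leey.
by rewrite lne_EFin ?normr_gt0 // -EFinM -EFinB lee_fin h.
Qed.

(** The scalar form of the boundedness of [A T(b^-1)]. The logarithmic curve is a level curve of
    [|Im l| exp (Re l / b)]; the real part is bounded by [w] on the right, and by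
    [u exp (- u / b) <= b] on the left. *)
Lemma region_exp_bound (w a b : R) l : 0 < w -> 0 < b -> log_region w a b l ->
  nrm l * expR (b^-1 * complex.Re l) <= expR (b^-1 * a) + w * expR (b^-1 * w) + b.
Proof.
move=> w0 b0 /(log_regionP b0)[lw lr].
have bV : 0 < b^-1 by rewrite invr_gt0.
have h1 : `|complex.Im l| * expR (b^-1 * complex.Re l) <= expR (b^-1 * a).
  have [->|l0] := eqVneq (complex.Im l) 0; first by rewrite normr0 mul0r expR_ge0.
  have n0 : 0 < `|complex.Im l| by rewrite normr_gt0.
  rewrite -[X in X * _](lnK n0) -expRD ler_expR.
  have := ler_wpM2l (ltW bV) (lr l0); rewrite mulrBr mulrA mulVf ?gt_eqF //; lra.
have h2 : `|complex.Re l| * expR (b^-1 * complex.Re l) <= w * expR (b^-1 * w) + b.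
  have p := expR_ge0 (b^-1 * w).
  have [x0|x0] := lerP 0 (complex.Re l).
    rewrite (@le_trans _ _ (w * expR (b^-1 * w))) ?lerDl ?(ltW b0) //.
    by rewrite ger0_norm // ler_pM ?expR_ge0 // ler_expR ler_pM2l.
  rewrite (@le_trans _ _ b) ?lerDr ?mulr_ge0 ?(ltW w0) //.
  set x := complex.Re l in x0 *; rewrite -(ler_pM2l bV) mulVf ?gt_eqF // mulrA.
  have := expR_ge1Dx (- (b^-1 * x)) => h.
  have e1 : expR (- (b^-1 * x)) * expR (b^-1 * x) = 1 by rewrite -expRD addNr expR0.
  by rewrite -e1 ler_wpM2r ?expR_ge0 // ltr0_norm // mulrN; lra.
rewrite (le_trans (ler_wpM2r (expR_ge0 _) (nrm_ReIm l))) // mulrDl; lra.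
Qed.

(** The first summand of the witness covers [h |l| <= 1], the other two the opposite case. *)
Lemma difference_quotient_bound (w a b : R) : 0 < w -> 0 < b ->
  exists2 K : R, 0 <= K & forall l h, log_region w a b l -> 0 < h -> h <= b^-1 ->
    nrm ((h^-1)%:C * (cexp (b^-1%:C * l) - cexp ((b^-1 - h)%:C * l))) <= K.
Proof.
move=> w0 b0; set C := expR (b^-1 * a) + w * expR (b^-1 * w) + b.
have C0 : 0 < C by rewrite !addr_gt0 ?mulr_gt0 ?expR_gt0.
exists (3 * C * expR 1 + C * expR (b / C) + C).
  by rewrite !addr_ge0 ?mulr_ge0 ?expR_ge0 // ltW.
move=> l h lr h0 hb; have hC := region_exp_bound w0 b0 lr; rewrite -/C in hC.
clearbody C.
set x := complex.Re l in hC; set q := nrm l in hC.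
have ReZ t : complex.Re (t%:C * l) = t * x.
  by rewrite /x; case: (l) => u v /=; rewrite mul0r subr0.
have E : cexp (b^-1%:C * l) - cexp ((b^-1 - h)%:C * l) =
    cexp ((b^-1 - h)%:C * l) * (cexp (h%:C * l) - 1).
  by rewrite mulrBr mulr1 -cexpD -mulrDl -rmorphD subrK.
have q0 : 0 <= q by exact: nrm_ge0.
have p1 : 0 <= 3 * C * expR 1 by rewrite !mulr_ge0 ?expR_ge0 // ltW.
have p2 : 0 <= C * expR (b / C) by rewrite mulr_ge0 ?expR_ge0 // ltW.
rewrite E nrmM nrmR gtr0_norm ?invr_gt0 // nrmM nrm_cexp ReZ ler_pdivrMl //.
(* [|cexp (h l) - 1|] is of order [h |l|] if [h |l| <= 1]; otherwise
   [expR (x / b) <= C h] absorbs the factor [h^-1]. *)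
have [hq|hq] := lerP (h * q) 1.
  have h1 := cexp_sub1_le (h%:C * l).
  rewrite ReZ nrmM nrmR gtr0_norm // -/q in h1.
  rewrite (le_trans (ler_wpM2l (expR_ge0 _) h1)) //.
  have e1 : expR ((b^-1 - h) * x) * expR (Num.max (h * x) 0) <= expR (b^-1 * x) * expR 1.
    rewrite -!expRD ler_expR mulrBl.
    have hx : `|h * x| <= 1.
      rewrite normrM gtr0_norm // (le_trans _ hq) // ler_pM2l //.
      exact: nrm_Re.
    move: hx; rewrite ler_norml; case: (lerP (h * x) 0) => s1; lra.
  have := ler_wpM2l (mulr_ge0 (ltW h0) q0) e1.
  have := ler_wpM2l (mulr_ge0 (ltW h0) (expR_ge0 1)) hC.
  have := mulr_ge0 (ltW h0) p2; have := mulr_ge0 (ltW h0) (ltW C0).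
  rewrite !mulrDr; lra.
have xC : expR (b^-1 * x) <= C * h.
  have q1 : 0 < q by rewrite -(pmulr_rgt0 _ h0); exact: lt_trans hq.
  rewrite -(ler_pM2l q1) (le_trans hC) // mulrCA -[X in X <= _]mulr1 mulrC.
  by rewrite [q * h]mulrC mulrC ler_pM2l // ltW.
(* The left side is the power [1 - h b] of [expR (b^-1 * x)], hence at most [(C h)^(1 - h b)], and
   [- ln u <= u^-1] bounds [(C h)^(- h b)] by [expR (b / C)]. *)
have xh : expR ((b^-1 - h) * x) <= C * h * expR (b / C).
  have Ch : 0 < C * h by rewrite mulr_gt0.
  rewrite -{1}(lnK Ch) -expRD ler_expR.
  have l1 : b^-1 * x <= ln (C * h) by rewrite -[b^-1 * x]expRK ler_ln ?posrE ?expR_gt0.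
  have l2 : - ln (C * h) <= (C * h)^-1.
    by rewrite -lnV ?posrE // ltW // ln_sublinear // invr_gt0.
  have hb1 : 0 <= 1 - h * b by rewrite subr_ge0 -ler_pdivlMr // div1r.
  have -> : (b^-1 - h) * x = (1 - h * b) * (b^-1 * x) by field; rewrite gt_eqF.
  rewrite (le_trans (ler_wpM2l hb1 l1)) // mulrBl mul1r lerD2l -mulrN.
  rewrite (le_trans (ler_wpM2l (mulr_ge0 (ltW h0) (ltW b0)) l2)) //.
  rewrite invfM le_eqVlt; apply/orP; left; apply/eqP; field.
  by rewrite !gt_eqF.
have n1 : nrm (cexp (h%:C * l) - 1) <= expR (h * x) + 1.
  by rewrite (le_trans (nrmB _ _)) // nrm_cexp nrm1 ReZ.
rewrite (le_trans (ler_wpM2l (expR_ge0 _) n1)) // mulrDr mulr1 -expRD -mulrDl subrK.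
have := mulr_ge0 (ltW h0) p1; rewrite !mulrDr; lra.
Qed.

End ScalarEstimates.

Section DifferentiableOrbits.
Context {R : realType} {X : completeNormedModType R[i]}.

Lemma orbit_differentiable_atP (u : R -> X) (t : R) :
  orbit_differentiable_at u t <-> exists g : X, forall e, 0 < e ->
    exists2 d, 0 < d & forall s, 0 <= s -> s != t -> `|s - t| < d ->
      nrm (((s - t)^-1)%:C *: (u s - u t) - g) < e.
Proof.
split=> -[g hg]; exists g.
  move=> e e0; have /cvg_nrmP/(_ e e0) := hg.
  rewrite /within /= => /nbhs_ballP[d /= d0 hd]; exists d => // s s0 st sd.
  have : ball t d s by rewrite -ball_normE /ball_ /= distrC.
  by move=> /hd; apply; rewrite //= in_itv /= s0.
apply/cvg_nrmP => e /hg[d d0 hd]; rewrite /within /=; apply/nbhs_ballP.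
exists d => //= s; rewrite -ball_normE /ball_ /= distrC => sd st.
by rewrite in_itv /= andbT => s0; exact: hd.
Qed.

End DifferentiableOrbits.

(** * The two implications *)

Section Final.
Context {R : realType} {X : completeNormedModType R[i]}
        {dot : {dot X for @Num.conj R[i]}}
        (norm_dot : forall x : X, `|x| ^+ 2 = dot x x)
        {A : set (X * X)} (nA : nop (dot := dot) A).
Implicit Types (x y : X) (s t h : R) (l : R[i]).

Lemma bicomm_normal_operator (S : {linear X -> X}) N' : continuous S ->
  bicomm (dot := dot) (A := A) S N' -> normal_operator dot (graph_of S).
Proof.
move=> cS hN; have [_ _ adj _] := hN.
have adjE : adjoint dot (graph_of S) = [set p | p.2 = N' p.1].
  apply/seteqP; split=> -[y z] /=.
    by move=> h; apply: dot_inj => // x; rewrite -adj; apply/esym/h.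
  by move=> -> x v; rewrite /graph_of /= => ->; rewrite adj.
split.
- split=> [|c [x y] [x' y']|x y z] /=; rewrite /graph_of /=.
  + by rewrite linear0.
  + by move=> -> ->; rewrite linearP.
  + by move=> -> ->.
- by move=> O [x Ox] _; exists x; split => //; exists (S x).
- have -> : graph_of S = (fun p : X * X => p.2 - S p.1) @^-1` [set 0].
    by apply/seteqP; split=> p; rewrite /graph_of /= => /eqP; rewrite ?subr_eq0 => h;
      apply/eqP; rewrite ?subr_eq0.
  apply: closed_comp; last exact/accessible_closed_set1/hausdorff_accessible/norm_hausdorff.
  move=> p _.
  have h1 : q.1 @[q --> p] --> p.1 by exact: cvg_fst.
  have h2 : q.2 @[q --> p] --> p.2 by exact: cvg_snd.
  exact: (cvgB h2 (cvg_comp _ _ h1 (cS p.1))).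
- rewrite adjE; apply/seteqP; split=> -[x z] /= -[y]; rewrite /graph_of /= => -> ->.
    by exists (N' x) => //=; rewrite (bicommC _ hN (bicomm_sym hN)).
  by exists (S x) => //=; rewrite (bicommC _ hN (bicomm_sym hN)).
Qed.

Section Forward.
Context {T : R -> {linear X -> X}} (gT : generates A T).
Let CT : C0_semigroup T := gT.1.

Lemma semigroup_normal t : 0 <= t -> normal_operator dot (graph_of (T t)).
Proof.
move=> t0; have [N' hN] := semigroup_bicomm norm_dot nA gT t0.
by apply: bicomm_normal_operator hN; case: CT => + _ _ _; apply.
Qed.

(** The right difference quotients at [t0] converge on every vector, hence are uniformly bounded; on
    the domain of [A] their limit is [T t0 y]. *)
Lemma eventually_differentiable_bound t0 : 0 < t0 ->
  (forall f, orbit_differentiable_at (T ^~ f) t0) ->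
  exists B : R, forall x y, A (x, y) -> nrm (T t0 y) <= B * nrm x.
Proof.
move=> t00 hd.
pose h n : R := harmonic n.
have h0 n : 0 < h n by rewrite invr_gt0 ltr0Sn.
pose Q n x := (h n)^-1%:C *: (T (t0 + h n) x - T t0 x).
have hc : h @ \oo --> (0 : R) by exact: cvg_harmonic.
have bT t : 0 <= t -> blin (T t) by exact: semigroup_blin.
have Qc f : exists g : X, Q n f @[n --> \oo] --> g.
  have /orbit_differentiable_atP[g hg] := hd f; exists g.
  apply/seq_cvgP => e /hg[d d0 {}hd].
  have /cvgr0Pnorm_lt/(_ d d0)[N _ hN] := hc.
  exists N => n Nn; have := hd (t0 + h n).
  have E : t0 + h n - t0 = h n by rewrite addrAC subrr add0r.
  rewrite E; apply.
  - by rewrite addr_ge0 // ltW.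
  - by rewrite -subr_eq0 E gt_eqF.
  - exact: hN.
have [B hB] : exists B : R, forall n x, nrm (Q n x) <= B * nrm x.
  apply: uniform_boundedness => [n|x].
    apply: blin_scale; apply: blin_sub; apply: bT; first by rewrite addr_ge0 // ltW.
    exact: ltW.
  by have [g hg] := Qc x; exact: (cvg_nrm_bounded hg).
exists B => x y Axy.
apply: (@nrm_le_lim _ _ _ \oo _ (fun n => Q n x)); last by apply: nearW => n; exact: hB.
have bt := bT t0 (ltW t00).
have -> : (fun n => Q n x) = (fun n => T t0 ((h n)^-1%:C *: (T (h n) x - x))).
  apply/funext => n; rewrite (blinZ _ _ bt) (blinB _ _ bt).
  by rewrite -(semigroupD CT) // ltW.
apply: blin_cvg => //.
have := (generatorP gT x y).1 Axy => lim.
exact: (cvg_seq_right lim h0 hc).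
Qed.

(** On approximate eigenvectors [T t0 y] is close to [l exp (t0 l) x], so [|l| exp (t0 Re l) <= B].
    Taking logarithms gives the region with [b = t0^-1]. *)
Lemma spectrum_log_region : eventually_differentiable T ->
  exists w a b : R, [/\ 0 < a, 0 < b & spectrum A `<=` log_region w a b].
Proof.
move=> [t0 t00 hd].
have [B hB] := eventually_differentiable_bound t00 (fun f => hd f t0 (lexx t0)).
have [w w0 hw] := spectrum_half_plane norm_dot nA gT.
have [M M0 hM] := semigroup_bound CT t0.
(* Enlarged beyond 1 so that [a = t0^-1 * ln D] is positive. *)
pose D := expR 1 + `|B|.
have D0 : 0 < D by rewrite ltr_wpDr // expR_gt0.
exists w, (t0^-1 * ln D), t0^-1.
have b0 : 0 < t0^-1 by rewrite invr_gt0.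
split => //.
  rewrite mulr_gt0 // ln_gt0 // (@lt_le_trans _ _ (expR 1)) ?lerDl //.
  by rewrite -expR0 ltr_expR.
move=> l sl; apply: log_region_intro => //; first exact: hw.
move=> l0.
have key : nrm l * expR (t0 * complex.Re l) <= B.
  have [C C0 hC] := approx_eigenvector gT l (ltW t00).
  apply: (@le_eps _ _ _ (M + nrm l * C)).
    by rewrite addr_ge0 ?mulr_ge0 ?nrm_ge0 // ltW.
  move=> e e0; move/(spectrumP norm_dot nA): sl => /(_ e e0)[x [y [Axy x1 xy]]].
  have bT := semigroup_blin CT (ltW t00).
  have h1 := hB _ _ Axy; rewrite x1 mulr1 in h1.
  have h2 : nrm (T t0 y - l *: T t0 x) <= M * e.
    rewrite -(blinZ _ _ bT) -(blinB _ _ bT) (le_trans (hM _ _ (ltW t00) (lexx _))) //.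
    by rewrite ler_wpM2l // ltW.
  have h3 : nrm (l *: T t0 x - (l * cexp (t0%:C * l)) *: x) <= nrm l * (C * e).
    rewrite -scalerA -scalerBr nrmZ ler_wpM2l ?nrm_ge0 //.
    by rewrite (le_trans (hC _ _ Axy)) // ler_wpM2l.
  have := nrm_lerB ((l * cexp (t0%:C * l)) *: x) (l *: T t0 x).
  have := nrm_lerB (l *: T t0 x) (T t0 y).
  rewrite (nrmC _ (T t0 y)) (nrmC ((l * _) *: x)) [nrm (_ *: x)]nrmZ x1 mulr1 nrmM nrm_cexp.
  have -> : complex.Re (t0%:C * l) = t0 * complex.Re l.
    by case: (l) => u v /=; rewrite mul0r subr0.
  have -> : (M + nrm l * C) * e = M * e + nrm l * (C * e) by ring.
  lra.
have n0 : 0 < `|complex.Im l| by rewrite normr_gt0.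
have {}key : `|complex.Im l| * expR (t0 * complex.Re l) <= D.
  rewrite (@le_trans _ _ (nrm l * expR (t0 * complex.Re l))) //.
    by rewrite ler_wpM2r ?expR_ge0 ?nrm_Im.
  by rewrite (le_trans key) // /D (le_trans (ler_norm B)) // lerDr expR_ge0.
rewrite -(ler_pM2l t00) mulrBr !mulrA mulfV ?gt_eqF // !mul1r.
have : ln (`|complex.Im l| * expR (t0 * complex.Re l)) <= ln D.
  by rewrite ler_ln ?posrE // mulr_gt0 // expR_gt0.
rewrite lnM ?posrE ?expR_gt0 // expRK; lra.
Qed.

End Forward.

Section Backward.
Context {w a b : R} (b_gt0 : 0 < b) (spA : spectrum A `<=` log_region w a b).
Context {T : R -> {linear X -> X}} (gT : generates A T).
Let CT : C0_semigroup T := gT.1.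
Let t0 : R := b^-1.
Let t0_gt0 : 0 < t0. Proof. by rewrite invr_gt0. Qed.

(* At the critical time [t0] only left difference quotients need an estimate:
   the right one with step [h] is [T h] applied to the left one. *)
Let D h x : X := (h^-1)%:C *: (T t0 x - T (t0 - h) x).

(** [D h] is in the bicommutant, and each of its joint approximate eigenvalues [(mu, l)] with [A]
    has [mu] equal to the scalar difference quotient at [l]. *)
Lemma left_quotient_bound : exists2 K : R, 0 <= K & forall h x, 0 < h -> h <= t0 ->
  nrm (D h x) <= K * nrm x.
Proof.
pose w1 := Num.max w 1.
have w10 : 0 < w1 by rewrite lt_max ltr01 orbT.
have sp1 l : spectrum A l -> complex.Re l <= w1.
  by move=> /spA /(log_regionP b_gt0)[lw _]; rewrite le_max lw.
have [K K0 hK] := difference_quotient_bound a w10 b_gt0.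
exists (K * expR 1); first by rewrite mulr_ge0 ?expR_ge0.
move=> h x h0 ht; have th : 0 <= t0 - h by rewrite subr_ge0.
have [N1 hN1] := semigroup_bicomm norm_dot nA gT (ltW t0_gt0).
have [N2 hN2] := semigroup_bicomm norm_dot nA gT th.
have hD := bicomm_scale nA (h^-1)%:C (bicomm_sub nA hN1 hN2).
apply: (joint_spectrum_bound norm_dot nA w10 sp1 hD K0) => mu l jl.
have sl := joint_spectrum_spectrum norm_dot nA jl.
have lr : log_region w1 a b l.
  have [lw lb] := log_regionP b_gt0 (spA sl).
  by apply: log_region_intro => //; rewrite le_max lw.
have [C1 C10 hC1] := approx_eigenvector gT l (ltW t0_gt0).
have [C2 C20 hC2] := approx_eigenvector gT l th.
pose q := (h^-1)%:C * (cexp (t0%:C * l) - cexp ((t0 - h)%:C * l)).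
suff -> : mu = q by exact: hK.
apply/eqP; rewrite -subr_eq0 -nrm_eq0 eq_le nrm_ge0 andbT.
apply: (@le_eps _ _ _ (1 + h^-1 * (C1 + C2))).
  by rewrite addr_ge0 // mulr_ge0 ?addr_ge0 // invr_ge0 ltW.
move=> e /jl[u [v [Auv u1 uv hu]]]; rewrite add0r.
have h1 : nrm (D h u - q *: u) <= h^-1 * (C1 + C2) * e.
  rewrite /D /q -scalerA -scalerBr nrmZ nrmR gtr0_norm ?invr_gt0 // -mulrA.
  rewrite ler_pM2l ?invr_gt0 // scalerBl.
  have := hC1 _ _ Auv; have := hC2 _ _ Auv.
  have := ler_wpM2l C10 uv; have := ler_wpM2l C20 uv.
  have := nrmB (T t0 u - cexp (t0%:C * l) *: u)
    (T (t0 - h) u - cexp ((t0 - h)%:C * l) *: u).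
  have -> : T t0 u - T (t0 - h) u -
      (cexp (t0%:C * l) *: u - cexp ((t0 - h)%:C * l) *: u) =
    T t0 u - cexp (t0%:C * l) *: u - (T (t0 - h) u - cexp ((t0 - h)%:C * l) *: u).
    by rewrite !opprB addrACA [RHS]addrACA; congr (_ + _); exact: addrC.
  lra.
have := nrm_sub (D h u) (mu *: u) (q *: u).
rewrite -scalerBl nrmZ u1 mulr1 (nrmC (mu *: u)) => /le_trans; apply.
by rewrite mulrDl mul1r lerD.
Qed.

Lemma left_quotient_blin h : 0 < h -> h <= t0 -> blin (D h).
Proof.
move=> h0 ht; apply: blin_scale; apply: blin_sub; apply: (semigroup_blin CT).
  exact: ltW.
by rewrite subr_ge0.
Qed.

Lemma left_quotient_cvg_dom x y : A (x, y) -> D h x @[h --> 0^'+] --> T t0 y.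
Proof.
move=> Axy; have [M M0 hM] := semigroup_bound CT t0.
apply/right_cvgP => e e0; have e20 : 0 < e / 2 / M by rewrite !divr_gt0.
have /right_cvgP/(_ _ e20)[d1 d10 hd1] := (generatorP gT x y).1 Axy.
have /right_cvgP/(_ _ e20)[d2 d20 hd2] := @semigroup_cvg _ _ _ CT y.
exists (Num.min t0 (Num.min d1 d2)); first by rewrite !lt_min t0_gt0 d10.
move=> h h0; rewrite !lt_min => /and3P[ht h1 h2].
have th : 0 <= t0 - h by rewrite subr_ge0 ltW.
have bT := semigroup_blin CT th.
have TE v : T t0 v = T (t0 - h) (T h v) by rewrite -(semigroupD CT) ?subrK // ltW.
have -> : D h x - T t0 y = T (t0 - h) ((h^-1)%:C *: (T h x - x) - T h y).
  by rewrite /D !TE -(blinB _ _ bT) -(blinZ _ _ bT) -(blinB _ _ bT).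
rewrite (le_lt_trans (hM _ _ th _)) ?gerBl ?(ltW h0) //.
rewrite mulrC -ltr_pdivlMr // (le_lt_trans (nrm_sub y _ _)) // (nrmC y).
have -> : e / M = e / 2 / M + e / 2 / M by field; rewrite gt_eqF.
by rewrite ltrD ?hd1 ?hd2.
Qed.

(** Uniform boundedness carries convergence over from the dense domain of [A]; [claim] is the Cauchy
    property this gives. *)
Lemma left_quotient_cvg x : exists l : X, D h x @[h --> 0^'+] --> l.
Proof.
have [K K0 hK] := left_quotient_bound.
have K1 : 0 < K + 1 by rewrite ltr_wpDl.
have claim (e : R) : 0 < e -> exists g d, [/\ 0 < d, d <= t0 &
    forall h, 0 < h -> h < d -> nrm (D h x - g) < e].
  move=> e0; have [_ _ dA _ _] := nA.
  have e20 : 0 < e / 2 by rewrite divr_gt0.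
  have [[u v] [Auv /= xu]] := dA x _ (divr_gt0 e20 K1).
  have /right_cvgP/(_ _ e20)[d d0 hd] := left_quotient_cvg_dom Auv.
  exists (T t0 v), (Num.min d t0); rewrite lt_min d0 t0_gt0 ge_min lexx orbT.
  split => // h h0; rewrite lt_min => /andP[hd' ht].
  rewrite (le_lt_trans (nrm_sub (D h u) _ _)) // (splitr e) ltrD ?hd //.
  rewrite -(blinB _ _ (left_quotient_blin h0 (ltW ht))).
  rewrite (le_lt_trans (hK _ _ h0 (ltW ht))) //.
  move: xu; rewrite ltr_pdivlMr //; have := nrm_ge0 (x - u); nra.
have h0 n : 0 < t0 / 2 ^+ n by exact: halves_gt0.
have hn (d : R) : 0 < d -> exists N, forall n, (N <= n)%N -> t0 / 2 ^+ n < d.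
  move=> d0; have /cvgr0Pnorm_lt/(_ d d0)[N _ hN] := cvg_inv_exp2 t0.
  by exists N => n Nn; rewrite (le_lt_trans (ler_norm _)) // hN.
have [l ul] : exists l : X, (fun n => D (t0 / 2 ^+ n) x) @ \oo --> l.
  apply: complete_seq => e e0.
  have [g [d [d0 _ hd]]] := claim _ (divr_gt0 e0 (ltr0Sn R 1)).
  have [N hN] := hn d d0; exists N => m n Nm Nn.
  rewrite (le_lt_trans (nrm_sub g _ _)) // (nrmC g) (splitr e).
  by rewrite ltrD // hd // hN.
exists l; apply/right_cvgP => e e0.
have [g [d [d0 _ hd]]] := claim _ (divr_gt0 e0 (ltr0Sn R 1)).
exists d => // h hp hh; rewrite (le_lt_trans (nrm_sub g _ _)) // (splitr e).
rewrite ltr_leD ?hd // nrmC.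
apply: (@nrm_le_lim _ _ _ \oo _ (fun n => D (t0 / 2 ^+ n) x - g)).
  by apply: cvgB => //; exact: cvg_cst.
by have [N hN] := hn d d0; exists N => // n /hN hnd; rewrite ltW // hd.
Qed.

Theorem log_region_differentiable f t : t0 <= t -> orbit_differentiable_at (T ^~ f) t.
Proof.
move=> tt; have [l /right_cvgP hl] := left_quotient_cvg f.
pose r := t - t0; have r0 : 0 <= r by rewrite subr_ge0.
have bR := semigroup_blin CT r0.
have [M M0 hM] := blin_bound bR.
have [M2 M20 hM2] := semigroup_bound CT t0.
apply/orbit_differentiable_atP; exists (T r l) => e e0.
have e1 : 0 < e / M / 2 by rewrite !divr_gt0.
have M21 : 0 < M2 + 1 by rewrite addr_gt0.
have [d1 d10 hd1] := hl _ (divr_gt0 e1 M21).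
have /right_cvgP/(_ _ e1)[d2 d20 hd2] := @semigroup_cvg _ _ _ CT l.
exists (Num.min t0 (Num.min d1 d2)); first by rewrite !lt_min t0_gt0 d10.
move=> s s0 st; rewrite !lt_min => /and3P[st0 sd1 sd2].
have close h : 0 < h -> h < d1 -> nrm (D h f - l) < e / M.
  move=> h0 /(hd1 h h0) /lt_le_trans; apply.
  rewrite ler_pdivrMr // ler_pdivrMr //.
  have := divr_gt0 e0 M0; nra.
have [ts|] := ltrP t s.
  (* For [s > t] the quotient is [T r (T h (D h f))]: [T h] is bounded by [M2] for [h <= t0] and
     [T h l] tends to [l]. The factor [M2 + 1] in [d1] absorbs the former. *)
  pose h := s - t; have h0 : 0 < h by rewrite subr_gt0.
  rewrite gtr0_norm // -/h in st0 sd1 sd2.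
  have bh := semigroup_blin CT (ltW h0).
  have th : 0 <= t0 - h by rewrite subr_ge0 ltW.
  have E : (h^-1)%:C *: (T s f - T t f) = T r (T h (D h f)).
    rewrite /D (blinZ _ _ bh) (blinZ _ _ bR) (blinB _ _ bh) (blinB _ _ bR).
    rewrite -(semigroupD CT _ (ltW h0) (ltW t0_gt0)) -(semigroupD CT _ (ltW h0) th).
    rewrite -(semigroupD CT _ r0 (addr_ge0 (ltW h0) (ltW t0_gt0))).
    rewrite -(semigroupD CT _ r0 (addr_ge0 (ltW h0) th)).
    by congr (_ *: (T _ f - T _ f)); rewrite /r /h; ring.
  rewrite -/h E -(blinB _ _ bR) (le_lt_trans (hM _)) // mulrC -ltr_pdivlMr //.
  rewrite (le_lt_trans (nrm_sub (T h l) _ _)) // -(blinB _ _ bh).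
  have -> : e / M = e / M / 2 + e / M / 2 by rewrite -splitr.
  rewrite ler_ltD ?hd2 // (le_trans (hM2 _ _ (ltW h0) (ltW st0))) //.
  have := hd1 h h0 sd1; rewrite ltr_pdivlMr // => h3.
  have := nrm_ge0 (D h f - l); nra.
rewrite le_eqVlt (negbTE st) /= => ts.
pose h := t - s; have h0 : 0 < h by rewrite subr_gt0.
rewrite distrC gtr0_norm // -/h in st0 sd1 sd2.
have th : 0 <= t0 - h by rewrite subr_ge0 ltW.
have E : ((s - t)^-1)%:C *: (T s f - T t f) = T r (D h f).
  rewrite /D (blinZ _ _ bR) (blinB _ _ bR) -!(semigroupD CT) ?(ltW t0_gt0) //.
  rewrite -(opprB t s) -/h invrN rmorphN scaleNr -scalerN opprB.
  by congr (_ *: (T _ f - T _ f)); rewrite /r /h; ring.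
rewrite E -(blinB _ _ bR) (le_lt_trans (hM _)) // mulrC -ltr_pdivlMr //.
exact: close.
Qed.

End Backward.
End Final.

Theorem corollary6p6 (R : realType) (X : completeNormedModType R[i])
    (dot : {dot X for @Num.conj R[i]})
    (norm_dot : forall x : X, `|x| ^+ 2 = dot x x)
    (A : set (X * X)) (normalA : normal_operator dot A) :
  ((exists2 T : R -> {linear X -> X},
      generates A T & eventually_differentiable T) <->
   (exists w a b : R,
      [/\ 0 < a, 0 < b & spectrum A `<=` log_region w a b])) /\
  (forall T : R -> {linear X -> X},
     generates A T -> eventually_differentiable T ->
     forall t : R, 0 <= t -> normal_operator dot (graph_of (T t))) /\
  (forall w a b : R, 0 < a -> 0 < b -> spectrum A `<=` log_region w a b ->
   forall T : R -> {linear X -> X}, generates A T ->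
   forall (f : X) (t : R), b^-1 <= t -> orbit_differentiable_at (T ^~ f) t).
Proof.
have nA := normal_operator_nop normalA.
split; [split=> [[T gT dT]|[w [a [b [a0 b0 spA]]]]]|split].
- exact: (spectrum_log_region norm_dot nA gT dT).
- have w0 : 0 < Num.max w 1 by rewrite lt_max ltr01 orbT.
  have [|T gT] := ex_semigroup norm_dot nA w0.
    by move=> l /spA /(log_regionP b0)[lw _]; rewrite le_max lw.
  exists T => //; exists b^-1; first by rewrite invr_gt0.
  by move=> f t; exact: (log_region_differentiable norm_dot nA b0 spA gT).
- by move=> T gT _ t; exact: (semigroup_normal norm_dot nA gT).
- move=> w a b _ b0 spA T gT f t.
  exact: (log_region_differentiable norm_dot nA b0 spA gT).
Qed.
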